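(* Let $X$ be an integer-valued random variable and $(S_n)_{n\in\mathbb{N}}$ the associated random walk satisfying the standing assumption given in the context, with variance $\nu\in(0,\infty)$, and let $\Lambda^a_n$ denote its occupation measure at level $a$. Then for every $\kappa>0$, as $n\to\infty$, $$n\,\mathbf{P}[S_n=x,\Lambda^a_n=\ell]=\varphi_\nu\left(\frac{a}{\sqrt n},\frac{x}{\sqrt n},\frac{\ell}{\sqrt n}\right)+o(1)$$ and $$\sqrt n\,\mathbf{P}[\Lambda^a_n=\ell]=\psi_\nu\left(\frac{a}{\sqrt n},\frac{\ell}{\sqrt n}\right)+o(1),$$ where the error terms $o(1)$ are uniform in $x,a\in\mathbb{Z}$ and $\ell\in\mathbb{N}$ such that (1) $\ell\ge\kappa\sqrt n$; (2) $a=0$ or $|a|\ge\kappa\sqrt n$; and (3) $|x-a|=0$ or $|x-a|\ge\kappa\sqrt n$. (That is, the supremum over all such $x,a,\ell$ of the absolute value of each error term tends to $0$ as $n\to\infty$.)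
   Context: $\mathbb{N}=\{1,2,3,\ldots\}$. Standing assumption: $(X_k)_{k\in\mathbb{N}}$ are i.i.d. copies of a random variable $X$ supported on $\mathbb{Z}$ with $\mathbf{E}[X]=0$ and $\mathbf{E}[X^2]=\nu\in(0,\infty)$. The lattice $\mathbb{Z}$ is maximal for $X$, that is, there are no $c,h$ with $h>1$ such that $X$ is supported on $c+h\mathbb{Z}$. The random walk $S_n:=X_1+\cdots+X_n$ ($n\in\mathbb{N}$) is recurrent (i.e., $S_n=0$ for infinitely many $n$ almost surely) and aperiodic (i.e., for every $x\in\mathbb{Z}$ there exists $n\in\mathbb{N}$ such that $\mathbf{P}[S_m=x]>0$ for every $m\ge n$). Occupation measure: $\Lambda_n^a:=\sum_{k=1}^n\mathbf{1}_{\{S_k=a\}}$ for $a\in\mathbb{R}$, $n\in\mathbb{N}$. Limit functions: for $a,x\in\mathbb{R}$ and $\ell>0$, $$\varphi_\nu(a,x,\ell):=\frac{(|a|+|x-a|+\nu\ell)\,e^{-(|a|+|x-a|+\nu\ell)^2/(2\nu)}}{\sqrt{2\pi\nu}},\qquad \psi_\nu(a,\ell):=2\nu\,\frac{e^{-(|a|+\nu\ell)^2/(2\nu)}}{\sqrt{2\pi\nu}}.$$ *)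

(* Defs.v *)
From mathcomp Require Import all_boot all_order all_algebra.
From mathcomp Require Import finmap.
From mathcomp Require Import all_classical all_reals all_analysis.

Set Implicit Arguments.
Unset Strict Implicit.
Unset Printing Implicit Defensive.

Import Order.TTheory GRing.Theory Num.Theory.
Import numFieldNormedType.Exports.

Local Open Scope classical_set_scope.
Local Open Scope ring_scope.

Definition supported_on (d : measure_display) (T : measurableType d)
    (R : realType) (P : probability T R) (X : {RV P >-> R}) (A : set R) : Prop :=
  P (X @^-1` A) = 1%E.

Definition lattice (R : realType) (c h : R) : set R :=
  [set c + h * z%:~R | z in [set: int]].

Definition mutually_independent (d : measure_display) (T : measurableType d)
    (R : realType) (P : probability T R) (X : nat -> {RV P >-> R}) : Prop :=
  forall (J : {fset nat}) (A : nat -> set R), (forall j, measurable (A j)) ->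
    P (\bigcap_(j in [set` J]) (X j @^-1` A j)) =
    (\prod_(j <- J) P (X j @^-1` A j))%E.

(* Laws are compared on measurable sets only: off them, the value of
   [distribution] is unspecified. *)
Definition same_law (d d' : measure_display) (T : measurableType d)
    (T' : measurableType d') (R : realType) (P : probability T R)
    (P' : probability T' R) (X : {RV P >-> R}) (X' : {RV P' >-> R}) : Prop :=
  forall A : set R, measurable A -> distribution P X A = distribution P' X' A.

Definition iid_copies (d d' : measure_display) (T : measurableType d)
    (T' : measurableType d') (R : realType) (P : probability T R)
    (P' : probability T' R) (X : {RV P >-> R}) (Xs : nat -> {RV P' >-> R}) :
    Prop :=
  mutually_independent Xs /\ forall k, same_law (Xs k) X.

(* Steps are indexed from 0: [Xs k] is the (k+1)-st step X_{k+1}, so that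
   [walk Xs n] is S_n = X_1 + ... + X_n. *)
Definition walk (T : Type) (R : realType) (Xs : nat -> T -> R) (n : nat)
    (w : T) : R :=
  \sum_(0 <= k < n) Xs k w.

Definition recurrent (d : measure_display) (T : measurableType d)
    (R : realType) (P : probability T R) (S : nat -> T -> R) : Prop :=
  {ae P, forall w, forall m, exists2 n, (m <= n)%N & S n w = 0}.

Definition aperiodic (d : measure_display) (T : measurableType d)
    (R : realType) (P : probability T R) (S : nat -> T -> R) : Prop :=
  forall x : int, exists n : nat, forall m : nat, (n <= m)%N ->
    (0 < P [set w | S m w = x%:~R])%E.

(* The time 0 is not counted. *)
Definition occupation (T : Type) (R : realType) (S : nat -> T -> R) (n : nat)
    (a : R) (w : T) : nat :=
  (\sum_(1 <= k < n.+1) (S k w == a))%N.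

Definition phi (R : realType) (nu a x l : R) : R :=
  let s := `|a| + `|x - a| + nu * l in
  s * expR (- s ^+ 2 / (2 * nu)) / Num.sqrt (2 * pi * nu).

Definition psi (R : realType) (nu a l : R) : R :=
  2 * nu * (expR (- (`|a| + nu * l) ^+ 2 / (2 * nu)) /
            Num.sqrt (2 * pi * nu)).

Definition admissible (R : realType) (kappa : R) (n : nat)
    (p : int * int * nat) : Prop :=
  let: (x, a, l) := p in
  [/\ (0 < l)%N,
      kappa * Num.sqrt n%:R <= l%:R,
      a = 0 \/ kappa * Num.sqrt n%:R <= `|a%:~R| &
      `|x - a| = 0 \/ kappa * Num.sqrt n%:R <= `|(x - a)%:~R|].

Definition uniform_o1 (R : realType) (I : Type) (D : nat -> set I)
    (err : nat -> I -> R) : Prop :=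
  ereal_sup [set `|err n i|%:E | i in D n] @[n --> \oo] --> 0%E.

(* Main.v *)
(* Reduce the walk modulo N, letting N go to infinity at the very end. On Z/N, write G_y(z) for
   the transform in time of P[S_n = y] and put F = 1 - 1/G_0, the transform of the first return
   time to 0. Then, for l >= 1,
     sum_n z^n P[S_n = x, L_n^a = l] = H F^(l-1) G_{x-a} / G_0,   H = (G_a - 1_{a=0}) / G_0,
   and summing over x replaces G_{x-a} by 1 / (1 - z). Let q be the principal square root of
   1 - z. As q tends to 0, G_y is close to exp(- sqrt(2/nu) |y| q) / (sqrt(2 nu) q) and F to
   1 - sqrt(2 nu) q, so the transforms are close to rho^m, respectively to sqrt(2 nu) rho^m / q,
   with rho = (1 - q) / (1 + q) and 2 m = sqrt(2/nu) (|a| + |x - a| + nu l) up to O(1), the term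
   |x - a| being absent from the second one. Now rho^m and rho^m / q are attached to the lazy
   walk with steps 1, 0, -1: the first passage time at m and the presence at m, whose laws are
   explicit and are estimated through Wallis' integrals. The difference of the transforms is
   small for small q and is O(exp(- c l |q|)) throughout, hence, averaged over the circle of
   radius 1 - 1/(2n), it changes the n-th coefficient by o(1/n), respectively o(1/sqrt n). *)
Require Import Defs.
From mathcomp Require Import all_boot all_order all_algebra.
From mathcomp Require Import all_classical all_reals all_analysis.
From mathcomp Require Import finmap complex measurable_realfun.
From mathcomp Require Import ring lra zify.

Set Implicit Arguments.
Unset Strict Implicit.
Unset Printing Implicit Defensive.

Import Order.TTheory GRing.Theory Num.Theory.
Import numFieldNormedType.Exports.
Import ComplexField.

Local Open Scope classical_set_scope.
Local Open Scope ring_scope.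
Local Open Scope complex_scope.

Local Notation Re := complex.Re.
Local Notation Im := complex.Im.

(** * Complex modulus and roots of unity *)

Section ComplexModulus.
Variable R : realType.
Implicit Types x y z : R[i].

(** Working on Z/N turns Fourier inversion into a finite average over roots of unity, so no integral
    over the circle is ever formed. The bounds hold for N large once z is fixed; this is enough,
    because a coefficient is read off from finitely many z, whose thresholds in N can be merged. The
    lazy walk likewise spares the inversion of exp(- s q): its transforms obey an algebraic
    recursion and its coefficients are binomial.

    The obstacle is uniformity in a, x and l, since transforms are only close for small q. Condition
    (1) overcomes it: l - 1 returns bring a factor |F|^(l-1), of order exp(- c l |q|), which leaves
    only |q| of order 1 / sqrt n. The geometric mean of a small bound eps^2 / C and of the decaying
    bound C exp(- c l |q|) is eps exp(- c l |q| / 2), hence O(eps / (n |1 - z|)^2), and the average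
    of |1 - z|^-2 over the circle is a Poisson sum of order n.

    The decay of |F| rests on |f| <= 1 - c (1 - cos t) for the characteristic function f of a step,
    at all roots of unity with one c; this is where aperiodicity enters. *)

Definition cn x : R := Normc.normc x.
Arguments cn : simpl never.

Lemma cnE x : cn x = Num.sqrt (Re x ^+ 2 + Im x ^+ 2).
Proof. by case: x. Qed.

Lemma cn0 : cn 0 = 0. Proof. exact: Normc.normc0. Qed.
Lemma cn1 : cn 1 = 1. Proof. exact: Normc.normc1. Qed.
Lemma cnM x y : cn (x * y) = cn x * cn y. Proof. exact: Normc.normcM. Qed.
Lemma cnV x : cn x^-1 = (cn x)^-1. Proof. exact: Normc.normcV. Qed.
Lemma cnf_div x y : cn (x / y) = cn x / cn y. Proof. by rewrite cnM cnV. Qed.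
Lemma cnD x y : cn (x + y) <= cn x + cn y. Proof. exact: le_normcD. Qed.
Lemma cnN x : cn (- x) = cn x. Proof. exact: normcN. Qed.

Lemma cn_ge0 x : 0 <= cn x.
Proof. by rewrite cnE sqrtr_ge0. Qed.

Lemma cn_eq0 x : (cn x == 0) = (x == 0).
Proof. by apply/eqP/eqP => [/Normc.eq0_normc|->]; rewrite ?cn0. Qed.

Lemma cn_gt0 x : (0 < cn x) = (x != 0).
Proof. by rewrite lt_def cn_ge0 andbT cn_eq0. Qed.

Lemma cnB x y : cn (x - y) <= cn x + cn y.
Proof. by rewrite -(cnN y); exact: cnD. Qed.

Lemma cn_sym x y : cn (x - y) = cn (y - x).
Proof. by rewrite -cnN opprB. Qed.

Lemma cn_revB x y : cn x - cn y <= cn (x - y).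
Proof. by rewrite lerBlDr -{1}(subrK y x) cnD. Qed.

Lemma cnX x n : cn (x ^+ n) = cn x ^+ n.
Proof. by elim: n => [|n IH]; rewrite ?cn1 // !exprS cnM IH. Qed.

Lemma cn_sum I (s : seq I) (Q : pred I) (F : I -> R[i]) :
  cn (\sum_(i <- s | Q i) F i) <= \sum_(i <- s | Q i) cn (F i).
Proof.
elim/big_ind2: _ => [|a b c d ab cd|//]; first by rewrite cn0.
exact: le_trans (cnD _ _) (lerD ab cd).
Qed.

Lemma cn_real (a : R) : cn a%:C = `|a|.
Proof. by rewrite cnE /= expr0n /= addr0 sqrtr_sqr. Qed.

Lemma cn_realM (a : R) x : 0 <= a -> cn (a%:C * x) = a * cn x.
Proof. by move=> a0; rewrite cnM cn_real ger0_norm. Qed.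

Lemma sqr_cn x : cn x ^+ 2 = Re x ^+ 2 + Im x ^+ 2.
Proof. by rewrite cnE sqr_sqrtr // addr_ge0 ?sqr_ge0. Qed.

Lemma Re_le_cn x : `|Re x| <= cn x.
Proof.
by rewrite cnE -sqrtr_sqr ler_sqrt ?addr_ge0 ?sqr_ge0 // lerDl sqr_ge0.
Qed.

Lemma Im_le_cn x : `|Im x| <= cn x.
Proof.
by rewrite cnE -sqrtr_sqr ler_sqrt ?addr_ge0 ?sqr_ge0 // lerDr sqr_ge0.
Qed.

Lemma cn_le_ReIm x : cn x <= `|Re x| + `|Im x|.
Proof.
have i1 : cn 'i = 1 by rewrite cnE /= expr0n /= expr1n add0r sqrtr1.
by rewrite {1}[x]complexE (le_trans (cnD _ _)) // cnM !cn_real i1 mul1r.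
Qed.

Lemma reCD x y : Re (x + y) = Re x + Re y. Proof. by case: x; case: y => ????. Qed.
Lemma imCD x y : Im (x + y) = Im x + Im y. Proof. by case: x; case: y. Qed.
Lemma reCN x : Re (- x) = - Re x. Proof. by case: x. Qed.
Lemma imCN x : Im (- x) = - Im x. Proof. by case: x. Qed.
Lemma reCM x y : Re (x * y) = Re x * Re y - Im x * Im y.
Proof. by case: x; case: y. Qed.
Lemma imCM x y : Im (x * y) = Re x * Im y + Im x * Re y.
Proof. by case: x; case: y. Qed.

Lemma reC_sum I (s : seq I) (Q : pred I) (F : I -> R[i]) :
  Re (\sum_(i <- s | Q i) F i) = \sum_(i <- s | Q i) Re (F i).
Proof. by elim/big_rec2: _ => [//|i a b _ <-]; rewrite reCD. Qed.

Lemma sqr_cn1B x : cn (1 - x) ^+ 2 = 1 - 2 * Re x + cn x ^+ 2.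
Proof. by rewrite !sqr_cn !reCD !imCD !reCN !imCN /=; ring. Qed.

Lemma sqr_cn1D x : cn (1 + x) ^+ 2 = 1 + 2 * Re x + cn x ^+ 2.
Proof. by rewrite -[x in 1 + x]opprK sqr_cn1B reCN cnN; ring. Qed.

(** Factorization of a difference of powers; the factor (k + 1) c^k is later absorbed by
    [bernoulli_mul]. *)
Lemma cn_expB x y k c : cn x <= c -> cn y <= c ->
  cn (x ^+ k.+1 - y ^+ k.+1) <= k.+1%:R * cn (x - y) * c ^+ k.
Proof.
move=> xc yc; have c0 : 0 <= c := le_trans (cn_ge0 x) xc.
rewrite subrXX cnM [X in _ <= X * _]mulrC -mulrA ler_wpM2l ?cn_ge0 //.
rewrite (le_trans (cn_sum _ _ _)) //.
have -> : k.+1%:R * c ^+ k = \sum_(i < k.+1) c ^+ k.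
  by rewrite sumr_const card_ord mulr_natl.
apply: ler_sum => i _; rewrite cnM !cnX.
have ik : (i <= k)%N by rewrite -ltnS.
rewrite -[in leRHS](subnK ik) exprD.
by apply: ler_pM; rewrite ?exprn_ge0 ?cn_ge0 // lerXn2r ?nnegrE ?cn_ge0.
Qed.

End ComplexModulus.
Arguments cn : simpl never.

(** * Points of the unit circle *)

Section Cis.
Variable R : realType.
Implicit Types t s : R.

Definition cis t : R[i] := cos t +i* sin t.

Lemma cisD t s : cis (t + s) = cis t * cis s.
Proof.
rewrite /cis cosD sinD; apply/eqP; rewrite eq_complex /= eqxx /=.
by apply/eqP; ring.
Qed.

Lemma cis0 : cis 0 = 1. Proof. by rewrite /cis cos0 sin0. Qed.

Lemma cn_cis t : cn (cis t) = 1.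
Proof. by rewrite cnE /= cos2Dsin2 sqrtr1. Qed.

Lemma cis_neq0 t : cis t != 0.
Proof. by rewrite -cn_eq0 cn_cis oner_eq0. Qed.

Lemma cisN t : cis (- t) = (cis t)^-1.
Proof.
by apply: (mulfI (cis_neq0 t)); rewrite -cisD subrr cis0 divff ?cis_neq0.
Qed.

Lemma cisMn t n : cis (t *+ n) = cis t ^+ n.
Proof. by elim: n => [|n IH]; rewrite ?cis0 // mulrS exprS cisD IH. Qed.

Lemma cis2pi : cis (2 * pi) = 1.
Proof. by rewrite mulr_natl /cis cos2pi sin2pi. Qed.

Lemma cis2piz (k : int) : cis (2 * pi * k%:~R) = 1.
Proof.
have H n : cis (2 * pi * n%:R) = 1 by rewrite mulr_natr cisMn cis2pi expr1n.
by case: k => n; rewrite ?H // NegzE mulrNz mulrN cisN H invr1.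
Qed.

Lemma cos_eq1 t : 0 < t < 2 * pi -> cos t != 1.
Proof.
move=> /andP[t0 t2]; have s0 : 0 < sin (t / 2).
  by apply: sin_gt0_pi; rewrite divr_gt0 //= ltr_pdivrMr // mulrC.
have -> : t = (t / 2) *+ 2 by rewrite -mulr_natr divfK.
rewrite cos_mulr2n cos2sin2; apply/negP => /eqP h.
have : sin (t / 2) ^+ 2 > 0 by rewrite exprn_gt0.
by rewrite -mulr_natr in h; lra.
Qed.

Lemma cis_eq1 (N : nat) (k : int) : (0 < N)%N ->
  cis (2 * pi * k%:~R / N%:R) = 1 -> (N %| k)%Z.
Proof.
move=> N0; have Nr : N%:R != 0 :> R by rewrite pnatr_eq0 -lt0n.
rewrite {1}(divz_eq k N) rmorphD rmorphM /=.
set r := (k %% N)%Z; set m := (k %/ N)%Z.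
have -> : 2 * pi * (m%:~R * N%:~R + r%:~R) / N%:R =
    2 * pi * m%:~R + 2 * pi * r%:~R / N%:R :> R.
  by rewrite -pmulrn; field.
rewrite cisD cis2piz mul1r => h.
have r0 : 0 <= r by rewrite modz_ge0 // -lt0n.
have rN : r < N by rewrite -[X in _ < X]/`|Posz N| ltz_mod // -lt0n.
case: (ltgtP 0 r) r0 => // [r0 _|r0 _]; last first.
  by apply/dvdz_mod0P; rewrite -/r -r0.
have /eqP : cos (2 * pi * r%:~R / N%:R) = 1 :> R by case: h.
rewrite (negbTE (cos_eq1 _)) //.
have N0' : 0 < N%:R :> R by rewrite ltr0n.
have p0 := pi_gt0 R.
have r0' : 0 < r%:~R :> R by rewrite ltr0z.
apply/andP; split; first by rewrite !(divr_gt0, mulr_gt0).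
by rewrite ltr_pdivrMr // ltr_pM2l ?mulr_gt0 // pmulrn ltr_int.
Qed.

End Cis.

(** * Fourier averages on Z/N and Poisson kernels *)

Section Torus.
Variable R : realType.

Definition th (N j : nat) : R := 2 * pi * j%:R / N%:R.

Definition avgC (N : nat) (F : nat -> R[i]) : R[i] :=
  N%:R^-1 * \sum_(j < N) F j.

Lemma cis_thD N j (k l : int) :
  cis (th N j * (k + l)%:~R) = cis (th N j * k%:~R) * cis (th N j * l%:~R).
Proof. by rewrite rmorphD mulrDr cisD. Qed.

Lemma cis_thM N j (k : int) : (0 < N)%N -> (N %| k)%Z ->
  cis (th N j * k%:~R) = 1.
Proof.
move=> N0 /dvdzP[m ->]; have Nr : N%:R != 0 :> R by rewrite pnatr_eq0 -lt0n.
have -> : th N j * (m * N)%:~R = 2 * pi * (j%:Z * m)%:~R.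
  by rewrite /th !rmorphM /= -!pmulrn; field.
exact: cis2piz.
Qed.

Lemma cis_th_mod N j (k l : int) : (0 < N)%N -> (N %| k - l)%Z ->
  cis (th N j * k%:~R) = cis (th N j * l%:~R).
Proof.
by move=> N0 kl; rewrite -[k](subrK l) cis_thD cis_thM // mul1r.
Qed.

Lemma sum_cis_th N (k : int) : (0 < N)%N ->
  \sum_(j < N) cis (th N j * k%:~R) = if (N %| k)%Z then N%:R else 0 :> R[i].
Proof.
move=> N0; have Nr : N%:R != 0 :> R by rewrite pnatr_eq0 -lt0n.
case: ifPn => kN.
  under eq_bigr do rewrite cis_thM //.
  by rewrite sumr_const card_ord.
set w : R[i] := cis (2 * pi * k%:~R / N%:R).
have -> : \sum_(j < N) cis (th N j * k%:~R) = \sum_(j < N) w ^+ j.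
  apply: eq_bigr => j _; rewrite /w -cisMn; congr cis.
  by rewrite /th -mulr_natr; field.
have w1 : w - 1 != 0.
  by rewrite subr_eq0; apply: contra kN => /eqP/(cis_eq1 N0).
apply: (mulfI w1); rewrite mulr0 -subrX1 /w -cisMn.
have -> : (2 * pi * k%:~R / N%:R) *+ N = 2 * pi * k%:~R :> R.
  by rewrite -mulr_natr divfK.
by rewrite cis2piz subrr.
Qed.

Lemma natrC (n : nat) : (n%:R : R[i]) = (n%:R)%:C.
Proof. by rewrite -[RHS]/(real_complex R n%:R) rmorph_nat. Qed.

Lemma natC_neq0 n : (0 < n)%N -> n%:R != 0 :> R[i].
Proof. by rewrite pnatr_eq0 -lt0n. Qed.

Definition avg (N : nat) (g : nat -> R) : R := N%:R^-1 * \sum_(j < N) g j.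

Lemma ler_avg N g1 g2 : (forall j, (j < N)%N -> g1 j <= g2 j) ->
  avg N g1 <= avg N g2.
Proof. by move=> h; rewrite ler_wpM2l ?invr_ge0 //; apply: ler_sum => j _; exact: h. Qed.

Lemma avgD N g1 g2 : avg N (fun j => g1 j + g2 j) = avg N g1 + avg N g2.
Proof. by rewrite /avg big_split mulrDr. Qed.

Lemma avgZ N c g : avg N (fun j => c * g j) = c * avg N g.
Proof. by rewrite /avg -mulr_sumr mulrCA. Qed.

Lemma avg_cst N c : (0 < N)%N -> avg N (fun=> c) = c.
Proof.
move=> N0; rewrite /avg sumr_const card_ord -[c *+ N]mulr_natl mulKf //.
by rewrite pnatr_eq0 -lt0n.
Qed.

Lemma cn_avgC N F : cn (avgC N F) <= avg N (fun j => cn (F j)).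
Proof.
rewrite /avgC /avg cnM cnV natrC cn_real ger0_norm // ler_wpM2l ?invr_ge0 //.
exact: cn_sum.
Qed.

Lemma avgC_orth N (k : int) : (0 < N)%N ->
  avgC N (fun j => cis (th N j * k%:~R)) = (N %| k)%Z%:R.
Proof.
move=> N0; rewrite /avgC sum_cis_th //.
by case: ifP; rewrite ?mulr0 // mulVf ?natC_neq0.
Qed.

(** Discrete Fourier inversion. The frequency y is only congruent to the index, so that y may be a
    negative site as well as a time. *)
Lemma avgC_coef N (c : nat -> R[i]) (y : int) (k0 : 'I_N) : (N %| k0%:Z - y)%Z ->
  avgC N (fun j => cis (- (th N j * y%:~R)) * \sum_(k < N) c k * cis (th N j * k%:R))
   = c k0.
Proof.
move=> yk; have N0 : (0 < N)%N by case: N k0 {yk} => // -[].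
rewrite /avgC.
under eq_bigr do rewrite mulr_sumr.
rewrite exchange_big /= (bigD1 k0) //=.
have H (k : 'I_N) : \sum_(j < N) cis (- (th N j * y%:~R)) * (c k * cis (th N j * k%:R))
   = c k * (N %| k%:Z - y)%Z%:R * N%:R.
  rewrite (eq_bigr (fun j : 'I_N => c k * cis (th N j * (k%:Z - y)%:~R))).
    rewrite -mulr_sumr sum_cis_th //.
    by case: ifP; rewrite ?mulr1 // mulr0 mul0r.
  by move=> j _; rewrite mulrCA -mulrN -rmorphN pmulrn -cis_thD addrC.
rewrite H yk mulr1 big1 => [|k kk0].
  by rewrite addr0 mulrCA mulVf ?mulr1 ?natC_neq0.
rewrite H; case: (boolP (N %| k%:Z - y)%Z) => [kN|_]; last by rewrite mulr0 mul0r.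
have : (N %| k%:Z - k0%:Z)%Z.
  by rewrite -[k%:Z](subrK y) -addrA rpredD // -opprB rpredN.
rewrite -eqz_mod_dvd !modz_nat !modn_small //.
by rewrite eqz_nat => /eqP/val_inj e; rewrite e eqxx in kk0.
Qed.

Lemma geo_sum (x : R[i]) n : 1 - x != 0 ->
  \sum_(k < n) x ^+ k = (1 - x ^+ n) / (1 - x).
Proof.
move=> x1; apply: (mulfI x1); rewrite mulrCA divff // mulr1.
by rewrite -opprB mulNr -subrX1 opprB.
Qed.

Lemma cn_lt1_neq (x : R[i]) : cn x < 1 -> 1 - x != 0.
Proof. by rewrite subr_eq0; apply: contraTneq => <-; rewrite cn1 ltxx. Qed.

(** On Z, the coefficients of 1 / ((1 - rho u) (1 - rho / u)) are rho^|k| / (1 - rho^2). Summing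
    them over a class modulo N gives two geometric series, one for each direction of winding. *)
Lemma avgC_kernel N (rho : R[i]) (y : int) : cn rho < 1 -> (`|y| < N)%N ->
  avgC N (fun j => cis (- (th N j * y%:~R)) /
     ((1 - rho * cis (th N j)) * (1 - rho * cis (- th N j)))) =
  (rho ^+ `|y| + rho ^+ (N - `|y|)) / ((1 - rho ^+ 2) * (1 - rho ^+ N)).
Proof.
move=> r1 yN; have N0 : (0 < N)%N by rewrite (leq_ltn_trans _ yN).
have X1 n : (0 < n)%N -> 1 - rho ^+ n != 0.
  by move=> n0; apply: cn_lt1_neq; rewrite cnX exprn_ilt1 ?cn_ge0 -?lt0n.
have rc t : 1 - rho * cis t != 0.
  by apply: cn_lt1_neq; rewrite cnM cn_cis mulr1.
set D := (1 - rho ^+ 2) * (1 - rho ^+ N).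
pose c k := (rho ^+ k + rho ^+ (N - k)) / D.
have D0 : D != 0 by rewrite mulf_neq0 ?X1.
have E j : ((1 - rho * cis (th N j)) * (1 - rho * cis (- th N j)))^-1 =
    \sum_(k < N) c k * cis (th N j * k%:R).
  set u := cis (th N j).
  have u0 : u != 0 := cis_neq0 _.
  have uN : u ^+ N = 1.
    by rewrite /u -cisMn -mulr_natr [_ * _%:R](_ : _ = th N j * (N : int)%:~R) // cis_thM ?dvdzz.
  (* Powers of u and powers of u^-1 are summed apart; u^N = 1 turns u^-k into u^(N - k). *)
  transitivity (D^-1 * (\sum_(k < N) (rho * u) ^+ k +
      rho * u^-1 * \sum_(k < N) (rho * u^-1) ^+ k)); last first.
    have -> : rho * u^-1 * \sum_(k < N) (rho * u^-1) ^+ k =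
        \sum_(k < N) rho ^+ (N - k) * u ^+ k.
      rewrite (reindex_inj rev_ord_inj) /= mulr_sumr; apply: eq_bigr => k _.
      have kN := ltn_ord k.
      rewrite -exprS exprMn exprVn -subSn // subSS; congr (_ * _).
      apply: (mulIf (expf_neq0 (N - k) u0)).
      by rewrite mulVf ?expf_neq0 // -exprD subnKC ?uN // ltnW.
    rewrite -big_split mulr_sumr /=; apply: eq_bigr => k _.
    rewrite mulr_natr cisMn -/u /c exprMn -mulrDl.
    by rewrite mulrC mulrAC.
  rewrite !geo_sum ?rc ?cisN // -?cisN -/u ?rc //.
  rewrite cisN -/u !exprMn exprVn uN invr1 !mulr1.
  have h1 := rc (th N j); have h2 := rc (- th N j).
  rewrite cisN -/u in h1 h2.
  rewrite /D; field.
  have hh : u - rho != 0.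
    by apply: contra h2 => /eqP h; rewrite -[rho](subKr u) h subr0 divff // subrr.
  by rewrite !X1 // h1 u0 hh.
(* A negative y is represented by N - |y|, and c is symmetric under k -> N - k. *)
have : exists2 k0 : 'I_N, (N %| k0%:Z - y)%Z & c k0 = c `|y|%N.
  case: y yN => y yN /=; first by exists (Ordinal yN); rewrite ?subrr ?dvdz0.
  have h : (N - y.+1 < N)%N by rewrite -subn_gt0 subKn // ltnW.
  exists (Ordinal h) => /=.
    by rewrite NegzE opprK -PoszD subnK ?dvdzz // ltnW.
  by rewrite /c subKn 1?addrC // ltnW.
case=> k0 k0y ck; rewrite -/(c `|y|%N) -ck -(avgC_coef _ k0y).
by congr (_ * _); apply: eq_bigr => j _; rewrite E.
Qed.

Lemma cn_1Bcis (r t : R) :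
  cn (1 - r%:C * cis t) ^+ 2 = (1 - r) ^+ 2 + 2 * r * (1 - cos t).
Proof.
by rewrite sqr_cn1B cnM cn_cis cn_real mulr1 real_normK ?num_real ?reCM /=; ring.
Qed.

Lemma avgC_real N (g : nat -> R) : avgC N (fun j => (g j)%:C) = (avg N g)%:C.
Proof. by rewrite /avgC /avg natrC -fmorphV -rmorph_sum -rmorphM. Qed.

Lemma avgC_Re N (F : nat -> R[i]) : Re (avgC N F) = avg N (fun j => Re (F j)).
Proof. by rewrite /avgC /avg natrC -fmorphV reCM /= mul0r subr0 reC_sum. Qed.

(** The case y = 0 of [avgC_kernel]: for real rho the two factors are conjugate. *)
Lemma avg_poisson N (r : R) : (0 < N)%N -> 0 <= r < 1 ->
  avg N (fun j => (cn (1 - r%:C * cis (th N j)) ^+ 2)^-1) =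
  (1 + r ^+ N) / ((1 - r ^+ 2) * (1 - r ^+ N)).
Proof.
move=> N0 /andP[r0 r1].
have cr : cn r%:C < 1 by rewrite cn_real ger0_norm.
have := @avgC_kernel N r%:C 0 cr N0.
rewrite expr0 subn0 => H; apply: complexI.
apply: etrans (esym (avgC_real _ _)) _.
rewrite fmorph_div !rmorphM !rmorphB rmorphD rmorph1 !rmorphXn /= -H.
congr (_ * _); apply: eq_bigr => j _; rewrite mulr0z mulr0 oppr0 cis0 mul1r.
have -> : (1 - r%:C * cis (th N j)) * (1 - r%:C * cis (- th N j)) =
   (cn (1 - r%:C * cis (th N j)) ^+ 2)%:C.
  rewrite cn_1Bcis /cis cosN sinN; apply/eqP; rewrite eq_complex /=.
  have h := cos2Dsin2 (th N j).
  apply/andP; split; apply/eqP; last by ring.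
  set c := cos _ in h *; set s := sin _ in h *.
  have -> : r * c - 0 * s = r * c by ring.
  suff : s ^+ 2 = 1 - c ^+ 2 by move=> hs; ring: hs.
  by rewrite -h; ring.
by rewrite -fmorphV.
Qed.

Lemma near_exp_le (r e : R) : 0 <= r < 1 -> 0 < e ->
  \forall N \near \oo, r ^+ N <= e.
Proof.
move=> /andP[r0 r1] e0.
have /cvgrPdist_le /(_ _ e0) : (fun n => r ^+ n) @ \oo --> (0 : R).
  by apply: cvg_expr; rewrite ger0_norm.
by apply: filterS => n; rewrite sub0r normrN ger0_norm ?exprn_ge0.
Qed.

Lemma near_avg_poisson (r : R) : 0 <= r < 1 ->
  \forall N \near \oo,
    avg N (fun j => (cn (1 - r%:C * cis (th N j)) ^+ 2)^-1) <= 2 / (1 - r ^+ 2).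
Proof.
move=> r01; have /andP[r0 r1] := r01.
have e3 : 0 < 3^-1 :> R by [].
near=> N.
have N0 : (0 < N)%N by near: N; exists 1%N.
(* At s = 1/3 the ratio (1 + s) / (1 - s) is 2. *)
have rN : r ^+ N <= 3^-1 by near: N; exact: near_exp_le.
have rN0 : 0 <= r ^+ N by rewrite exprn_ge0.
have r2 : r ^+ 2 < 1 by rewrite expr_lt1.
rewrite avg_poisson // invfM mulrA mulrAC ler_pM2r ?invr_gt0 ?subr_gt0 //.
by rewrite ler_pdivrMr; lra.
Unshelve. all: by end_near. Qed.

(** Comparison with the Poisson kernel of radius 1 - h / 2, whose denominator h^2 / 4 + (2 - h) b is
    at most 2 (h^2 + b), where b = 1 - cos t. *)
Lemma near_avg_lap (h : R) : 0 < h <= 2 ->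
  \forall N \near \oo,
    avg N (fun j => (h ^+ 2 + (1 - cos (th N j)))^-1) <= 8 / h.
Proof.
move=> /andP[h0 h2]; pose r := 1 - h / 2.
have r01 : 0 <= r < 1 by apply/andP; split; rewrite /r; lra.
have H : 0 < (1 - r ^+ 2) by rewrite subr_gt0 expr_lt1; have /andP[] := r01.
pose P N j := (cn (1 - r%:C * cis (th N j)) ^+ 2)^-1.
near=> N.
have hA : avg N (P N) <= 2 / (1 - r ^+ 2) by near: N; exact: near_avg_poisson.
apply: le_trans (_ : 2 * avg N (P N) <= _); last first.
  rewrite (le_trans (ler_wpM2l _ hA)) // mulrA ler_pdivrMr // mulrAC.
  by rewrite ler_pdivlMr // /r; nra.
rewrite -avgZ; apply: ler_avg => j _.
rewrite /P cn_1Bcis; set b := 1 - cos _.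
have b0 : 0 <= b by rewrite subr_ge0 cos_le1.
have h20 : 0 < h ^+ 2 by rewrite exprn_gt0.
have r0 : 0 <= 2 * r * b by rewrite !mulr_ge0 //; have /andP[] := r01.
have r1 : 0 < (1 - r) ^+ 2 by rewrite exprn_gt0 // subr_gt0; have /andP[] := r01.
have K0 : 0 < (1 - r) ^+ 2 + 2 * r * b by rewrite ltr_wpDr.
have B0 : 0 < h ^+ 2 + b by rewrite ltr_wpDr.
rewrite -[leLHS]mul1r ler_pdivrMr // mulrAC ler_pdivlMr // mul1r.
by rewrite /r; nra.
Unshelve. all: by end_near. Qed.

End Torus.

(** * The complex exponential and powers close to it *)

Section ComplexExp.
Variable R : realType.

Lemma sin_mvt (y : R) : 0 < y -> exists2 c, 0 < c < y & sin y = cos c * y.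
Proof.
move=> y0.
have d (x : R) : x \in `]0, y[%R -> is_derive x 1 sin (cos x) by move=> _; exact: is_derive_sin.
have ct : {within `[0, y], continuous (@sin R)}.
  by apply: continuous_subspaceT => x; exact: continuous_sin.
have [c] := MVT y0 d ct.
by rewrite in_itv /= sin0 !subr0 => cy e; exists c.
Qed.

Lemma sin_le (y : R) : `|sin y| <= `|y|.
Proof.
have pos (x : R) : 0 < x -> `|sin x| <= `|x| :> R.
  move=> x0; have [c _ ->] := sin_mvt x0.
  by rewrite normrM ler_piMl // cos_max.
case: (ltgtP y 0) => [y0|/pos //|->]; last by rewrite sin0.
by have := pos (- y); rewrite sinN !normrN oppr_gt0; apply.
Qed.

Lemma cos_ge (y : R) : 1 - cos y <= y ^+ 2 / 2.
Proof.
have {1}-> : y = (y / 2) *+ 2 by rewrite -mulr_natr divfK.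
rewrite cos_mulr2n cos2sin2.
have : sin (y / 2) ^+ 2 <= (y / 2) ^+ 2.
  by rewrite -[leLHS]real_normK ?num_real // -[leRHS]real_normK ?num_real // lerXn2r ?nnegrE // sin_le.
by rewrite -mulr_natr; lra.
Qed.

Lemma sinB_le (y : R) : `|y| <= 1 -> `|sin y - y| <= y ^+ 2.
Proof.
have pos (x : R) : 0 < x -> x <= 1 -> `|sin x - x| <= x ^+ 2 :> R.
  move=> x0 x1; have [c /andP[c0 cx] ->] := sin_mvt x0.
  rewrite -[X in _ - X]mul1r -mulrBl normrM (gtr0_norm x0) distrC.
  rewrite ger0_norm ?subr_ge0 ?cos_le1 // expr2 ler_pM2r //.
  by apply: le_trans (cos_ge c) _; nra.
case: (ltgtP y 0) => [y0|y0|->].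
- rewrite ltr0_norm // => y1; have := pos (- y).
  by rewrite sinN sqrrN -opprD normrN oppr_gt0; apply.
- by rewrite gtr0_norm // => /(pos _ y0).
- by rewrite sin0 subr0 normr0.
Qed.

Lemma expRB1_le (x : R) : `|x| <= 2^-1 -> `|expR x - 1 - x| <= 2 * x ^+ 2.
Proof.
rewrite ler_norml => /andP[x1 x2].
have h1 := expR_ge1Dx x; have h2 := expR_ge1Dx (- x).
rewrite expRN in h2; have e0 := expR_gt0 x.
have h3 : expR x * (1 - x) <= 1.
  by rewrite -[leRHS](@divff _ (expR x)) ?gt_eqF // ler_pM2l.
rewrite ger0_norm; last by lra.
nra.
Qed.

Definition cexp (w : R[i]) : R[i] := (expR (Re w))%:C * cis (Im w).

Lemma cexpD v w : cexp (v + w) = cexp v * cexp w.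
Proof. by rewrite /cexp reCD imCD expRD cisD rmorphM /=; ring. Qed.

Lemma cn_cexp w : cn (cexp w) = expR (Re w).
Proof. by rewrite /cexp cn_realM ?expR_ge0 // cn_cis mulr1. Qed.

Lemma cexp0 : cexp 0 = 1.
Proof. by rewrite /cexp expR0 cis0 mulr1. Qed.

Lemma cexpX w k : cexp (w *+ k) = cexp w ^+ k.
Proof. by elim: k => [|k IH]; rewrite ?cexp0 // mulrS exprS cexpD IH. Qed.

Lemma cexp_lin w : cn w <= 2^-1 -> cn (cexp w - 1 - w) <= 9 * cn w ^+ 2.
Proof.
move=> w2; have := Re_le_cn w; have := Im_le_cn w; have := sqr_cn w.
case: w w2 => x y /=; set W := cn _ => W2 WE yW xW.
have x2 : `|x| <= 2^-1 := le_trans xW W2.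
have y2 : `|y| <= 2^-1 := le_trans yW W2.
apply: le_trans (cn_le_ReIm _) _; rewrite /cexp !reCD !imCD reCM imCM /= !mul0r !subr0 !addr0.
have e1 := expRB1_le x2; have s1 := sin_le y.
have s2 : `|sin y - y| <= y ^+ 2 by apply: sinB_le; lra.
have c1 := cos_ge y; have c2 := cos_le1 y.
have e0 := expR_gt0 x.
have xx : x ^+ 2 <= 4^-1 by rewrite -real_normK ?num_real //; have := normr_ge0 x; nra.
have e2 : expR x <= 2.
  by move: e1 x2; rewrite !ler_norml => /andP[_ h] /andP[_ h']; lra.
have ex1 : `|expR x - 1| <= 2 * `|x|.
  have -> : expR x - 1 = (expR x - 1 - x) + x by ring.
  apply: le_trans (ler_normD _ _) _.
  by move: e1; rewrite -[x ^+ 2]real_normK ?num_real //; have := normr_ge0 x; nra.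
have r1 : `|expR x * cos y - 1 - x| <= 2 * x ^+ 2 + y ^+ 2.
  have -> : expR x * cos y - 1 - x = (expR x - 1 - x) - expR x * (1 - cos y) by ring.
  apply: le_trans (ler_normB _ _) _; apply: lerD => //.
  have c3 : 0 <= 1 - cos y by rewrite subr_ge0.
  rewrite ger0_norm ?mulr_ge0 ?(ltW e0) //.
  have : expR x * (1 - cos y) <= 2 * (1 - cos y) by rewrite ler_wpM2r.
  lra.
have r2 : `|expR x * sin y - y| <= 2 * `|x| * `|y| + y ^+ 2.
  have -> : expR x * sin y - y = (expR x - 1) * sin y + (sin y - y) by ring.
  apply: le_trans (ler_normD _ _) _; apply: lerD => //.
  by rewrite normrM ler_pM.
apply: le_trans (lerD r1 r2) _.
have : 2 * `|x| * `|y| <= x ^+ 2 + y ^+ 2.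
  rewrite -[x ^+ 2]real_normK ?num_real // -[y ^+ 2]real_normK ?num_real //.
  by have := sqr_ge0 (`|x| - `|y|); rewrite sqrrB -mulr_natr; nra.
have := sqr_ge0 x; have := sqr_ge0 y; lra.
Qed.

Lemma cexpB v w : Re v <= 0 -> cn (w - v) <= 2^-1 -> cn (cexp w - cexp v) <= 6 * cn (w - v).
Proof.
move=> v0 wv; have -> : w = v + (w - v) by ring.
rewrite cexpD (_ : _ - _ = cexp v * (cexp (w - v) - 1)); last by ring.
rewrite cnM cn_cexp [v + _]addrC addrK.
apply: le_trans (_ : cn (cexp (w - v) - 1) <= _).
  by rewrite ler_piMl ?cn_ge0 // expR_le1.
have -> : cexp (w - v) - 1 = (cexp (w - v) - 1 - (w - v)) + (w - v) by ring.
apply: le_trans (cnD _ _) _; have := cexp_lin wv; have := cn_ge0 (w - v); nra.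
Qed.

(** (1 - s)^k is the least of the k + 1 terms of a geometric sum bounded by 1 / s. *)
Lemma bernoulli_mul (s : R) k : 0 < s <= 1 -> k.+1%:R * (1 - s) ^+ k <= s^-1.
Proof.
move=> /andP[s0 s1]; have t0 : 0 <= 1 - s by rewrite subr_ge0.
have := subrX1 (1 - s) k.+1.
have h : k.+1%:R * (1 - s) ^+ k <= \sum_(i < k.+1) (1 - s) ^+ i.
  have -> : k.+1%:R * (1 - s) ^+ k = \sum_(i < k.+1) (1 - s) ^+ k.
    by rewrite sumr_const card_ord mulr_natl.
  apply: ler_sum => i _; apply: ler_wiXn2l => //; first by lra.
  by rewrite -ltnS.
move: (\sum_(_ < _) _) h => S h e.
apply: le_trans h _; rewrite -[leLHS]mulr1 -[leRHS]mul1r ler_pdivlMr //.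
have : 0 <= (1 - s) ^+ k.+1 by rewrite exprn_ge0.
nra.
Qed.

(** Uniformity in k: since |q| <= 2 Re q, both u and exp(- c q) have modulus at most 1 - s with s =
    c |q| / 8. They differ by a small multiple of |q|, and [bernoulli_mul] bounds the factor (k + 1)
    (1 - s)^k by 1 / s, which cancels this |q|. *)
Lemma pow_cexp (c e : R) : 0 < c -> 0 < e -> exists2 d, 0 < d &
  forall q : R[i], 0 < cn q -> cn q <= 2 * Re q -> cn q < d ->
  forall u, cn (u - (1 - c%:C * q)) <= d * cn q ->
  forall k, cn (u ^+ k - cexp (- ((c * k%:R)%:C * q))) <= e.
Proof.
move=> c0 e0.
(* In turn: for |u| <= 1 - s, for d |q| <= e s / 2, for the range where [cexp_lin] applies, and for
   its quadratic error to be at most e s / 2. *)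
pose d := Num.min (Num.min (c / 8) (e * c / 16)) (Num.min ((72 * c)^-1) (e / (144 * c))).
have d0 : 0 < d.
  by rewrite !lt_min !divr_gt0 ?mulr_gt0 //= invr_gt0 mulr_gt0.
have [d1 d2 d3 d4] : [/\ d <= c / 8, d <= e * c / 16, d <= (72 * c)^-1 & d <= e / (144 * c)].
  by split; rewrite !ge_min lexx ?orbT.
exists d => // q q0 qR qd u ud [|k].
  by rewrite mulr0 mul0r oppr0 cexp0 subrr cn0 ltW.
set w := - (c%:C * q).
have -> : - ((c * k.+1%:R)%:C * q) = w *+ k.+1.
  by rewrite /w mulNrn -[in RHS]mulr_natr natrC rmorphM; congr (- _); ring.
rewrite cexpX; set v := cexp w.
have cq : c * cn q <= 72^-1.
  move: qd => /lt_le_trans /(_ d3); rewrite invfM ltr_pdivlMr // mulrC.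
  exact: ltW.
have cq0 : 0 < c * cn q by rewrite mulr_gt0.
have wE : cn w = c * cn q by rewrite cnN cn_realM // ltW.
have vl : cn (v - 1 - w) <= 9 * (c * cn q) ^+ 2.
  by rewrite -wE; apply: cexp_lin; rewrite wE; lra.
have l1 : cn (1 + w) <= 1 - c * cn q / 4.
  rewrite -(@ler_pXn2r _ 2) ?nnegrE ?cn_ge0 //; last by lra.
  have -> : cn (1 + w) ^+ 2 = 1 - c * (2 * Re q) + (c * cn q) ^+ 2.
    by rewrite sqr_cn1D wE /w reCN reCM /=; ring.
  have : c * cn q <= c * (2 * Re q) by rewrite ler_wpM2l // ltW.
  move: (c * cn q) cq0 cq => x x0 x2; nra.
pose s := c * cn q / 8.
have s01 : 0 < s <= 1 by rewrite /s; apply/andP; split; lra.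
have u1 : cn u <= 1 - s.
  have -> : u = (1 + w) + (u - (1 - c%:C * q)) by rewrite /w; ring.
  apply: le_trans (cnD _ _) _.
  have : d * cn q <= c / 8 * cn q by rewrite ler_pM2r.
  by rewrite /s; lra.
have v1 : cn v <= 1 - s.
  have -> : v = (1 + w) + (v - 1 - w) by ring.
  apply: le_trans (cnD _ _) _; rewrite /s.
  by move: (c * cn q) cq0 cq l1 vl => x x0 x2 l1 vl; nra.
apply: le_trans (cn_expB _ u1 v1) _.
have uv : cn (u - v) <= d * cn q + 9 * (c * cn q) ^+ 2.
  have -> : u - v = (u - (1 - c%:C * q)) - (v - 1 - w) by rewrite /w; ring.
  by apply: le_trans (cnB _ _) _; exact: lerD.
rewrite mulrAC; apply: le_trans (ler_wpM2r (cn_ge0 _) (bernoulli_mul k s01)) _.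
rewrite mulrC ler_pdivrMr; last by case/andP: s01.
apply: le_trans uv _; rewrite /s.
have : d * cn q <= e * c / 16 * cn q by rewrite ler_pM2r.
have : 9 * (c * cn q) ^+ 2 <= e * (c * cn q) / 16.
  have : cn q <= e / (144 * c) := le_trans (ltW qd) d4.
  rewrite ler_pdivlMr ?mulr_gt0 // => h.
  have {h} : 144 * (c * cn q) <= e by rewrite (le_trans _ h) //; lra.
  by move: (c * cn q) cq0 => x x0; nra.
lra.
Qed.

End ComplexExp.

(** * The walk modulo N and its transforms *)

Section TorusWalk.
Variables (R : realType) (N : nat) (p : int -> R) (f : nat -> R[i]).
Hypothesis N0 : (0 < N)%N.
Hypothesis p_ge0 : forall x, 0 <= p x.
Hypothesis p_sum1 : forall x, \sum_(r < N) p (x - r%:Z) = 1.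
Hypothesis p_fourier : forall j (x : int),
  \sum_(r < N) (p (x - r%:Z))%:C * cis (- (th R N j * r%:R)) =
  f j * cis (- (th R N j * x%:~R)).

Definition conv (h : int -> R[i]) (x : int) : R[i] :=
  \sum_(r < N) (p (x - r%:Z))%:C * h r.

Lemma cn_conv h x K : (forall r, cn (h r) <= K) -> cn (conv h x) <= K.
Proof.
move=> hK; rewrite (le_trans (cn_sum _ _ _)) //.
rewrite -[leRHS]mul1r -(p_sum1 x) mulr_suml; apply: ler_sum => r _.
by rewrite cn_realM // ler_wpM2l.
Qed.

Lemma cn_f j : cn (f j) <= 1.
Proof.
have := p_fourier j 0; rewrite mulr0z mulr0 oppr0 cis0 mulr1 => <-.
by apply: (@cn_conv (fun r => cis (- (th R N j * r%:~R))) 0) => r; rewrite cn_cis.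
Qed.

Lemma f_0 : f 0%N = 1.
Proof.
have := p_fourier 0 0; rewrite /th mulr0 !mul0r oppr0 cis0 mulr1 => <-.
rewrite -(rmorph1 (real_complex R)) -(p_sum1 0) rmorph_sum.
by apply: eq_bigr => r _; rewrite mul0r oppr0 cis0 mulr1.
Qed.

Variable z : R[i].
Hypothesis z_lt1 : cn z < 1.

Lemma cn_zf j : cn (z * f j) < 1.
Proof.
by rewrite cnM (le_lt_trans _ z_lt1) // ler_piMr ?cn_ge0 // cn_f.
Qed.

(* Transform in time of the law, modulo [N], of the walk started at 0. *)
Definition green (x : int) : R[i] :=
  avgC N (fun j => cis (- (th R N j * x%:~R)) / (1 - z * f j)).

Lemma cn_green x : cn (green x) <= (1 - cn z)^-1.
Proof.
rewrite (le_trans (cn_avgC _ _)) // -(avg_cst (1 - cn z)^-1 N0).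
apply: ler_avg => j _; rewrite cnf_div cn_cis mul1r.
rewrite lef_pV2 ?posrE ?subr_gt0 ?cn_gt0 ?cn_lt1_neq ?cn_zf //.
apply: le_trans (cn_revB _ _); rewrite cn1 lerB // cnM ler_piMr ?cn_ge0 //.
exact: cn_f.
Qed.

Lemma green_mod x y : (N %| x - y)%Z -> green x = green y.
Proof.
move=> xy; congr (_ * _); apply: eq_bigr => j _.
by rewrite !cisN (cis_th_mod R j N0 xy).
Qed.

Lemma avgC_orthN (x : int) :
  avgC N (fun j => cis (- (th R N j * x%:~R))) = (N %| x)%Z%:R.
Proof.
rewrite -rpredN -avgC_orth //; congr (_ * _); apply: eq_bigr => j _.
by rewrite rmorphN mulrN.
Qed.

(** The resolvent equation: convolution multiplies the j-th mode by f j, and z f / (1 - z f) = 1 /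
    (1 - z f) - 1. *)
Lemma conv_green a x :
  z * conv (fun r => green (r - a)) x = green (x - a) - (N %| x - a)%Z%:R.
Proof.
rewrite -avgC_orthN -[green (x - a)]/(_ * _) -mulrBr -sumrB.
rewrite /conv; under eq_bigr do rewrite mulrCA mulr_sumr.
rewrite -mulr_sumr exchange_big mulrCA /=; congr (_ * _).
rewrite mulr_sumr; apply: eq_bigr => j _ /=.
have nz : 1 - z * f j != 0 by apply: cn_lt1_neq; exact: cn_zf.
transitivity (z * cis (th R N j * a%:~R) / (1 - z * f j) *
   \sum_(r < N) (p (x - r%:Z))%:C * cis (- (th R N j * r%:R))).
  rewrite !mulr_sumr; apply: eq_bigr => r _.
  by rewrite rmorphB mulrBr opprB cisD; ring.
rewrite p_fourier rmorphB mulrBr opprB cisD; field.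
exact: nz.
Qed.

(** Only the frequency 0, where f is 1, survives the sum over x. *)
Lemma sum_green a : \sum_(x < N) green (x%:Z - a) = (1 - z)^-1.
Proof.
have z1 : 1 - z != 0 by apply: cn_lt1_neq.
rewrite -mulr_sumr exchange_big /=.
rewrite (eq_bigr (fun j : 'I_N => cis (th R N j * a%:~R) / (1 - z * f j) *
   (N%:R * (N %| j)%:R))) => [|j _]; last first.
  transitivity (cis (th R N j * a%:~R) / (1 - z * f j) *
      \sum_(r < N) cis (- (th R N r * j%:Z%:~R))).
    rewrite mulr_sumr; apply: eq_bigr => r _.
    rewrite rmorphB mulrBr opprB cisD mulrAC; congr (_ * cis (- _)).
    by rewrite /th; ring.
  congr (_ * _); apply: (mulfI (invr_neq0 (natC_neq0 R N0))).
  by rewrite [LHS]avgC_orthN mulKf ?natC_neq0.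
rewrite (bigD1 (Ordinal N0)) //= dvdn0 mulr1 big1 ?addr0 => [|j].
  rewrite /th mulr0 !mul0r cis0 f_0 mulr1 mul1r mulrCA mulVf ?mulr1 //.
  exact: natC_neq0.
rewrite -val_eqE /= -lt0n => j0.
by rewrite gtnNdvd // !mulr0.
Qed.

(** The left side is Re ((1 + w) / (1 - w)). Its positivity is what keeps [green 0] away from 0. *)
Lemma Re_inv1B (w : R[i]) : cn w < 1 ->
  2 * Re (1 - w)^-1 - 1 = (1 - cn w ^+ 2) / cn (1 - w) ^+ 2.
Proof.
move=> w1; have := cn_lt1_neq w1; rewrite -cn_gt0 => w0.
have -> : Re (1 - w)^-1 = (1 - Re w) / cn (1 - w) ^+ 2.
  by rewrite sqr_cn; case: (w) => a b /=.
have w00 : cn (1 - w) ^+ 2 != 0 by rewrite expf_neq0 // gt_eqF.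
apply: (mulIf w00); rewrite divfK // mulrBl mul1r -mulrA divfK //.
by rewrite sqr_cn1B; ring.
Qed.

Lemma Re_green0 :
  2 * Re (green 0) - 1 =
  avg N (fun j => (1 - cn (z * f j) ^+ 2) / cn (1 - z * f j) ^+ 2).
Proof.
have -> : green 0 = avgC N (fun j => (1 - z * f j)^-1).
  by congr (_ * _); apply: eq_bigr => j _; rewrite mulr0z mulr0 oppr0 cis0 mul1r.
rewrite -[X in _ - X](avg_cst 1 N0) /avgC /avg natrC -fmorphV reCM /= mul0r subr0.
rewrite reC_sum mulrCA -mulrBr mulr_sumr -sumrB; congr (_ * _).
by apply: eq_bigr => j _; rewrite Re_inv1B ?cn_zf.
Qed.

Lemma Re_green0_ge : 1 <= 2 * Re (green 0).
Proof.
rewrite -subr_ge0 Re_green0 mulr_ge0 ?invr_ge0 // sumr_ge0 // => j _.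
by rewrite divr_ge0 ?exprn_ge0 ?cn_ge0 // subr_ge0 expr_le1 ?cn_ge0 // ltW // cn_zf.
Qed.

Lemma green0_neq0 : green 0 != 0.
Proof.
apply/negP => /eqP h; have := Re_green0_ge.
by rewrite h /= mulr0 ler10.
Qed.

(* Transform of the law of the first return time to 0. *)
Definition ret : R[i] := 1 - (green 0)^-1.

(** An identity for g = [green 0], valid for any g != 0: |1 - 1/g|^2 = 1 - (2 Re g - 1) / |g|^2. It
    turns a lower bound on Re g and an upper bound on |g| into a contraction factor for each
    return. *)
Lemma sqr_cn_ret :
  cn ret ^+ 2 = 1 - (2 * Re (green 0) - 1) / cn (green 0) ^+ 2.
Proof.
have g0 := green0_neq0; have := g0; rewrite -cn_gt0 => /lt0r_neq0 g1.
have -> : ret = (green 0 - 1) / green 0 by rewrite /ret; field.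
rewrite cnf_div expr_div_n cn_sym sqr_cn1B; field.
exact: g1.
Qed.

Lemma cn_ret : cn ret <= 1.
Proof.
rewrite -(@ler_pXn2r _ 2) ?nnegrE ?cn_ge0 // sqr_cn_ret expr1n gerBl.
by rewrite divr_ge0 ?exprn_ge0 ?cn_ge0 // subr_ge0 Re_green0_ge.
Qed.

Lemma cn_invgreen0 : cn (green 0)^-1 <= 2.
Proof.
rewrite cnV -[leRHS]invrK lef_pV2 ?posrE ?invr_gt0 ?cn_gt0 ?green0_neq0 //.
have := Re_green0_ge; have := Re_le_cn (green 0); have := ler_norm (Re (green 0)).
lra.
Qed.

Variable a : int.

(* Transform of the law of the first positive time at which the walk is at [a]. *)
Definition hit : R[i] := (green a - (N %| a)%Z%:R) / green 0.

(* Transform of the event that the l-th visit to [a] has just taken place. *)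
Definition visit (l : nat) : R[i] :=
  if l is l'.+1 then ret ^+ l' * hit / green 0 else - hit.

(** Last-exit decomposition: [green (x - a) / green 0] is the transform of the paths that leave a
    for x without coming back. For l = 0 the paths that have hit a are subtracted, whence [- hit] in
    [visit]. *)
Definition occ_gf (x : int) (l : nat) : R[i] :=
  (l == 0)%N%:R * green x + visit l * green (x - a).

(* How the joint law [h] of position and number of visits to [a] evolves in one step, [K]
   averaging over the increment. *)
Definition step (V : zmodType) (K : (int -> V) -> int -> V)
   (h : int -> nat -> V) (x : int) (l : nat) : V :=
  if (N %| x - a)%Z then (if l is l'.+1 then K (h^~ l') x else 0)
  else K (h^~ l) x.

Lemma conv_visit l x : z * conv (fun r => green r *+ (l == 0)%N + visit l * green (r - a)) x =
  (green x - (N %| x)%Z%:R) *+ (l == 0)%N + visit l * (green (x - a) - (N %| x - a)%Z%:R).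
Proof.
rewrite -(conv_green a x); have := conv_green 0 x; rewrite subr0 => <-.
rewrite /conv !mulr_sumr -sumrMnl -big_split /=; apply: eq_bigr => r _.
by rewrite subr0; case: (l == 0)%N; rewrite ?mulr1n ?mulr0n ?mul1r ?mul0r; ring.
Qed.

Lemma occ_gfE l : occ_gf^~ l = (fun r => green r *+ (l == 0)%N + visit l * green (r - a)).
Proof. by apply/funext => r; rewrite /occ_gf mulr_natl. Qed.

(** Replaces the strong Markov property: the renewal formula is not derived but checked against the
    one-step evolution. Away from a this is the resolvent equation with sources 0 and a; at a it is
    what the formulas for [hit] and [ret] are made for. *)
Lemma occ_gf_step x l :
  occ_gf x l = ((N %| x)%Z && (l == 0)%N)%:R + z * step conv occ_gf x l.
Proof.
have g0 := green0_neq0.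
rewrite /step; case: ifPn => xa; last first.
  rewrite occ_gfE conv_visit (negbTE xa) subr0 /occ_gf mulr_natl.
  case: (l == 0)%N; rewrite ?andbT ?andbF ?mulr1n ?mulr0n ?mul1r ?mul0r.
    by ring.
  by rewrite !add0r.
have Gx : green x = green a by exact: green_mod.
have Gxa : green (x - a) = green 0 by apply: green_mod; rewrite subr0.
have Nx : (N %| x)%Z = (N %| a)%Z by rewrite -{1}[x](subrK a) rpredDl.
case: l => [|l].
  rewrite mulr0 addr0 andbT /occ_gf /= Gx Gxa Nx /hit; field.
  exact: g0.
rewrite andbF add0r occ_gfE conv_visit Gx Gxa xa Nx /occ_gf Gxa mul0r add0r.
case: l => [|l] /=; rewrite ?mulr1n ?mulr0n /ret /hit.
  by field.
by rewrite exprS; move: (_ ^+ l) => c; field.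
Qed.

Variable mu : nat -> int -> nat -> R.
Hypothesis mu0 : forall x l, mu 0 x l = ((N %| x)%Z && (l == 0)%N)%:R.
Hypothesis muS : forall n x l,
  mu n.+1 x l = step (fun h x => \sum_(r < N) p (x - r%:Z) * h r) (mu n) x l.

(** The difference with a partial sum obeys the recursion without its source, so that each step
    gains a factor |z|. The power series is thus identified without any theory of convergence. *)
Lemma occ_gf_partial K l : (forall x l', (l' <= l)%N -> cn (occ_gf x l') <= K) ->
  forall M x l', (l' <= l)%N ->
  cn (occ_gf x l' - \sum_(k < M) z ^+ k * (mu k x l')%:C) <= K * cn z ^+ M.
Proof.
move=> hK; elim=> [|M IH] x l' ll'; first by rewrite big_ord0 subr0 mulr1 hK.
pose e x l' := occ_gf x l' - \sum_(k < M) z ^+ k * (mu k x l')%:C.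
have E : occ_gf x l' - \sum_(k < M.+1) z ^+ k * (mu k x l')%:C = z * step conv e x l'.
  rewrite big_ord_recl mul1r mu0 occ_gf_step rmorph_nat opprD addrACA subrr add0r.
  rewrite (eq_bigr (fun k : 'I_M => z * (z ^+ k * (step (fun h x =>
     \sum_(r < N) p (x - r%:Z) * h r) (mu k) x l')%:C))) => [|k _].
    rewrite -mulr_sumr -mulrBr; congr (_ * _).
    have C h g y : conv (fun r => h r - \sum_(k < M) z ^+ k * (g k r)%:C) y =
       conv h y - \sum_(k < M) z ^+ k * (\sum_(r < N) p (y - r%:Z) * g k r%:Z)%:C.
      rewrite /conv; under eq_bigr do rewrite mulrBr mulr_sumr.
      rewrite sumrB exchange_big /=; congr (_ - _); apply: eq_bigr => k _.
      rewrite rmorph_sum mulr_sumr; apply: eq_bigr => r _.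
      by rewrite rmorphM mulrCA.
    rewrite /step; case: ifP => _; last by rewrite C.
    case: l' ll' => [|l'] _; last by rewrite C.
    by rewrite big1 ?subr0 // => k _; rewrite rmorph0 mulr0.
  by rewrite muS exprS mulrA.
rewrite E cnM exprS mulrCA ler_wpM2l ?cn_ge0 // /step.
have K0 : 0 <= K * cn z ^+ M := le_trans (cn_ge0 _) (IH x l' ll').
case: ifP => _; last by apply: cn_conv => r; exact: IH.
by case: l' ll' {E} => [|l'] ll'; rewrite ?cn0 //; apply: cn_conv => r; exact/IH/ltnW.
Qed.

Lemma cn_hit : cn hit <= 2 * ((1 - cn z)^-1 + 1).
Proof.
rewrite /hit cnM mulrC ler_pM ?cn_ge0 ?cn_invgreen0 //.
rewrite (le_trans (cnB _ _)) // lerD ?cn_green //.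
by case: (_ %| _)%Z; rewrite ?cn1 ?cn0.
Qed.

(** A crude bound free of N, x, a and l; its size is immaterial because it comes multiplied by
    |z|^M. *)
Definition occ_bound : R :=
  (1 - cn z)^-1 + 4 * ((1 - cn z)^-1 + 1) * (1 - cn z)^-1.

Lemma cn_occ_gf x l : cn (occ_gf x l) <= occ_bound.
Proof.
have b0 : 0 <= (1 - cn z)^-1 by rewrite invr_ge0 subr_ge0 ltW.
rewrite (le_trans (cnD _ _)) // lerD //.
  by case: eqP => _; rewrite ?mul1r ?mul0r ?cn_green ?cn0.
rewrite cnM ler_pM ?cn_ge0 ?cn_green //.
have := cn_hit; rewrite /visit; case: l => [|l] h.
  by rewrite cnN; lra.
rewrite cnM cnM.
have h1 : cn (ret ^+ l) <= 1 by rewrite cnX exprn_ile1 ?cn_ge0 ?cn_ret.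
have := cn_invgreen0; have := cn_ge0 hit; have := cn_ge0 (green 0)^-1.
move: (cn hit) (cn _^-1) (cn (ret ^+ l)) h h1 (cn_ge0 (ret ^+ l)) => A B C.
move=> h h1 C0 B0 A0 B2; rewrite -mulrA.
apply: le_trans (_ : A * B <= _); first by rewrite ler_piMl ?mulr_ge0.
by apply: le_trans (ler_pM A0 B0 h B2) _; lra.
Qed.

Lemma visit_partial x l M : 
  cn (visit l.+1 * green (x - a) - \sum_(k < M) z ^+ k * (mu k x l.+1)%:C)
    <= occ_bound * cn z ^+ M.
Proof.
have -> : visit l.+1 * green (x - a) = occ_gf x l.+1 by rewrite /occ_gf mul0r add0r.
by apply: (occ_gf_partial (l := l.+1)) => // x' l' _; exact: cn_occ_gf.
Qed.

Lemma visit_sum_partial l M :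
  cn (visit l.+1 / (1 - z) - \sum_(k < M) z ^+ k * (\sum_(x < N) mu k x%:Z l.+1)%:C)
    <= N%:R * (occ_bound * cn z ^+ M).
Proof.
rewrite -(sum_green a) mulr_sumr.
under [X in _ - X]eq_bigr do rewrite rmorph_sum mulr_sumr.
rewrite exchange_big -sumrB (le_trans (cn_sum _ _ _)) //= mulr_natl.
rewrite -[N in leRHS]card_ord -sumr_const; apply: ler_sum => x _.
exact: visit_partial.
Qed.

End TorusWalk.

(** * Asymptotics of the transforms for small q, and decay for all q *)

Section Estimates.
Variables (R : realType) (f : R -> R[i]) (p : nat -> int -> R) (nu C1 c2 : R).
Hypothesis p_ge0 : forall N x, 0 <= p N x.
Hypothesis p_sum1 : forall N, (0 < N)%N -> forall x, \sum_(r < N) p N (x - r%:Z) = 1.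
Hypothesis p_fourier : forall N, (0 < N)%N -> forall j (x : int),
  \sum_(r < N) (p N (x - r%:Z))%:C * cis (- (th R N j * r%:R)) =
  f (th R N j) * cis (- (th R N j * x%:~R)).
Hypothesis nu_gt0 : 0 < nu.
Hypothesis C1_gt0 : 0 < C1.
Hypothesis c2_gt0 : 0 < c2.

Local Notation b t := (1 - cos t).
Hypothesis f_upper : forall t, cn (1 - f t) <= C1 * b t.
Hypothesis f_lower : forall N j, (1 < N)%N -> cn (f (th R N j)) <= 1 - c2 * b (th R N j).
Hypothesis f_taylor : forall e, 0 < e -> exists2 d, 0 < d &
  forall t, b t < d -> cn (1 - f t - (nu * b t)%:C) <= e * b t.

(* [q] is the principal square root of [1 - z]. *)
Definition disk (z q : R[i]) := [/\ cn z < 1, q ^+ 2 = 1 - z & 0 < Re q].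

Section Disk.
Variables z q : R[i].
Hypothesis zq : disk z q.

Lemma disk_lt1 : cn z < 1. Proof. by case: zq. Qed.

Lemma disk_cn1B : cn (1 - z) = cn q ^+ 2.
Proof. by case: zq => _ <- _; rewrite cnX. Qed.

Lemma disk_Re2 : 0 < Re (q ^+ 2).
Proof.
case: zq => z1 -> _; rewrite reCD reCN /= subr_gt0.
by rewrite (le_lt_trans _ z1) // (le_trans (ler_norm _)) // Re_le_cn.
Qed.

Lemma disk_gt0 : 0 < cn q.
Proof.
by case: zq => _ _ q0; apply: lt_le_trans (Re_le_cn q); rewrite normr_gt0 gt_eqF.
Qed.

(** Re (q^2) = Re (1 - z) > 0 puts q in the sector of half-angle pi / 4, where even |q| <= sqrt 2 Re
    q. *)
Lemma disk_Re : cn q <= 2 * Re q.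
Proof.
have q0 : 0 < Re q by case: zq.
rewrite -(@ler_pXn2r _ 2) ?nnegrE ?cn_ge0 ?mulr_ge0 ?ltW //.
have := disk_Re2; rewrite expr2 reCM sqr_cn; nra.
Qed.

Lemma disk_le2 : cn q <= 2.
Proof.
have := disk_cn1B; have := cnB 1 z; rewrite cn1; have := disk_lt1.
by have := cn_ge0 q; nra.
Qed.

End Disk.

Lemma b_ge0 (t : R) : 0 <= b t.
Proof. by rewrite subr_ge0 cos_le1. Qed.

Lemma cn_f1 N j : (0 < N)%N -> cn (f (th R N j)) <= 1.
Proof.
by move=> N0; exact: (@cn_f R N (p N) (fun j => f (th R N j))) (p_ge0 N) (p_sum1 N0) (p_fourier N0) j.
Qed.

Definition c3 : R := (1 + (C1 + 1) / c2)^-1.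

Lemma c3_gt0 : 0 < c3.
Proof. by rewrite invr_gt0 addr_gt0 // divr_gt0 // addr_gt0. Qed.

Lemma ic3_ge0 : 0 <= c3^-1.
Proof. by have := c3_gt0; rewrite -invr_gt0 => /ltW. Qed.

(** |1 - z f| is at least c2 b and at least |q|^2 - C1 b. Adding (C1 + 1) / c2 times the first bound
    to the second leaves |q|^2 + b, whence the value of [c3]. *)
Lemma resolvent_lower z q N j : disk z q -> (1 < N)%N ->
  c3 * (cn q ^+ 2 + b (th R N j)) <= cn (1 - z * f (th R N j)).
Proof.
move=> zq N1; have z1 := disk_lt1 zq; set t := th R N j.
have fl := f_lower j N1; have fu := f_upper t; have f1 := cn_f1 j (ltnW N1).
rewrite -/t in fl f1.
have D1 : c2 * b t <= cn (1 - z * f t).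
  apply: le_trans (cn_revB _ _); rewrite cn1 cnM.
  by have := cn_ge0 (f t); have := cn_ge0 z; nra.
have D2 : cn q ^+ 2 - C1 * b t <= cn (1 - z * f t).
  have -> : 1 - z * f t = (1 - z) - - (z * (1 - f t)) by ring.
  apply: le_trans (cn_revB _ _); rewrite (disk_cn1B zq) cnN cnM lerB //.
  by apply: le_trans fu; rewrite ler_piMl ?cn_ge0 // ltW.
rewrite /c3 ler_pdivrMl; last by rewrite -invr_gt0; exact: c3_gt0.
have bE : b t <= cn (1 - z * f t) / c2 by rewrite ler_pdivlMr // mulrC.
have -> : (1 + (C1 + 1) / c2) * cn (1 - z * f t) =
    cn (1 - z * f t) + (C1 + 1) * (cn (1 - z * f t) / c2) by ring.
have : C1 * b t <= C1 * (cn (1 - z * f t) / c2) by rewrite ler_wpM2l // ltW.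
lra.
Qed.

Local Notation G N z y := (green N (fun j => f (th R N j)) z y).

Lemma near_avg_resolvent z q : disk z q ->
  \forall N \near \oo, avg N (fun j => (cn q ^+ 2 + b (th R N j))^-1) <= 8 / cn q.
Proof.
by move=> zq; apply: near_avg_lap; rewrite (disk_gt0 zq) (disk_le2 zq).
Qed.

Lemma qb_gt0 z q t : disk z q -> 0 < cn q ^+ 2 + b t.
Proof. by move=> zq; rewrite ltr_pwDl ?b_ge0 // exprn_gt0 // (disk_gt0 zq). Qed.

Lemma green_upper z q : disk z q ->
  \forall N \near \oo, forall y, cn (G N z y) <= (8 / c3) / cn q.
Proof.
move=> zq; near=> N => y.
have N1 : (1 < N)%N by near: N; exists 2%N.
rewrite (le_trans (cn_avgC _ _)) //.
have -> : 8 / c3 / cn q = c3^-1 * (8 / cn q) by ring.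
apply: le_trans (_ : c3^-1 * avg N (fun j => (cn q ^+ 2 + b (th R N j))^-1) <= _).
  rewrite -avgZ; apply: ler_avg => j _.
  rewrite cnf_div cn_cis mul1r -invfM lef_pV2 ?posrE ?resolvent_lower //.
    by apply: lt_le_trans (resolvent_lower j zq N1); rewrite mulr_gt0 ?c3_gt0 ?(qb_gt0 _ zq).
  by rewrite mulr_gt0 ?c3_gt0 ?(qb_gt0 _ zq).
rewrite ler_wpM2l ?ic3_ge0 //.
by near: N; exact: (near_avg_resolvent zq).
Unshelve. all: by end_near. Qed.

Lemma avg_b N : (1 < N)%N -> avg N (fun j => b (th R N j)) = 1.
Proof.
move=> N1; have N0 : (0 < N)%N by exact: ltnW.
have := @avgC_orth R N 1 N0; rewrite (_ : (N %| 1)%Z = false); last first.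
  by rewrite dvdz1 absz_nat; case: N N1 {N0} => [|[]].
move=> /(congr1 (@complex.Re R)); rewrite avgC_Re /= => h.
have {}h : avg N (fun j => cos (th R N j)) = 0.
  by rewrite -h; congr (_ * _); apply: eq_bigr => j _; rewrite mulr1.
by rewrite -[RHS](avg_cst 1 N0) -[RHS]subr0 -h /avg sumrB mulrBr.
Qed.

(** Meant for q away from 0. In [Re_green0] the numerators are at least c2 b and the denominators at
    most 4, and b has mean 1. *)
Lemma green0_Re_lower z q N : disk z q -> (1 < N)%N ->
  c2 / 4 <= 2 * Re (G N z 0) - 1.
Proof.
move=> zq N1; have N0 := ltnW N1; have z1 := disk_lt1 zq.
rewrite (Re_green0 N0 (p_ge0 N) (p_sum1 N0) (p_fourier N0) z1).
have -> : c2 / 4 = avg N (fun j => c2 / 4 * b (th R N j)) by rewrite avgZ avg_b ?mulr1.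
apply: ler_avg => j _.
set t := th R N j; have fl := f_lower j N1; rewrite -/t in fl.
have zf := cn_zf (p_ge0 N) (p_sum1 N0) (p_fourier N0) z1 j; rewrite -/t in zf.
have h1 : 0 < cn (1 - z * f t) by rewrite cn_gt0 cn_lt1_neq.
have h2 : cn (1 - z * f t) <= 2.
  by rewrite (le_trans (cnB _ _)) // cn1; lra.
have h3 : cn (z * f t) <= 1 - c2 * b t.
  by apply: le_trans fl; rewrite cnM ler_piMl ?cn_ge0 // ltW.
rewrite ler_pdivlMr ?exprn_gt0 //.
have := b_ge0 t; have := cn_ge0 (z * f t); move: (cn _) (cn (z * _)) h1 h2 h3 zf => x y.
move=> x0 x2 yb y1 y0 b0.
have cb : 0 <= c2 * b t by rewrite mulr_ge0 // ltW.
have x4 : x ^+ 2 <= 4 by nra.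
have : c2 / 4 * b t * x ^+ 2 <= c2 / 4 * b t * 4.
  by rewrite ler_wpM2l // mulr_ge0 // divr_ge0 // ltW.
have : y ^+ 2 <= y by rewrite expr2 ler_piMl // ltW.
lra.
Qed.

(** The decay rate of G_y in |y| q. The recurring product nu * c1 is sqrt(2 nu). *)
Definition c1 : R := Num.sqrt (2 / nu).

Lemma c1_gt0 : 0 < c1.
Proof. by rewrite sqrtr_gt0 divr_gt0. Qed.

Lemma sqr_c1 : c1 ^+ 2 = 2 / nu.
Proof. by rewrite sqr_sqrtr // divr_ge0 // ltW. Qed.

(** Parameter of a nearest-neighbour model in space: by [kernel_K] its kernel is exactly q^2 + nu
    rho1 b, close to 1 - z f, and [avgC_kernel] inverts it in closed form. *)
Definition rho1 (q : R[i]) : R[i] := 1 - c1%:C * q.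

Lemma cn_1B_le (c : R) q : 0 <= c -> cn q <= 2 * Re q -> c * cn q <= 2^-1 ->
  cn (1 - c%:C * q) <= 1 - c * cn q / 4.
Proof.
move=> c0 qq cq; have q0 := cn_ge0 q.
have cq0 : 0 <= c * cn q by rewrite mulr_ge0.
rewrite -(@ler_pXn2r _ 2) ?nnegrE ?cn_ge0 //; last by lra.
have -> : cn (1 - c%:C * q) ^+ 2 = 1 - c * (2 * Re q) + (c * cn q) ^+ 2.
  rewrite sqr_cn1B cnM cn_real ger0_norm // reCM /=; ring.
have : c * cn q <= c * (2 * Re q) by rewrite ler_wpM2l.
move: (c * cn q) cq0 cq => x x0 x2; nra.
Qed.

(** As Re (q^2) > 0, the modulus of q^2 + nu b exceeds both |q|^2 and nu b; the factor rho1 perturbs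
    it by at most nu b / 4. *)
Lemma K_lower z q t : disk z q -> c1 * cn q <= 4^-1 ->
  Num.min 2^-1 (nu / 4) * (cn q ^+ 2 + b t) <=
  cn (q ^+ 2 + nu%:C * rho1 q * (b t)%:C).
Proof.
move=> zq c1q; have b0 := b_ge0 t; have R2 := disk_Re2 zq.
set w := q ^+ 2 + (nu * b t)%:C.
have -> : q ^+ 2 + nu%:C * rho1 q * (b t)%:C = w - nu%:C * c1%:C * q * (b t)%:C.
  by rewrite /w /rho1 rmorphM; ring.
have nb0 : 0 <= nu * b t by rewrite mulr_ge0 // ltW.
have w1 : cn q ^+ 2 <= cn w.
  rewrite -cnX -(@ler_pXn2r _ 2) ?nnegrE ?cn_ge0 // !sqr_cn /w reCD imCD /=; nra.
have w2 : nu * b t <= cn w.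
  rewrite (le_trans _ (Re_le_cn w)) // (le_trans _ (ler_norm _)) //.
  by rewrite /w reCD /= lerDr ltW.
apply: le_trans (cn_revB _ _); rewrite !cnM !cn_real !ger0_norm ?(ltW c1_gt0) ?(ltW nu_gt0) //.
have -> : nu * c1 * cn q * b t = (c1 * cn q) * (nu * b t) by ring.
have : (c1 * cn q) * (nu * b t) <= 4^-1 * (nu * b t) by rewrite ler_wpM2r.
have q0 : 0 <= cn q ^+ 2 by rewrite exprn_ge0 ?cn_ge0.
set m := Num.min _ _.
have m1 : m <= 2^-1 by rewrite ge_min lexx.
have m2 : m <= nu / 4 by rewrite ge_min lexx orbT.
have : m * cn q ^+ 2 <= 2^-1 * cn q ^+ 2 by rewrite ler_wpM2r.
have : m * b t <= nu / 4 * b t by rewrite ler_wpM2r.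
lra.
Qed.

Lemma kernel_K q t : (nu / 2)%:C *
  ((1 - rho1 q * cis t) * (1 - rho1 q * cis (- t))) =
  q ^+ 2 + nu%:C * rho1 q * (b t)%:C.
Proof.
have ct : cis t + cis (- t) = 2 * (cos t)%:C.
  rewrite /cis cosN sinN; apply/eqP; rewrite eq_complex /=; apply/andP.
  by split; apply/eqP; ring.
have -> : (1 - rho1 q * cis t) * (1 - rho1 q * cis (- t)) =
   1 - rho1 q * (cis t + cis (- t)) + rho1 q ^+ 2 * (cis t * cis (- t)) by ring.
rewrite ct -cisD subrr cis0 rmorphB rmorph1.
have n2 : (nu / 2)%:C = nu%:C / 2 :> R[i] by rewrite rmorphM fmorphV rmorph_nat.
have cc : c1%:C ^+ 2 = 2 / nu%:C :> R[i].
  by rewrite -rmorphXn /= sqr_c1 rmorphM fmorphV rmorph_nat.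
have nn : nu%:C != 0 :> R[i] by rewrite -cn_eq0 cn_real normr_eq0 gt_eqF.
rewrite n2 mulr1.
transitivity (nu%:C / 2 * (c1%:C ^+ 2) * q ^+ 2 + nu%:C * rho1 q * (1 - (cos t)%:C)).
  by rewrite /rho1; field.
by rewrite cc; field.
Qed.

(** With L = |q|^2 + b, the difference is at most a constant times (o(b) + O(|q| b)) / L^2. For
    small b this is e / L. For larger b the Taylor bound is lost, but L is bounded below and the
    loss goes into D, harmless after multiplication by q. *)
Lemma resolvent_diff e : 0 < e -> exists2 d, 0 < d & exists D, forall z q N j,
  disk z q -> c1 * cn q <= 4^-1 -> cn q < d -> (1 < N)%N ->
  cn ((1 - z * f (th R N j))^-1 -
      (q ^+ 2 + nu%:C * rho1 q * (b (th R N j))%:C)^-1) <=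
  e * (cn q ^+ 2 + b (th R N j))^-1 + D.
Proof.
move=> e0; set m := Num.min 2^-1 (nu / 4).
have m0 : 0 < m by rewrite lt_min invr_gt0 /= ltr0n divr_gt0.
have c30 := c3_gt0.
pose k := (c3 * m)^-1.
have k0 : 0 < k by rewrite invr_gt0 mulr_gt0.
pose e' := e / 2 / k.
have e'0 : 0 < e' by rewrite !divr_gt0.
have [d' d'0 hd'] := f_taylor e'0.
pose C := nu * c1 + 2 * C1.
have C0 : 0 < C by rewrite addr_gt0 ?mulr_gt0 ?c1_gt0.
exists (e' / C); first by rewrite divr_gt0.
exists (k * (C1 + nu) / d') => z q N j zq c1q qd N1.
set t := th R N j; set L := cn q ^+ 2 + b t.
have L0 : 0 < L by exact: qb_gt0 zq.
have b0 := b_ge0 t; have q0 := cn_ge0 q; have q2 := disk_le2 zq.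
set x := 1 - z * f t; set y := q ^+ 2 + _.
have xL : c3 * L <= cn x by exact: resolvent_lower.
have yL : m * L <= cn y by exact: K_lower zq c1q.
have x0 : 0 < cn x by apply: lt_le_trans xL; rewrite mulr_gt0.
have y0 : 0 < cn y by apply: lt_le_trans yL; rewrite mulr_gt0.
have -> : x^-1 - y^-1 = (y - x) / (x * y).
  by field; rewrite -!cn_gt0 x0 y0.
have yx : cn (y - x) <= cn (1 - f t - (nu * b t)%:C) + C * cn q * b t.
  have -> : y - x = - (1 - f t - (nu * b t)%:C) + (q ^+ 2 * (1 - f t) - nu%:C * c1%:C * q * (b t)%:C).
    by rewrite /y /x /rho1 rmorphM; case: zq => _ -> _; ring.
  rewrite (le_trans (cnD _ _)) // cnN lerD2l (le_trans (cnB _ _)) //.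
  rewrite !cnM !cn_real !ger0_norm ?(ltW c1_gt0) ?(ltW nu_gt0) //.
  have : cn q * cn q * cn (1 - f t) <= 2 * cn q * (C1 * b t).
    by rewrite ler_pM ?cn_ge0 ?mulr_ge0 ?f_upper //; nra.
  rewrite /C; lra.
have kL : cn ((y - x) / (x * y)) <= k * (cn (y - x) / L ^+ 2).
  rewrite cnf_div cnM mulrCA ler_wpM2l ?cn_ge0 //.
  rewrite /k -invfM lef_pV2 ?posrE ?mulr_gt0 // ?exprn_gt0 //.
  by rewrite expr2 mulrACA ler_pM // ?mulr_ge0 ?ltW.
apply: le_trans kL _.
have bL : b t / L <= 1 by rewrite ler_pdivrMr // mul1r lerDr exprn_ge0.
have qC : C * cn q * b t <= e' * b t.
  by rewrite ler_wpM2r // mulrC -ler_pdivlMr // ltW.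
have L2 : 0 < L ^+ 2 by rewrite exprn_gt0.
case: (ltP (b t) d') => hb.
  apply: le_trans (_ : k * (2 * e' * (b t / L) * L^-1) <= _).
    rewrite ler_wpM2l ?(ltW k0) // ler_pdivrMr //.
    have -> : 2 * e' * (b t / L) / L * L ^+ 2 = 2 * e' * b t.
      by field; rewrite gt_eqF.
    by apply: le_trans yx _; have := hd' t hb; lra.
  have -> : k * (2 * e' * (b t / L) / L) = e * (b t / L) / L.
    by rewrite /e'; field; rewrite !gt_eqF.
  rewrite -[leLHS]addr0 lerD //; last first.
    by rewrite divr_ge0 ?(ltW d'0) // mulr_ge0 ?(ltW k0) // addr_ge0 // ltW.
  by rewrite ler_pM2r ?invr_gt0 // ler_piMr // ltW.
apply: le_trans (_ : k * ((C1 + nu + e') * (b t / L) * L^-1) <= _).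
  rewrite ler_wpM2l ?(ltW k0) // ler_pdivrMr //.
  have -> : (C1 + nu + e') * (b t / L) / L * L ^+ 2 = (C1 + nu + e') * b t.
    by field; rewrite gt_eqF.
  apply: le_trans yx _.
  have : cn (1 - f t - (nu * b t)%:C) <= C1 * b t + nu * b t.
    by rewrite (le_trans (cnB _ _)) // lerD ?f_upper // cn_real ger0_norm // mulr_ge0 // ltW.
  lra.
have Ld : L^-1 <= d'^-1.
  by rewrite lef_pV2 ?posrE // (le_trans hb) // lerDr exprn_ge0.
have -> : k * ((C1 + nu + e') * (b t / L) / L) =
   k * (C1 + nu) * ((b t / L) * L^-1) + (e / 2) * ((b t / L) * L^-1).
  by rewrite /e'; field; rewrite !gt_eqF.
have Li : 0 <= L^-1 by rewrite invr_ge0 ltW.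
have H1 : (b t / L) * L^-1 <= L^-1 by rewrite ler_piMl.
rewrite addrC lerD //.
  apply: le_trans (_ : e / 2 * L^-1 <= _); first by rewrite ler_pM2l ?divr_gt0.
  by rewrite ler_wpM2r //; lra.
by rewrite ler_pM2l ?(le_trans H1) // mulr_gt0 // addr_gt0.
Qed.

Lemma cn_rho1 z q : disk z q -> c1 * cn q <= 4^-1 -> cn (rho1 q) < 1.
Proof.
move=> zq c1q; apply: le_lt_trans (cn_1B_le (ltW c1_gt0) (disk_Re zq) _) _.
  by apply: le_trans c1q _; lra.
by have := mulr_gt0 c1_gt0 (disk_gt0 zq); lra.
Qed.

Definition g0 : R := (nu * c1)^-1.

Lemma g0_gt0 : 0 < g0.
Proof. by rewrite invr_gt0 mulr_gt0 // c1_gt0. Qed.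

Lemma near_exp_sub (r e : R) y : 0 <= r < 1 -> 0 < e ->
  \forall N \near \oo, r ^+ (N - y) <= e.
Proof.
move=> r01 e0; have [M _ hM] := near_exp_le r01 e0.
by exists (M + y)%N => //= N MN; apply: hM => /=; rewrite leq_subRL // ?(leq_trans (leq_addl _ _) MN) // addnC.
Qed.

(** With s = c1 q, the closed form contains 1 - rho1^2 = s (2 - s). The errors are the periodic
    images rho1^(N - |y|) and rho1^N, and s itself, from replacing 2 - s by 2. *)
Lemma kernel_main q N (y : int) : cn (rho1 q) < 1 -> q != 0 -> (`|y| < N)%N ->
  c1 * cn q <= 4^-1 -> cn (rho1 q ^+ N) <= 2^-1 ->
  cn (q * avgC N (fun j => cis (- (th R N j * y%:~R)) /
      (q ^+ 2 + nu%:C * rho1 q * (b (th R N j))%:C)) - g0%:C * rho1 q ^+ `|y|)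
  <= 4 * g0 * (cn (rho1 q) ^+ (N - `|y|) + cn (rho1 q) ^+ N + c1 * cn q).
Proof.
move=> r1 q0 yN c1q wN.
have nn : nu%:C != 0 :> R[i] by rewrite -cn_eq0 cn_real normr_eq0 gt_eqF.
have cc : c1%:C != 0 :> R[i] by rewrite -cn_eq0 cn_real normr_eq0 gt_eqF ?c1_gt0.
have c2E : nu%:C * c1%:C ^+ 2 = 2 :> R[i].
  by rewrite -rmorphXn /= sqr_c1 rmorphM fmorphV rmorph_nat; field.
have -> : avgC N (fun j => cis (- (th R N j * y%:~R)) /
      (q ^+ 2 + nu%:C * rho1 q * (b (th R N j))%:C)) =
    (nu / 2)%:C^-1 * ((rho1 q ^+ `|y| + rho1 q ^+ (N - `|y|)) /
                      ((1 - rho1 q ^+ 2) * (1 - rho1 q ^+ N))).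
  rewrite -avgC_kernel // /avgC mulrCA; congr (_ * _).
  rewrite mulr_sumr; apply: eq_bigr => j _.
  by rewrite -kernel_K invfM mulrCA.
set s := c1%:C * q; set u := rho1 q ^+ `|y|; set v := rho1 q ^+ (N - _); set w := rho1 q ^+ N.
have sE : cn s = c1 * cn q by rewrite cnM cn_real ger0_norm // ltW // c1_gt0.
have s2 : 1 <= cn (2 - s).
  apply: le_trans (cn_revB _ _); rewrite sE.
  have -> : cn (2 : R[i]) = 2 by rewrite natrC cn_real ger0_norm.
  by lra.
have w2 : 2^-1 <= cn (1 - w) by apply: le_trans (cn_revB _ _); rewrite cn1 -/w in wN *; lra.
have s0 : 2 - s != 0 by rewrite -cn_gt0; lra.
have w0 : 1 - w != 0 by rewrite -cn_gt0; lra.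
have -> : 1 - rho1 q ^+ 2 = s * (2 - s) by rewrite /rho1 -/s; ring.
have n2 : (nu / 2)%:C = nu%:C / 2 :> R[i] by rewrite rmorphM fmorphV rmorph_nat.
have -> : q * ((nu / 2)%:C^-1 * ((u + v) / (s * (2 - s) * (1 - w)))) - g0%:C * u =
   g0%:C * ((2 * v + u * s + 2 * (u * w) - u * s * w) / ((2 - s) * (1 - w))).
  have gE : g0%:C = (nu%:C * c1%:C)^-1 :> R[i] by rewrite fmorphV rmorphM.
  rewrite n2 gE /s; field.
  by rewrite cc nn -/s s0 w0 q0.
have u1 : cn u <= 1 by rewrite cnX exprn_ile1 ?cn_ge0 // ltW.
have w1 : cn w <= 1 by rewrite cnX exprn_ile1 ?cn_ge0 // ltW.
have g00 := ltW g0_gt0.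
rewrite cn_realM // [leRHS](_ : _ = g0 * (4 * (cn (rho1 q) ^+ (N - `|y|) + cn (rho1 q) ^+ N + c1 * cn q))); last by ring.
rewrite ler_wpM2l //.
rewrite cnf_div ler_pdivrMr; last by rewrite cn_gt0 mulf_neq0.
rewrite -!cnX -/v -/w -sE.
have D0 : 2^-1 <= cn ((2 - s) * (1 - w)).
  by rewrite cnM; move: (cn (2 - s)) (cn (1 - w)) s2 w2 => x y' *; nra.
have X0 : 0 <= cn v + cn w + cn s by rewrite !addr_ge0 ?cn_ge0.
apply: le_trans (_ : 2 * (cn v + cn w + cn s) <= _); last first.
  by move: (cn (_ * _)) D0 => d d2; nra.
have c2' : cn (2 : R[i]) = 2 by rewrite natrC cn_real ger0_norm.
apply: le_trans (cnB _ _) _; apply: le_trans (lerD (cnD _ _) (lexx _)) _.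
apply: le_trans (lerD (lerD (cnD _ _) (lexx _)) (lexx _)) _.
rewrite !(cnM 2) !(cnM u) !(cnM (u * s)) (cnM u s) c2'.
have h1 : cn u * cn s <= cn s by rewrite ler_piMl ?cn_ge0.
have h2 : cn u * cn w <= cn w by rewrite ler_piMl ?cn_ge0.
have h3 : cn u * cn s * cn w <= cn s.
  by apply: le_trans h1; rewrite ler_piMr ?mulr_ge0 ?cn_ge0.
lra.
Qed.

(** The factor q is the natural normalization: it removes D, and it balances the average of 1 / L,
    which is at most 8 / |q|; hence the share e / 24 = (e / 3) / 8. *)
Lemma green_near e : 0 < e -> exists2 d, 0 < d & forall z q, disk z q -> cn q < d ->
  forall y : int, \forall N \near \oo,
    cn (q * G N z y - g0%:C * rho1 q ^+ `|y|) <= e.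
Proof.
move=> e0; have g00 := g0_gt0; have c10 := c1_gt0.
have e24 : 0 < e / 24 by rewrite divr_gt0.
have [d1 d10 [D hD]] := resolvent_diff e24.
have D0 : 0 < `|D| + 1 by rewrite ltr_wpDl.
pose k := e / (24 * g0).
have k0 : 0 < k by rewrite divr_gt0 // mulr_gt0.
exists (Num.min (Num.min d1 (4^-1 / c1)) (Num.min (e / 6 / (`|D| + 1)) (k / c1))).
  have i4 : 0 < 4^-1 :> R by rewrite invr_gt0.
  have e6 : 0 < e / 6 by rewrite divr_gt0.
  have := divr_gt0 i4 c10; have := divr_gt0 k0 c10; have := divr_gt0 e6 D0.
  by rewrite !lt_min d10 => -> -> ->.
move=> z q zq; rewrite !lt_min => /andP[/andP[qd1 qc1] /andP[qD qk]] y.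
have q0 := disk_gt0 zq.
have c1q : c1 * cn q <= 4^-1 by rewrite mulrC -ler_pdivlMr // ltW.
have r1 := cn_rho1 zq c1q.
have r01 : 0 <= cn (rho1 q) < 1 by rewrite cn_ge0.
have kk : 0 < Num.min k 2^-1 by rewrite lt_min k0 /= invr_gt0.
near=> N.
have N1 : (1 < N)%N by near: N; exists 2%N.
have yN : (`|y| < N)%N by near: N; exists `|y|.+1%N.
have rN : cn (rho1 q) ^+ N <= Num.min k 2^-1 by near: N; exact: near_exp_le.
have rNy : cn (rho1 q) ^+ (N - `|y|%N) <= k by near: N; exact: near_exp_sub.
have hav : avg N (fun j => (cn q ^+ 2 + b (th R N j))^-1) <= 8 / cn q.
  by near: N; exact: (near_avg_resolvent zq).
move: rN; rewrite le_min => /andP[rN rN2].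
rewrite -(subrK (q * avgC N (fun j => cis (- (th R N j * y%:~R)) /
      (q ^+ 2 + nu%:C * rho1 q * (b (th R N j))%:C))) (q * G N z y)) -addrA.
apply: le_trans (cnD _ _) _.
have -> : e = (e / 3 + e / 6) + e / 2 by field.
apply: lerD; last first.
  apply: le_trans (kernel_main r1 _ yN c1q _) _; rewrite ?cnX //.
    by rewrite -cn_gt0.
  have -> : e / 2 = 4 * g0 * (k + k + k) by rewrite /k; field; rewrite gt_eqF.
  by rewrite ler_pM2l ?mulr_gt0 // !lerD // mulrC -ler_pdivlMr // (ltW qk).
rewrite -mulrBr cnM.
pose K j := q ^+ 2 + nu%:C * rho1 q * (b (th R N j))%:C.
have -> : G N z y - avgC N (fun j => cis (- (th R N j * y%:~R)) / K j) =
    avgC N (fun j => cis (- (th R N j * y%:~R)) * ((1 - z * f (th R N j))^-1 - (K j)^-1)).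
  rewrite /green /avgC -mulrBr -sumrB; congr (_ * _).
  by apply: eq_bigr => j _; rewrite mulrBr.
apply: le_trans (_ : cn q * (e / 24 * (8 / cn q) + `|D|) <= _); last first.
  rewrite mulrDr lerD //.
    by rewrite le_eqVlt; apply/orP; left; apply/eqP; field; rewrite gt_eqF.
  move: qD; rewrite ltr_pdivlMr // => qD; apply: le_trans (ltW qD).
  by rewrite ler_pM2l // lerDl.
rewrite ler_wpM2l ?cn_ge0 //; apply: le_trans (cn_avgC N _) _.
apply: le_trans (_ : avg N (fun j => e / 24 * (cn q ^+ 2 + b (th R N j))^-1 + `|D|) <= _).
  apply: ler_avg => j _; rewrite cnM cn_cis mul1r.
  apply: le_trans (hD z q N j zq c1q qd1 N1) _.
  by rewrite lerD2l ler_norm.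
by rewrite avgD avgZ avg_cst ?(ltnW N1) // lerD2r ler_wpM2l // ltW.
Unshelve. all: by end_near. Qed.

Lemma cn_inv_green0 z q N : disk z q -> (0 < N)%N -> cn (G N z 0)^-1 <= 2.
Proof.
move=> zq N0.
exact: (cn_invgreen0 N0 (p_ge0 N) (p_sum1 N0) (p_fourier N0) (disk_lt1 zq)).
Qed.

Lemma G0_neq0 z q N : disk z q -> (0 < N)%N -> G N z 0 != 0.
Proof.
move=> zq N0.
exact: (green0_neq0 N0 (p_ge0 N) (p_sum1 N0) (p_fourier N0) (disk_lt1 zq)).
Qed.

(** For small q, G_0 is close to g0 / q, whose real part is at least g0 / (2 |q|) since q lies in a
    sector; otherwise [green0_Re_lower] suffices, |q| being bounded below. *)
Lemma green0_lower : exists2 c, 0 < c & forall z q, disk z q ->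
  \forall N \near \oo, c / cn q <= 2 * Re (G N z 0) - 1.
Proof.
have g00 := g0_gt0; have g04 : 0 < g0 / 4 by rewrite divr_gt0.
have [d d0 hd] := green_near g04.
pose d' := Num.min d (g0 / 4).
have d'0 : 0 < d' by rewrite lt_min d0.
exists (Num.min (g0 / 4) (c2 / 4 * d')); first by rewrite lt_min g04 mulr_gt0 // divr_gt0.
move=> z q zq; have q0 := disk_gt0 zq.
case: (ltP (cn q) d') => qd; last first.
  near=> N; have N1 : (1 < N)%N by near: N; exists 2%N.
  apply: le_trans (green0_Re_lower zq N1); rewrite ler_pdivrMr //.
  rewrite ge_min; apply/orP; right; rewrite ler_wpM2l // divr_ge0 // ltW //.
move: qd; rewrite lt_min => /andP[qd qg].
near=> N.
have h : cn (q * G N z 0 - g0%:C * rho1 q ^+ `|0%:Z|) <= g0 / 4.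
  by near: N; exact: (hd _ _ zq qd).
move: h; rewrite absz0 expr0 mulr1; set w := q * _ => h.
have Gw : G N z 0 = w / q by rewrite /w mulrAC divff ?mul1r // -cn_gt0.
set e := w - g0%:C in h.
have -> : G N z 0 = g0%:C * q^-1 + e / q by rewrite Gw /e; ring.
rewrite reCD.
have h1 : - (g0 / 4 / cn q) <= Re (e / q).
  rewrite lerNl; apply: le_trans (ler_norm _) _; rewrite normrN.
  by apply: le_trans (Re_le_cn _) _; rewrite cnf_div ler_pM2r // invr_gt0.
have h2 : g0 / 2 / cn q <= Re (g0%:C * q^-1).
  rewrite reCM /= mul0r subr0 -mulrA ler_pM2l //.
  have -> : Re q^-1 = Re q / cn q ^+ 2 by rewrite sqr_cn; case: (q).
  rewrite -invfM ler_pdivlMr ?exprn_gt0 //.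
  have := disk_Re zq => hq.
  have -> : (2 * cn q)^-1 * cn q ^+ 2 = cn q / 2 by field; rewrite gt_eqF.
  lra.
have h3 : 1 <= g0 / 4 / cn q by rewrite ler_pdivlMr // mul1r ltW.
apply: le_trans (_ : g0 / 4 / cn q <= _).
  by rewrite ler_pM2r ?invr_gt0 // ge_min lexx.
have e2 : g0 / 2 / cn q = g0 / 4 / cn q + g0 / 4 / cn q by field; rewrite gt_eqF.
lra.
Unshelve. all: by end_near. Qed.

Lemma inv_green0_upper : exists2 C, 0 < C & forall z q, disk z q ->
  \forall N \near \oo, cn (G N z 0)^-1 <= C * cn q.
Proof.
have [c c0 hc] := green0_lower.
exists (2 / c) => [|z q zq]; first by rewrite divr_gt0.
have q0 := disk_gt0 zq; near=> N.
have N0 : (0 < N)%N by near: N; exists 1%N.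
have h : c / cn q <= 2 * Re (G N z 0) - 1 by near: N; exact: (hc _ _ zq).
have G0 := G0_neq0 zq N0; rewrite -cn_gt0 in G0.
have X0 : 0 < 2 / c * cn q by rewrite mulr_gt0 // divr_gt0.
rewrite cnV -[leRHS]invrK lef_pV2 ?posrE ?invr_gt0 //.
have -> : (2 / c * cn q)^-1 = c / cn q / 2 by field; rewrite !gt_eqF.
have := Re_le_cn (G N z 0); have := ler_norm (Re (G N z 0)); lra.
Unshelve. all: by end_near. Qed.

Local Notation F N z := (ret N (fun j => f (th R N j)) z).

(** In [sqr_cn_ret] the numerator is at least c / |q| and |G_0| at most C / |q|, so the deficit is
    at least (c / C^2) |q|. *)
Lemma ret_upper : exists2 c, 0 < c & forall z q, disk z q ->
  \forall N \near \oo, cn (F N z) <= 1 - c * cn q.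
Proof.
have [c c0 hc] := green0_lower; have c30 := c3_gt0.
have [C CE] : exists C, C = 8 / c3 by exists (8 / c3).
have C0 : 0 < C by rewrite CE divr_gt0.
exists (c / C ^+ 2 / 2) => [|z q zq]; first by rewrite !divr_gt0 // exprn_gt0.
have q0 := disk_gt0 zq; near=> N.
have N0 : (0 < N)%N by near: N; exists 1%N.
have h : c / cn q <= 2 * Re (G N z 0) - 1 by near: N; exact: (hc _ _ zq).
have u : forall y, cn (G N z y) <= C / cn q by rewrite CE; near: N; exact: (green_upper zq).
have {}u := u 0.
have G0 := G0_neq0 zq N0; rewrite -cn_gt0 in G0.
have F2 := sqr_cn_ret N0 (p_ge0 N) (p_sum1 N0) (p_fourier N0) (disk_lt1 zq).
have F1 := cn_ret N0 (p_ge0 N) (p_sum1 N0) (p_fourier N0) (disk_lt1 zq).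
have : c / C ^+ 2 * cn q <= (2 * Re (G N z 0) - 1) / cn (G N z 0) ^+ 2.
  rewrite ler_pdivlMr ?exprn_gt0 //; apply: le_trans h.
  apply: le_trans (_ : c / C ^+ 2 * cn q * (C / cn q) ^+ 2 <= _).
    rewrite ler_wpM2l ?lerXn2r ?nnegrE ?cn_ge0 ?divr_ge0 ?(ltW C0) ?cn_ge0 //.
    by rewrite mulr_ge0 ?cn_ge0 // divr_ge0 ?exprn_ge0 // ltW.
  by rewrite le_eqVlt; apply/orP; left; apply/eqP; field; rewrite !gt_eqF.
move: F2 F1 (cn_ge0 (F N z)); move: (cn (F N z)) (_ / cn (G N z 0) ^+ 2) => x y.
nra.
Unshelve. all: by end_near. Qed.

Local Notation Hit N z a := (hit N (fun j => f (th R N j)) z a).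
Local Notation Vis N z a l := (visit N (fun j => f (th R N j)) z a l).

(** Each 1 / G_0, of order q, offsets one G_y or one 1 / q, so only the power of [ret] matters. N is
    chosen before a, y and l. *)
Lemma visit_upper : exists C c, [/\ 0 < C, 0 < c & forall z q, disk z q ->
  \forall N \near \oo, forall a y l,
    cn (Vis N z a l.+1 * G N z y) <= C * (1 - c * cn q) ^+ l /\
    cn (q * (Vis N z a l.+1 / (1 - z))) <= C * (1 - c * cn q) ^+ l].
Proof.
have [c c0 hc] := ret_upper; have [B B0 hB] := inv_green0_upper.
have [D DE] : exists D, D = 8 / c3 by exists (8 / c3).
have D0 : 0 < D by rewrite DE divr_gt0 // c3_gt0.
exists ((D * B + 2) * (D * B + B)), c; split=> //.
  by rewrite !(addr_gt0, mulr_gt0).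
move=> z q zq; have q0 := disk_gt0 zq; near=> N => a y l.
have N0 : (0 < N)%N by near: N; exists 1%N.
have hF : cn (F N z) <= 1 - c * cn q by near: N; exact: (hc _ _ zq).
have hI : cn (G N z 0)^-1 <= B * cn q by near: N; exact: (hB _ _ zq).
have u : forall x, cn (G N z x) <= D / cn q by rewrite DE; near: N; exact: (green_upper zq).
have I2 := cn_inv_green0 zq N0.
have DB x : cn (G N z x * (G N z 0)^-1) <= D * B.
  rewrite cnM (_ : D * B = (D / cn q) * (B * cn q)); last by field; rewrite gt_eqF.
  by rewrite ler_pM ?cn_ge0.
have hh : cn (Hit N z a) <= D * B + 2.
  rewrite /hit mulrBl (le_trans (cnB _ _)) // lerD // cnM.
  by rewrite -[leRHS]mul1r ler_pM ?cn_ge0 //; case: (_ %| _)%Z; rewrite ?cn1 ?cn0.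
have hFl : cn (F N z ^+ l) <= (1 - c * cn q) ^+ l.
  by rewrite cnX lerXn2r ?nnegrE ?cn_ge0 // (le_trans (cn_ge0 _) hF).
have P0 : 0 <= (1 - c * cn q) ^+ l := le_trans (cn_ge0 _) hFl.
have main X x : cn X <= x -> x <= D * B + B ->
    cn (F N z ^+ l * Hit N z a * X) <= (D * B + 2) * (D * B + B) * (1 - c * cn q) ^+ l.
  move=> Xx xD; rewrite (cnM (_ * _) X) (cnM (F N z ^+ l)) -mulrA [leRHS]mulrC.
  apply: ler_pM => //; rewrite ?mulr_ge0 ?cn_ge0 //.
  by apply: ler_pM; rewrite ?cn_ge0 //; exact: (le_trans Xx xD).
have G0 := G0_neq0 zq N0; have qq : q != 0 by rewrite -cn_gt0.
split.
  have -> : Vis N z a l.+1 * G N z y = F N z ^+ l * Hit N z a * (G N z y * (G N z 0)^-1).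
    by rewrite /visit; ring.
  by apply: main (DB y) _; rewrite lerDl ltW.
have -> : q * (Vis N z a l.+1 / (1 - z)) = F N z ^+ l * Hit N z a * ((G N z 0)^-1 / q).
  by have [_ <- _] := zq; rewrite /visit; field; rewrite G0 qq.
apply: (main _ B); last by rewrite lerDr mulr_ge0 // ltW.
by rewrite cnf_div ler_pdivrMr.
Unshelve. all: by end_near. Qed.

Lemma cn_mulB (x y x' y' : R[i]) :
  cn (x * y - x' * y') <= cn x * cn (y - y') + cn (x - x') * cn y'.
Proof.
have -> : x * y - x' * y' = x * (y - y') + (x - x') * y' by ring.
by rewrite (le_trans (cnD _ _)) // !cnM.
Qed.

Lemma inv_green0_near e : 0 < e -> exists2 d, 0 < d & forall z q, disk z q -> cn q < d ->
  \forall N \near \oo, cn ((q * G N z 0)^-1 - (nu * c1)%:C) <= e.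
Proof.
move=> e0; have g00 := g0_gt0.
have k0 : 0 < Num.min (g0 / 2) (e * g0 ^+ 2 / 2).
  by rewrite lt_min !divr_gt0 // mulr_gt0 // exprn_gt0.
have [d d0 hd] := green_near k0.
exists d => // z q zq qd; have q0 := disk_gt0 zq; near=> N.
have N0 : (0 < N)%N by near: N; exists 1%N.
have : cn (q * G N z 0 - g0%:C * rho1 q ^+ `|0%:Z|) <= Num.min (g0 / 2) (e * g0 ^+ 2 / 2).
  by near: N; exact: (hd _ _ zq qd).
rewrite absz0 expr0 mulr1 le_min; set Q := q * _ => /andP[h1 h2].
have G0 : Q != 0 by rewrite mulf_neq0 ?(G0_neq0 zq N0) // -cn_gt0.
have gg : g0%:C != 0 :> R[i] by rewrite -cn_eq0 cn_real normr_eq0 gt_eqF.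
have -> : (nu * c1)%:C = g0%:C^-1 :> R[i] by rewrite /g0 fmorphV invrK.
have -> : Q^-1 - g0%:C^-1 = (g0%:C - Q) / (Q * g0%:C) by field; rewrite G0 gg.
rewrite cnf_div cnM cn_sym cn_real gtr0_norm //.
have Q0 : g0 / 2 <= cn Q.
  have := cn_revB g0%:C (g0%:C - Q); rewrite opprB addrCA subrr addr0.
  by rewrite cn_real gtr0_norm // cn_sym; lra.
have QQ : 0 < cn Q by rewrite cn_gt0.
rewrite ler_pdivrMr ?mulr_gt0 //; apply: le_trans h2 _.
have -> : e * (cn Q * g0) = e * g0 * cn Q by ring.
have -> : e * g0 ^+ 2 / 2 = e * g0 * (g0 / 2) by ring.
by rewrite ler_pM2l // mulr_gt0.
Unshelve. all: by end_near. Qed.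

Lemma nuc1_gt0 : 0 < nu * c1. Proof. by rewrite mulr_gt0 // c1_gt0. Qed.

Lemma Re_cexp_le0 z q (s : R) : disk z q -> 0 <= s -> Re (- (s%:C * q)) <= 0.
Proof.
case=> _ _ q0 s0; rewrite reCN reCM /= mul0r subr0 oppr_le0.
by rewrite mulr_ge0 // ltW.
Qed.

Lemma cn_cexpN_le1 z q (s : R) : disk z q -> 0 <= s -> cn (cexp (- (s%:C * q))) <= 1.
Proof. by move=> zq s0; rewrite cn_cexp expR_le1 (Re_cexp_le0 zq). Qed.

Lemma green_ratio_near e : 0 < e -> exists2 d, 0 < d & forall z q, disk z q -> cn q < d ->
  forall y : int, \forall N \near \oo,
    cn (G N z y / G N z 0 - cexp (- ((c1 * `|y|%N%:R)%:C * q))) <= e.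
Proof.
move=> e0; have g00 := g0_gt0; have n0 := nuc1_gt0; have c10 := c1_gt0.
have e4 : 0 < e / 4 by rewrite divr_gt0.
pose k := Num.min (e / (4 * (nu * c1 + 1))) 1.
have p1 : 0 < nu * c1 + 1 by rewrite addr_gt0.
have p2 : 0 < g0 + 1 by rewrite addr_gt0.
have k0 : 0 < k by rewrite lt_min ltr01 andbT divr_gt0 // mulr_gt0.
pose k' := e / (4 * (g0 + 1)).
have k'0 : 0 < k' by rewrite divr_gt0 // mulr_gt0.
have k''0 : 0 < Num.min k' 1 by rewrite lt_min k'0 ltr01.
have [d1 d10 h1] := green_near k0; have [d2 d20 h2] := inv_green0_near k''0.
have [d3 d30 h3] := pow_cexp c10 e4.
pose D := Num.min (Num.min d1 d2) (Num.min d3 (4^-1 / c1)).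
have D0 : 0 < D by rewrite !lt_min d10 d20 d30 /= divr_gt0 // invr_gt0.
exists D => // z q zq; rewrite !lt_min => /andP[/andP[qd1 qd2] /andP[qd3 qd4]] y.
have q0 := disk_gt0 zq; near=> N.
have N0 : (0 < N)%N by near: N; exists 1%N.
have hG : cn (q * G N z y - g0%:C * rho1 q ^+ `|y|) <= k by near: N; exact: (h1 _ _ zq qd1).
have hI : cn ((q * G N z 0)^-1 - (nu * c1)%:C) <= Num.min k' 1 by near: N; exact: (h2 _ _ zq qd2).
move: hG hI; rewrite !le_min => /andP[hG hG1] /andP[hI hI1].
have hr : cn (rho1 q ^+ `|y| - cexp (- ((c1 * `|y|%N%:R)%:C * q))) <= e / 4.
  by apply: h3 => //; [exact: (disk_Re zq)|rewrite subrr cn0 mulr_ge0 // ltW].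
have c1q : c1 * cn q <= 4^-1 by rewrite mulrC -ler_pdivlMr // ltW.
have r1 : cn (rho1 q ^+ `|y|) <= 1.
  by rewrite cnX exprn_ile1 ?cn_ge0 // ltW // (cn_rho1 zq c1q).
have G0 := G0_neq0 zq N0; have qq : q != 0 by rewrite -cn_gt0.
rewrite -(subrK (rho1 q ^+ `|y|) (G N z y / G N z 0)) -addrA.
apply: le_trans (cnD _ _) _; have -> : e = e / 4 * 3 + e / 4 by field.
apply: lerD => //.
have -> : G N z y / G N z 0 = (q * G N z y) * (q * G N z 0)^-1 by field; rewrite qq G0.
have -> : rho1 q ^+ `|y| = (g0%:C * rho1 q ^+ `|y|) * (nu * c1)%:C.
  have -> : (nu * c1)%:C = g0%:C^-1 :> R[i] by rewrite /g0 fmorphV invrK.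
  by field; rewrite -cn_eq0 cn_real normr_eq0 gt_eqF.
apply: le_trans (cn_mulB _ _ _ _) _; rewrite cn_real (gtr0_norm n0).
have u : cn (q * G N z y) <= g0 + 1.
  rewrite -(subrK (g0%:C * rho1 q ^+ `|y|) (q * G N z y)).
  apply: le_trans (cnD _ _) _; rewrite addrC lerD // cn_realM ?(ltW g00) //.
  by rewrite ler_piMr // ltW.
have t1 : cn (q * G N z y) * cn ((q * G N z 0)^-1 - (nu * c1)%:C) <= (g0 + 1) * k'.
  by rewrite ler_pM ?cn_ge0.
have t2 : cn (q * G N z y - g0%:C * rho1 q ^+ `|y|) * (nu * c1) <=
    e / (4 * (nu * c1 + 1)) * (nu * c1).
  by rewrite ler_pM2r.
apply: le_trans (lerD t1 t2) _.
have -> : (g0 + 1) * k' = e / 4 by rewrite /k'; field; rewrite gt_eqF // ltr_wpDl // ltW.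
have -> : e / (4 * (nu * c1 + 1)) * (nu * c1) = e / 4 * ((nu * c1) / (nu * c1 + 1)).
  by field; rewrite gt_eqF // ltr_wpDl // ltW.
have : (nu * c1) / (nu * c1 + 1) <= 1.
  by rewrite ler_pdivrMr ?mul1r ?lerDl // ltr_wpDl // ltW.
nra.
Unshelve. all: by end_near. Qed.

(** The indicator in [hit] contributes at most 1 / |G_0| = O(|q|), so a = 0 is no exception. *)
Lemma hit_near e : 0 < e -> exists2 d, 0 < d & forall z q, disk z q -> cn q < d ->
  forall a : int, \forall N \near \oo,
    cn (Hit N z a - cexp (- ((c1 * `|a|%N%:R)%:C * q))) <= e.
Proof.
move=> e0; have e2 : 0 < e / 2 by rewrite divr_gt0.
have [d1 d10 h1] := green_ratio_near e2; have [B B0 hB] := inv_green0_upper.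
have D0 : 0 < Num.min d1 (e / 2 / B) by rewrite lt_min d10 divr_gt0.
exists (Num.min d1 (e / 2 / B)) => // z q zq; rewrite lt_min => /andP[qd1 qd2] a.
have q0 := disk_gt0 zq; near=> N.
have hG : cn (G N z a / G N z 0 - cexp (- ((c1 * `|a|%N%:R)%:C * q))) <= e / 2.
  by near: N; exact: (h1 _ _ zq qd1).
have hI : cn (G N z 0)^-1 <= B * cn q by near: N; exact: (hB _ _ zq).
rewrite /hit mulrBl addrAC; apply: le_trans (cnB _ _) _.
have -> : e = e / 2 + e / 2 by field.
apply: lerD => //; rewrite cnM; apply: le_trans (_ : cn (G N z 0)^-1 <= _).
  by rewrite ler_piMl ?cn_ge0 //; case: (_ %| _)%Z; rewrite ?cn1 ?cn0.
by apply: le_trans hI _; rewrite mulrC -ler_pdivlMr // ltW.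
Unshelve. all: by end_near. Qed.

(** [ret] is 1 - nu c1 q up to a small multiple of q, which is the hypothesis of [pow_cexp]; hence
    the uniformity in l. *)
Lemma ret_near e : 0 < e -> exists2 d, 0 < d & forall z q, disk z q -> cn q < d ->
  \forall N \near \oo, forall l : nat,
    cn (F N z ^+ l - cexp (- ((nu * c1 * l%:R)%:C * q))) <= e.
Proof.
move=> e0; have [d d0 hd] := pow_cexp nuc1_gt0 e0.
have [d1 d10 h1] := inv_green0_near d0.
exists (Num.min d d1); first by rewrite lt_min d0.
move=> z q zq; rewrite lt_min => /andP[qd qd1]; have q0 := disk_gt0 zq.
near=> N => l.
have N0 : (0 < N)%N by near: N; exists 1%N.
have hI : cn ((q * G N z 0)^-1 - (nu * c1)%:C) <= d by near: N; exact: (h1 _ _ zq qd1).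
apply: hd => //; first exact: (disk_Re zq).
have G0 := G0_neq0 zq N0; have qq : q != 0 by rewrite -cn_gt0.
have -> : F N z - (1 - (nu * c1)%:C * q) = - (((q * G N z 0)^-1 - (nu * c1)%:C) * q).
  by rewrite /ret; field; rewrite qq G0.
by rewrite cnN cnM ler_wpM2r // cn_ge0.
Unshelve. all: by end_near. Qed.

(** Transform of the time the lazy walk takes to climb one level: the root in the unit disk of 4 rho
    = z (1 + rho)^2. *)
Definition rho0 (q : R[i]) : R[i] := (1 - q) / (1 + q).

(** An exponent known up to K changes the exponential by O(K |q|) only. This leaves room for
    rounding to an integer m, and for l - 1 in place of l. *)
Lemma rho0_near (K e : R) : 0 < e -> exists2 d, 0 < d & forall z q, disk z q -> cn q < d ->
  forall (m : nat) (s : R), 0 <= s -> `|2 * m%:R - s| <= K ->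
    cn (cexp (- (s%:C * q)) - rho0 q ^+ m) <= e.
Proof.
move=> e0; have e2 : 0 < e / 2 by rewrite divr_gt0.
have [d d0 hd] := @pow_cexp R 2 _ (ltr0n _ 2) e2.
have K1 : 0 < `|K| + 1 by rewrite ltr_wpDl.
pose D := Num.min (Num.min d (d / 2)) (Num.min (2^-1 / (`|K| + 1)) (e / 12 / (`|K| + 1))).
have D0 : 0 < D by rewrite !lt_min d0 !divr_gt0 // invr_gt0.
exists D => // z q zq; rewrite !lt_min => /andP[/andP[qd qd2] /andP[qK qK']] m s s0 ms.
have q0 := disk_gt0 zq; have [_ _ rq] := zq.
have n1 : 1 <= cn (1 + q).
  by rewrite (le_trans _ (Re_le_cn _)) // (le_trans _ (ler_norm _)) // reCD /= lerDl ltW.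
have n0 : 1 + q != 0 by rewrite -cn_gt0 (lt_le_trans ltr01).
have h1 : cn (rho0 q ^+ m - cexp (- ((2 * m%:R)%:C * q))) <= e / 2.
  apply: hd => //; first exact: (disk_Re zq).
  have -> : rho0 q - (1 - 2%:C * q) = 2%:C * (q * q) / (1 + q).
    by rewrite /rho0 (_ : 2%:C = 2) ?rmorph_nat //; field.
  rewrite cnf_div cn_realM // cnM ler_pdivrMr ?(lt_le_trans ltr01) //.
  apply: le_trans (_ : d * cn q * 1 <= _); last by rewrite ler_pM2l // mulr_gt0.
  rewrite mulr1 mulrA ler_pM2r // mulrC -ler_pdivlMr // ltW //.
have Kq : cn (- (s%:C * q) - - ((2 * m%:R)%:C * q)) <= `|K| * cn q.
  have -> : - (s%:C * q) - - ((2 * m%:R)%:C * q) = (2 * m%:R - s)%:C * q.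
    by rewrite rmorphB; ring.
  by rewrite cnM cn_real ler_wpM2r ?cn_ge0 // (le_trans ms) // ler_norm.
have Kq2 : (`|K| + 1) * cn q <= 2^-1 by rewrite mulrC -ler_pdivlMr // ltW.
have Kq3 : (`|K| + 1) * cn q <= e / 12 by rewrite mulrC -ler_pdivlMr // ltW.
have h2 : cn (cexp (- (s%:C * q)) - cexp (- ((2 * m%:R)%:C * q))) <= e / 2.
  apply: le_trans (cexpB _ _) _.
  - by apply: (Re_cexp_le0 zq); rewrite mulr_ge0.
  - by apply: le_trans Kq _; lra.
  - by lra.
have -> : cexp (- (s%:C * q)) - rho0 q ^+ m =
  (cexp (- (s%:C * q)) - cexp (- ((2 * m%:R)%:C * q))) - (rho0 q ^+ m - cexp (- ((2 * m%:R)%:C * q))).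
  by ring.
by apply: le_trans (cnB _ _) _; lra.
Qed.

(** The three exponentials, for the first hit, the returns and the last excursion, multiply into
    one. The radius d depends on K and e only, whereas the threshold in N may depend on
    everything. *)
Lemma visit_near (K e : R) : 0 < e -> exists2 d, 0 < d &
  forall z q, disk z q -> cn q < d -> forall (a : int) (l m : nat),
    (forall y : int, `|2 * m%:R - c1 * (`|a|%N%:R + `|y|%N%:R + nu * l%:R)| <= K ->
     \forall N \near \oo, cn (Vis N z a l.+1 * G N z y - rho0 q ^+ m) <= e) /\
    (`|2 * m%:R - c1 * (`|a|%N%:R + nu * l%:R)| <= K ->
     \forall N \near \oo,
       cn (q * (Vis N z a l.+1 / (1 - z)) - (nu * c1)%:C * rho0 q ^+ m) <= e).
Proof.
move=> e0; have n0 := nuc1_gt0; have c10 := c1_gt0.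
have p1 : 0 < nu * c1 + 1 by rewrite addr_gt0.
pose k := Num.min (Num.min (e / 6) (e / 6 / (nu * c1 + 1))) 1.
have k0 : 0 < k by rewrite !lt_min ltr01 !divr_gt0.
have [k1 k2 k3] : [/\ k <= e / 6, k * (nu * c1 + 1) <= e / 6 & k <= 1].
  by split; rewrite -?ler_pdivlMr // !ge_min lexx ?orbT.
have [d1 d10 h1] := green_ratio_near k0; have [d2 d20 h2] := hit_near k0.
have [d3 d30 h3] := ret_near k0; have [d4 d40 h4] := rho0_near K k0.
have [d5 d50 h5] := inv_green0_near k0.
pose D := Num.min (Num.min d1 d2) (Num.min (Num.min d3 d4) d5).
have D0 : 0 < D by rewrite !lt_min d10 d20 d30 d40.
exists D => // z q zq; rewrite !lt_min => /andP[/andP[qd1 qd2] /andP[/andP[qd3 qd4] qd5]] a l m.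
have q0 := disk_gt0 zq; have qq : q != 0 by rewrite -cn_gt0.
set X := cexp (- ((nu * c1 * l%:R)%:C * q)).
set Y := cexp (- ((c1 * `|a|%N%:R)%:C * q)).
have X1 : cn X <= 1 by apply: (cn_cexpN_le1 zq); rewrite mulr_ge0 // ltW.
have Y1 : cn Y <= 1 by apply: (cn_cexpN_le1 zq); rewrite mulr_ge0 // ltW.
have XY : \forall N \near \oo,
    cn (F N z ^+ l * Hit N z a - X * Y) <= 2 * k /\ cn (F N z ^+ l * Hit N z a) <= 2.
  near=> N.
  have N0 : (0 < N)%N by near: N; exists 1%N.
  have hF : forall l, cn (F N z ^+ l - cexp (- ((nu * c1 * l%:R)%:C * q))) <= k.
    by near: N; exact: (h3 _ _ zq qd3).
  have {}hF : cn (F N z ^+ l - X) <= k by exact: hF.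
  have hH : cn (Hit N z a - Y) <= k by near: N; exact: (h2 _ _ zq qd2).
  have F1 : cn (F N z ^+ l) <= 1.
    rewrite cnX exprn_ile1 ?cn_ge0 //.
    exact: (cn_ret N0 (p_ge0 N) (p_sum1 N0) (p_fourier N0) (disk_lt1 zq)).
  have H2 : cn (Hit N z a) <= 2.
    rewrite -(subrK Y (Hit N z a)); apply: le_trans (cnD _ _) _; lra.
  split.
    apply: le_trans (cn_mulB _ _ _ _) _.
    have t1 : cn (F N z ^+ l) * cn (Hit N z a - Y) <= 1 * k by rewrite ler_pM ?cn_ge0.
    have t2 : cn (F N z ^+ l - X) * cn Y <= k * 1 by rewrite ler_pM ?cn_ge0.
    by lra.
  by rewrite (cnM (F N z ^+ l)) -[2]mul1r ler_pM ?cn_ge0.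
split=> [y|] hm.
  set Z := cexp (- ((c1 * `|y|%N%:R)%:C * q)).
  have Z1 : cn Z <= 1 by apply: (cn_cexpN_le1 zq); rewrite mulr_ge0 // ltW.
  have XYZ : X * Y * Z = cexp (- ((c1 * (`|a|%N%:R + `|y|%N%:R + nu * l%:R))%:C * q)).
    by rewrite /X /Y /Z -!cexpD; congr cexp; rewrite !(rmorphM, rmorphD); ring.
  have hr : cn (X * Y * Z - rho0 q ^+ m) <= k.
    rewrite XYZ; apply: (h4 _ _ zq qd4) hm.
    by rewrite mulr_ge0 ?(ltW c10) // !addr_ge0 // mulr_ge0 // ltW.
  near=> N.
  have [h21 h22] : cn (F N z ^+ l * Hit N z a - X * Y) <= 2 * k /\
    cn (F N z ^+ l * Hit N z a) <= 2 by near: N.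
  have hG : cn (G N z y / G N z 0 - Z) <= k by near: N; exact: (h1 _ _ zq qd1).
  have -> : Vis N z a l.+1 * G N z y = F N z ^+ l * Hit N z a * (G N z y / G N z 0).
    by rewrite /visit; ring.
  rewrite -(subrK (X * Y * Z) (_ * (_ / _))) -addrA; apply: le_trans (cnD _ _) _.
  have := cn_mulB (F N z ^+ l * Hit N z a) (G N z y / G N z 0) (X * Y) Z.
  have t1 : cn (F N z ^+ l * Hit N z a) * cn (G N z y / G N z 0 - Z) <= 2 * k.
    by rewrite ler_pM ?cn_ge0.
  have t2 : cn (F N z ^+ l * Hit N z a - X * Y) * cn Z <= 2 * k * 1.
    by rewrite ler_pM ?cn_ge0.
  lra.
have XYE : X * Y = cexp (- ((c1 * (`|a|%N%:R + nu * l%:R))%:C * q)).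
  by rewrite /X /Y -!cexpD; congr cexp; rewrite !(rmorphM, rmorphD); ring.
have hr : cn (X * Y - rho0 q ^+ m) <= k.
  rewrite XYE; apply: (h4 _ _ zq qd4) hm.
  by rewrite mulr_ge0 ?(ltW c10) // !addr_ge0 // mulr_ge0 // ltW.
near=> N.
have N0 : (0 < N)%N by near: N; exists 1%N.
have G0 := G0_neq0 zq N0.
have [h21 h22] : cn (F N z ^+ l * Hit N z a - X * Y) <= 2 * k /\
  cn (F N z ^+ l * Hit N z a) <= 2 by near: N.
have hI : cn ((q * G N z 0)^-1 - (nu * c1)%:C) <= k by near: N; exact: (h5 _ _ zq qd5).
have -> : q * (Vis N z a l.+1 / (1 - z)) = F N z ^+ l * Hit N z a * (q * G N z 0)^-1.
  by have [_ <- _] := zq; rewrite /visit; field; rewrite G0 qq.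
have -> : F N z ^+ l * Hit N z a * (q * G N z 0)^-1 - (nu * c1)%:C * rho0 q ^+ m =
  (F N z ^+ l * Hit N z a * (q * G N z 0)^-1 - X * Y * (nu * c1)%:C) +
  (nu * c1)%:C * (X * Y - rho0 q ^+ m) by ring.
apply: le_trans (cnD _ _) _; rewrite cn_realM ?(ltW n0) //.
have := cn_mulB (F N z ^+ l * Hit N z a) (q * G N z 0)^-1 (X * Y) (nu * c1)%:C.
rewrite cn_real (gtr0_norm n0).
have t1 : cn (F N z ^+ l * Hit N z a) * cn ((q * G N z 0)^-1 - (nu * c1)%:C) <= 2 * k.
  by rewrite ler_pM ?cn_ge0.
have t2 : cn (F N z ^+ l * Hit N z a - X * Y) * (nu * c1) <= 2 * k * (nu * c1).
  by rewrite ler_pM2r.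
have t3 : nu * c1 * cn (X * Y - rho0 q ^+ m) <= nu * c1 * k by rewrite ler_pM2l.
lra.
Unshelve. all: by end_near. Qed.

End Estimates.

(** * The lazy walk *)

Section LazyWalk.
Variable R : realType.

(* Law at time [n] of the lazy walk with steps 1, 0, -1 of probabilities 1/4, 1/2, 1/4. *)
Definition lazy (n m : nat) : R := 'C(n.*2, n + m)%:R / 4 ^+ n.

(* By Kemperman's formula, the probability that this walk first hits [m] at time [n]. *)
Definition lazy_hit (n m : nat) : R :=
  if n is 0 then (m == 0)%N%:R else m%:R / n%:R * lazy n m.
Arguments lazy_hit : simpl never.

Lemma avg3C (x y t : R) : ((x + 2 * y + t) / 4)%:C = (x%:C + 2 * y%:C + t%:C) / 4.
Proof. by rewrite rmorphM fmorphV !rmorphD rmorphM !rmorph_nat. Qed.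

Lemma lazy0 m : lazy 0 m = (m == 0)%N%:R.
Proof. by rewrite /lazy bin0n divr1. Qed.

Lemma lazy_ge0 n m : 0 <= lazy n m.
Proof. by rewrite divr_ge0 ?exprn_ge0. Qed.

Lemma lazy_small n m : (n < m)%N -> lazy n m = 0.
Proof. by move=> nm; rewrite /lazy bin_small ?mul0r // -addnn ltn_add2l. Qed.

(** By symmetry -1 has the weight of 1, which stays within nonnegative indices. *)
Lemma lazyS0 n : lazy n.+1 0 = (lazy n 0 + lazy n 1) / 2.
Proof.
rewrite /lazy !addn0 addn1 doubleS binS.
have -> : 'C(n.*2.+1, n) = 'C(n.*2.+1, n.+1).
  by rewrite -bin_sub -?addnn; [congr 'C(_, _); lia|lia].
rewrite binS addnn exprS -muln2 !natrM !natrD.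
have h : 4 ^+ n != 0 :> R by rewrite expf_neq0.
by field.
Qed.

Lemma lazySS n m : lazy n.+1 m.+1 = (lazy n m + 2 * lazy n m.+1 + lazy n m.+2) / 4.
Proof.
rewrite /lazy !addnS addSn doubleS !binS exprS !natrD.
have h : 4 ^+ n != 0 :> R by rewrite expf_neq0.
by field.
Qed.

(** Ratio of neighbouring binomial coefficients, the source of both the recursion for [lazy_hit] and
    the Gaussian profile. *)
Lemma lazy_step n m : (n + m.+1)%:R * lazy n m.+1 = (n%:R - m%:R) * lazy n m.
Proof.
rewrite /lazy !mulrA; congr (_ / _).
case: (leqP m n) => mn.
  rewrite -natrB // -!natrM addnS mul_bin_left; congr (_ * _)%:R.
  by rewrite -addnn; lia.
rewrite !bin_small ?mulr0 // -addnn; lia.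
Qed.

Lemma lazy_hit0 n : lazy_hit n 0 = (n == 0)%N%:R.
Proof. by case: n => [|n] //; rewrite /lazy_hit !mul0r. Qed.

(** With [lazy_hit0] as boundary value, this recursion characterizes the first-passage law; it is
    all that is used of Kemperman's formula. *)
Lemma lazy_hitSS n m :
  lazy_hit n.+1 m.+1 = (lazy_hit n m + 2 * lazy_hit n m.+1 + lazy_hit n m.+2) / 4.
Proof.
case: n => [|n].
  rewrite /lazy_hit !lazySS !lazy0; case: m => [|m] /=; rewrite ?mulr0 ?addr0 ?mul0r ?mulr0 //.
  by rewrite divr1 mul1r.
have n1 : n.+1%:R != 0 :> R by rewrite pnatr_eq0.
rewrite /lazy_hit lazySS.
have h1 := lazy_step n.+1 m; have h2 := lazy_step n.+1 m.+1.
have nE : n.+2%:R = n.+1%:R + 1 :> R by rewrite natr1.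
have mE : m.+1%:R = m%:R + 1 :> R by rewrite natr1.
have mE2 : m.+2%:R = m%:R + 2 :> R by rewrite -addn2 natrD.
have n2 : n.+1%:R + 1 != 0 :> R by rewrite natr1 pnatr_eq0.
rewrite !natrD nE mE mE2 in h1 h2 *.
move: (lazy n.+1 m) (lazy n.+1 m.+1) (lazy n.+1 m.+2) h1 h2 => A B C.
move: (m%:R) (n.+1%:R) n1 n2 => y x x1 x2 h1 h2.
(* With denominators cleared, the two sides differ by the sum of the defects of h1 and h2, that is,
   of [lazy_step] at two consecutive levels. *)
have E : x * (y + 1) * (A + 2 * B + C) =
   (x + 1) * (y * A + 2 * (y + 1) * B + (y + 2) * C).
  apply/eqP; rewrite -subr_eq0; apply/eqP.
  transitivity (((x - y) * A - (x + (y + 1)) * B) +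
    ((x - (y + 1)) * B - (x + (y + 2)) * C)); first by ring.
  by rewrite h1 h2; ring.
have -> : (y + 1) / (x + 1) * ((A + 2 * B + C) / 4) =
  x * (y + 1) * (A + 2 * B + C) / (4 * x * (x + 1)).
  by field; rewrite x1 x2.
by rewrite E; field; rewrite x1 x2.
Qed.

Variables z q : R[i].
Hypothesis zq : disk z q.

Lemma onePq_neq0 : 1 + q != 0.
Proof.
have [_ _ q0] := zq; rewrite -cn_gt0 (lt_le_trans _ (Re_le_cn _)) //.
by rewrite (lt_le_trans _ (ler_norm _)) // reCD /= addr_gt0.
Qed.

Lemma rho0_eq : 4 * rho0 q = z * (1 + rho0 q) ^+ 2.
Proof.
have n0 := onePq_neq0; have [_ zE _] := zq.
have -> : z = 1 - q ^+ 2 by rewrite zE; ring.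
by rewrite /rho0; field.
Qed.

(** |1 - q|^2 and |1 + q|^2 differ by 4 Re q >= 2 |q|, while |1 + q|^2 is at most 9. *)
Lemma cn_rho0_le : cn (rho0 q) <= 1 - cn q / 18.
Proof.
have n0 := onePq_neq0; have q0 := disk_gt0 zq; have q2 := disk_le2 zq.
have qR := disk_Re zq; rewrite -cn_gt0 in n0.
rewrite -(@ler_pXn2r _ 2) ?nnegrE ?cn_ge0 //; last by lra.
rewrite cnf_div expr_div_n ler_pdivrMr ?exprn_gt0 // sqr_cn1B sqr_cn1D.
move: (cn q) q0 q2 qR => x x0 x2; move: (Re q) => y xy.
have : y >= 0 by lra.
have h : (1 - x / 18) ^+ 2 >= 1 - x / 9 by nra.
have : (1 - x / 9) * (1 + 2 * y + x ^+ 2) <= (1 - x / 18) ^+ 2 * (1 + 2 * y + x ^+ 2).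
  by rewrite ler_wpM2r //; nra.
move=> h2 y0; apply: le_trans h2; nra.
Qed.

Lemma cn_rho0_le1 : cn (rho0 q) <= 1.
Proof. by have := cn_rho0_le; have := cn_ge0 q; lra. Qed.

(** Same scheme as [occ_gf_partial]: rho0^m obeys the recursion of [lazy_hit] by [rho0_eq], and the
    error gains |z| at each step. *)
Lemma lazy_hit_partial M m :
  cn (rho0 q ^+ m - \sum_(k < M) z ^+ k * (lazy_hit k m)%:C) <= cn z ^+ M.
Proof.
elim: M m => [|M IH] m.
  by rewrite big_ord0 subr0 cnX exprn_ile1 ?cn_ge0 // cn_rho0_le1.
rewrite big_ord_recl mul1r; case: m => [|m].
  rewrite big1 => [|k _]; last by rewrite lazy_hit0 mulr0.
  by rewrite addr0 subrr cn0 exprn_ge0 // cn_ge0.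
pose e m := rho0 q ^+ m - \sum_(k < M) z ^+ k * (lazy_hit k m)%:C.
have four : 4 != 0 :> R[i] by rewrite pnatr_eq0.
have -> : rho0 q ^+ m.+1 - ((lazy_hit 0 m.+1)%:C +
    \sum_(k < M) z ^+ k.+1 * (lazy_hit k.+1 m.+1)%:C) =
    z * ((e m + 2 * e m.+1 + e m.+2) / 4).
  have -> : rho0 q ^+ m.+1 = z * ((rho0 q ^+ m + 2 * rho0 q ^+ m.+1 + rho0 q ^+ m.+2) / 4).
    apply: (mulfI four); rewrite !exprS; move: (rho0 q ^+ m) => t.
    by transitivity (4 * rho0 q * t); [ring|rewrite rho0_eq; field].
  have -> : \sum_(k < M) z ^+ k.+1 * (lazy_hit k.+1 m.+1)%:C =
    z * ((\sum_(k < M) z ^+ k * (lazy_hit k m)%:C +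
          2 * \sum_(k < M) z ^+ k * (lazy_hit k m.+1)%:C +
          \sum_(k < M) z ^+ k * (lazy_hit k m.+2)%:C) / 4).
    rewrite mulr_sumr -!big_split /= mulr_suml mulr_sumr; apply: eq_bigr => k _.
    by rewrite lazy_hitSS exprS avg3C; field.
  by rewrite /e rmorph0; field.
rewrite cnM exprS ler_wpM2l ?cn_ge0 // cnf_div.
have -> : cn (4 : R[i]) = 4 by rewrite natrC cn_real ger0_norm.
have c2 : cn (2 : R[i]) = 2 by rewrite natrC cn_real ger0_norm.
rewrite ler_pdivrMr //; apply: le_trans (cnD _ _) _.
apply: le_trans (lerD (cnD _ _) (lexx _)) _; rewrite cnM c2.
have := IH m; have := IH m.+1; have := IH m.+2; rewrite -!/(e _); lra.
Qed.

Lemma lazy_partial M m :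
  cn (rho0 q ^+ m / q - \sum_(k < M) z ^+ k * (lazy k m)%:C) <= (cn q)^-1 * cn z ^+ M.
Proof.
have qq : q != 0 by rewrite -cn_gt0 (disk_gt0 zq).
have four : 4 != 0 :> R[i] by rewrite pnatr_eq0.
have c2 : cn (2 : R[i]) = 2 by rewrite natrC cn_real ger0_norm.
have c4 : cn (4 : R[i]) = 4 by rewrite natrC cn_real ger0_norm.
elim: M m => [|M IH] m.
  rewrite big_ord0 subr0 mulr1 cnM cnV cnX ler_piMl ?invr_ge0 ?cn_ge0 //.
  by rewrite exprn_ile1 ?cn_ge0 // cn_rho0_le1.
pose e m := rho0 q ^+ m / q - \sum_(k < M) z ^+ k * (lazy k m)%:C.
rewrite big_ord_recl mul1r; case: m => [|m].
  have -> : rho0 q ^+ 0 / q - ((lazy 0 0)%:C + \sum_(k < M) z ^+ k.+1 * (lazy k.+1 0)%:C) =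
     z * ((e 0%N + e 1%N) / 2).
    have -> : rho0 q ^+ 0 / q = 1 + z * ((rho0 q ^+ 0 / q + rho0 q ^+ 1 / q) / 2).
      have n0 := onePq_neq0; have [_ zE _] := zq.
      have -> : z = 1 - q ^+ 2 by rewrite zE; ring.
      by rewrite /rho0 expr0 expr1; field; rewrite qq n0.
    have -> : \sum_(k < M) z ^+ k.+1 * (lazy k.+1 0)%:C =
      z * ((\sum_(k < M) z ^+ k * (lazy k 0)%:C + \sum_(k < M) z ^+ k * (lazy k 1)%:C) / 2).
      rewrite -!big_split /= mulr_suml mulr_sumr; apply: eq_bigr => k _.
      by rewrite lazyS0 exprS rmorphM fmorphV rmorph_nat rmorphD; field.
    by rewrite lazy0 rmorph1 /e; field.
  rewrite cnM exprS mulrCA ler_wpM2l ?cn_ge0 // cnf_div c2 ler_pdivrMr //.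
  apply: le_trans (cnD _ _) _.
  by have := IH 0%N; have := IH 1%N; rewrite -!/(e _); lra.
have -> : rho0 q ^+ m.+1 / q - ((lazy 0 m.+1)%:C +
    \sum_(k < M) z ^+ k.+1 * (lazy k.+1 m.+1)%:C) =
    z * ((e m + 2 * e m.+1 + e m.+2) / 4).
  have -> : rho0 q ^+ m.+1 / q = z * ((rho0 q ^+ m / q + 2 * (rho0 q ^+ m.+1 / q) + rho0 q ^+ m.+2 / q) / 4).
    apply: (mulfI four); rewrite !exprS; move: (rho0 q ^+ m) => t.
    by transitivity (4 * rho0 q * t / q); [ring|rewrite rho0_eq; field; rewrite qq].
  have -> : \sum_(k < M) z ^+ k.+1 * (lazy k.+1 m.+1)%:C =
    z * ((\sum_(k < M) z ^+ k * (lazy k m)%:C +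
          2 * \sum_(k < M) z ^+ k * (lazy k m.+1)%:C +
          \sum_(k < M) z ^+ k * (lazy k m.+2)%:C) / 4).
    rewrite mulr_sumr -!big_split /= mulr_suml mulr_sumr; apply: eq_bigr => k _.
    by rewrite lazySS exprS avg3C; field.
  rewrite lazy0 rmorph0 /e; move: (\sum_(k < M) _) (\sum_(k < M) _) (\sum_(k < M) _) => *.
  by field.
rewrite cnM exprS mulrCA ler_wpM2l ?cn_ge0 // cnf_div c4 ler_pdivrMr //.
apply: le_trans (cnD _ _) _.
apply: le_trans (lerD (cnD _ _) (lexx _)) _; rewrite cnM c2.
by have := IH m; have := IH m.+1; have := IH m.+2; rewrite -!/(e _); lra.
Qed.

End LazyWalk.

(** * Wallis' integrals and the Gaussian profile of the lazy walk *)

Section Wallis.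
Variable R : realType.
Local Notation mu := (@lebesgue_measure R).

Lemma Rintegral_derive (f F : R -> R) (a b : R) : a < b -> continuous f ->
  (forall x : R, is_derive x 1 F (f x)) -> \int[mu]_(x in `[a, b]) f x = F b - F a.
Proof.
move=> ab cf dF; have cF : continuous F.
  by move=> x; apply/differentiable_continuous/derivable1_diffP; have [] := dF x.
rewrite /Rintegral (@continuous_FTC2 _ f F) //.
- exact: continuous_subspaceT.
- split => [x _||]; first by have [] := dF x.
  + exact/cvg_at_right_filter/cF.
  + exact/cvg_at_left_filter/cF.
- by move=> x _; rewrite derive1E; have [_] := dF x.
Qed.

Definition wallis (k : nat) : R := \int[mu]_(x in `[0, pi / 2]) sin x ^+ k.

Lemma pihalf_gt0 : 0 < pi / 2 :> R. Proof. by rewrite divr_gt0 // pi_gt0. Qed.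

Lemma continuous_sinX k : continuous (fun x : R => sin x ^+ k).
Proof.
move=> x; elim: k => [|k IH]; first exact: cvg_cst.
have -> : (fun y : R => sin y ^+ k.+1) = (fun y => sin y * sin y ^+ k).
  by apply/funext => y; rewrite exprS.
by apply: cvgM IH; exact: continuous_sin.
Qed.

Lemma integrable_sinX k : mu.-integrable `[0, pi / 2] (EFin \o (fun x : R => sin x ^+ k)).
Proof.
apply: continuous_compact_integrable; first exact: segment_compact.
by apply: continuous_subspaceT; exact: continuous_sinX.
Qed.

Lemma wallis0 : wallis 0 = pi / 2.
Proof.
rewrite /wallis (@Rintegral_derive _ id) ?subr0 ?pihalf_gt0 //.
exact: (@continuous_sinX 0).
Qed.

Lemma wallis1 : wallis 1 = 1.
Proof.
have d (x : R) : is_derive x 1 (fun y : R => - cos y) (sin x ^+ 1).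
  by rewrite expr1 -[sin x]opprK; exact: (is_deriveN (is_derive_cos x)).
rewrite /wallis (Rintegral_derive pihalf_gt0 (@continuous_sinX 1) d).
by rewrite cos_pihalf cos0 oppr0 opprK add0r.
Qed.

(** The difference of the two integrands has the primitive - cos x sin^(k+1) x, which vanishes at
    both ends. *)
Lemma wallis_rec k : k.+2%:R * wallis k.+2 = k.+1%:R * wallis k.
Proof.
pose f (x : R) := k.+2%:R * sin x ^+ k.+2 - k.+1%:R * sin x ^+ k.
have cf : continuous f.
  by move=> x; apply: cvgB; apply: cvgM; try exact: cvg_cst; exact: continuous_sinX.
have d (x : R) : is_derive x 1 (fun y : R => - cos y * sin y ^+ k.+1) (f x).
  have d1 : is_derive x 1 (fun y : R => - cos y) (sin x).
    by rewrite -[sin x]opprK; exact: (is_deriveN (is_derive_cos x)).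
  have d2 := is_deriveM d1 (is_deriveX k.+1 (is_derive_sin x)).
  rewrite exprfctE in d2; apply: is_derive_eq d2 _.
  have sc : cos x ^+ 2 = 1 - sin x ^+ 2 by rewrite cos2sin2.
  rewrite /f /GRing.scale /= !exprS -[k.+2%:R]natr1.
  move: (sin x ^+ k) (k.+1%:R) => t m.
  transitivity (sin x * (sin x * t) - m * t * cos x ^+ 2).
    by ring.
  by rewrite sc; ring.
have h := Rintegral_derive pihalf_gt0 cf d.
rewrite cos_pihalf sin0 oppr0 expr0n mul0r mulr0 subr0 in h.
move: h; rewrite /f RintegralB //=; last 2 first.
- exact: (integrableZl _ _ (integrable_sinX k.+2)).
- exact: (integrableZl _ _ (integrable_sinX k)).
rewrite !RintegralZl //; try exact: integrable_sinX.
by move/eqP; rewrite subr_eq0 => /eqP.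
Qed.

Lemma wallis_decr k : wallis k.+1 <= wallis k.
Proof.
apply: le_Rintegral => //; try exact: integrable_sinX.
move=> x /=; rewrite in_itv /= => /andP[x0 xp].
rewrite exprS ler_piMl ?sin_le1 // exprn_ge0 // sin_ge0_pi // x0 /=.
by apply: le_trans xp _; have := pi_gt0 R; lra.
Qed.

Lemma wallis_prod k : k.+1%:R * (wallis k * wallis k.+1) = pi / 2.
Proof.
elim: k => [|k IH]; first by rewrite mul1r wallis0 wallis1 mulr1.
by rewrite mulrCA wallis_rec -IH; ring.
Qed.

Lemma lazy_central n : n.+1%:R * lazy R n.+1 0 = (n%:R + 2^-1) * lazy R n 0.
Proof.
rewrite lazyS0; have := lazy_step R n 0.
rewrite addn1 subr0 -natr1; move: (lazy R n 0) (lazy R n 1) => A B h.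
transitivity (((n%:R + 1) * A + (n%:R + 1) * B) / 2); first by ring.
by rewrite h; field.
Qed.

Lemma wallis_even n : wallis n.*2 = pi / 2 * lazy R n 0.
Proof.
elim: n => [|n IH]; first by rewrite wallis0 lazy0 mulr1.
have h : n.*2.+2%:R != 0 :> R by rewrite pnatr_eq0.
apply: (mulfI h); rewrite doubleS wallis_rec IH.
have -> : n.*2.+2%:R * (pi / 2 * lazy R n.+1 0) = pi * (n.+1%:R * lazy R n.+1 0).
  by rewrite -doubleS -muln2 natrM; field.
by rewrite lazy_central -natr1 -muln2 natrM; field.
Qed.

(** By monotonicity W_(2n)^2 lies between W_(2n) W_(2n+1) and W_(2n-1) W_(2n), both explicit by
    [wallis_prod]. This gives the constant sqrt pi without Stirling's formula. *)
Lemma lazy_central_sqr n : (0 < n)%N ->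
  (n%:R + 2^-1)^-1 <= pi * lazy R n 0 ^+ 2 <= n%:R^-1.
Proof.
move=> n0; have p0 := pi_gt0 R; have nr : 0 < n%:R :> R by rewrite ltr0n.
have b0 := lazy_ge0 R n 0.
have h1 := wallis_prod n.*2; have h2 := wallis_prod n.*2.-1.
have e1 : n.*2.-1.+1 = n.*2 by lia.
have d1 := wallis_decr n.*2; have d2 := wallis_decr n.*2.-1.
rewrite e1 in h2 d2; rewrite wallis_even in h1 h2 d1 d2.
have N1 : n.*2.+1%:R = 2 * n%:R + 1 :> R by rewrite -natr1 -muln2 natrM mulrC.
have N2 : n.*2%:R = 2 * n%:R :> R by rewrite -muln2 natrM mulrC.
rewrite N1 in h1; rewrite N2 in h2.
have w0 : 0 <= pi / 2 * lazy R n 0 by rewrite mulr_ge0 // divr_ge0 // ltW.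
move: (wallis _) (wallis _) (lazy R n 0) b0 h1 h2 d1 d2 w0 => W2 W1 b b0 h1 h2 d1 d2 w0.
apply/andP; split.
  rewrite -[leLHS]mul1r ler_pdivrMr; last by lra.
  rewrite -(ler_pM2l p0) mulr1.
  have : (2 * n%:R + 1) * (pi / 2 * b * W1) <= (2 * n%:R + 1) * (pi / 2 * b * (pi / 2 * b)).
    by rewrite ler_wpM2l ?(ler_wpM2l w0) //; lra.
  lra.
rewrite -[leRHS]mul1r ler_pdivlMr // -(ler_pM2l p0) mulr1.
have : 2 * n%:R * (pi / 2 * b * (pi / 2 * b)) <= 2 * n%:R * (W2 * (pi / 2 * b)).
  by rewrite ler_wpM2l ?(ler_wpM2r w0) //; lra.
lra.
Qed.

(** Product of the ratios 1 - (2 j + 1) / (n + j + 1) for j < m; the first m odd numbers add up to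
    m^2. The cap M keeps one denominator through the induction. *)
Lemma lazy_le n M m : (0 < n)%N -> (m <= M)%N ->
  lazy R n m <= lazy R n 0 * expR (- (m%:R ^+ 2 / (n%:R + M%:R))).
Proof.
move=> n0; have nr : 0 < n%:R :> R by rewrite ltr0n.
have D0 : 0 < n%:R + M%:R :> R by rewrite ltr_pwDl.
elim: m => [|m IH] mM; first by rewrite expr0n mul0r oppr0 expR0 mulr1.
have d0 : 0 < (n + m.+1)%:R :> R by rewrite ltr0n; lia.
have -> : lazy R n m.+1 = (1 - (2 * m%:R + 1) / (n + m.+1)%:R) * lazy R n m.
  apply: (mulfI (lt0r_neq0 d0)); rewrite lazy_step [in RHS]mulrA; congr (_ * _).
  rewrite mulrBr mulrCA divff ?gt_eqF // mulr1 natrD -natr1; ring.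
apply: le_trans (_ : expR (- ((2 * m%:R + 1) / (n%:R + M%:R))) * lazy R n m <= _).
  rewrite ler_wpM2r ?(lazy_ge0 R) //.
  apply: le_trans (expR_ge1Dx _); rewrite lerD2l lerN2 ler_wpM2l //.
  by rewrite lef_pV2 ?posrE // natrD lerD2l ler_nat.
apply: le_trans (ler_wpM2l (expR_ge0 _) (IH (ltnW mM))) _.
rewrite mulrCA -expRD; apply: ler_wpM2l; first exact: (lazy_ge0 R).
rewrite ler_expR -natr1 le_eqVlt; apply/orP; left; apply/eqP.
by field; rewrite gt_eqF.
Qed.

Lemma lazy_ge n M m : (M < n)%N -> (m <= M)%N ->
  lazy R n 0 * expR (- (m%:R ^+ 2 / (n%:R - M%:R))) <= lazy R n m.
Proof.
move=> Mn; have D0 : 0 < n%:R - M%:R :> R by rewrite subr_gt0 ltr_nat.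
elim: m => [|m IH] mM; first by rewrite expr0n mul0r oppr0 expR0 mulr1.
have d0 : 0 < (n + m.+1)%:R :> R by rewrite ltr0n; lia.
have d1 : 0 < n%:R - m%:R :> R by rewrite subr_gt0 ltr_nat; lia.
have -> : lazy R n m.+1 = (1 + (2 * m%:R + 1) / (n%:R - m%:R))^-1 * lazy R n m.
  apply: (mulfI (lt0r_neq0 d0)); rewrite lazy_step [in RHS]mulrA; congr (_ * _).
  have e : 1 + (2 * m%:R + 1) / (n%:R - m%:R) = (n + m.+1)%:R / (n%:R - m%:R) :> R.
    by rewrite natrD -natr1; field; rewrite gt_eqF.
  by rewrite e invf_div mulrCA divff ?gt_eqF // mulr1.
apply: le_trans (_ : expR (- ((2 * m%:R + 1) / (n%:R - M%:R))) * lazy R n m <= _); last first.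
  rewrite ler_wpM2r ?(lazy_ge0 R) // expRN.
  have t0 : 0 <= (2 * m%:R + 1) / (n%:R - m%:R) :> R.
    by rewrite divr_ge0 ?(ltW d1) // addr_ge0 // mulr_ge0.
  rewrite lef_pV2 ?posrE ?expR_gt0 ?ltr_pwDl //.
  apply: le_trans (expR_ge1Dx _) _; rewrite ler_expR ler_wpM2l ?addr_ge0 ?mulr_ge0 //.
  by rewrite lef_pV2 ?posrE // lerD2l lerN2 ler_nat ltnW.
apply: le_trans (ler_wpM2l (expR_ge0 _) (IH (ltnW mM))).
rewrite mulrCA -expRD; apply: ler_wpM2l; first exact: (lazy_ge0 R).
rewrite ler_expR -natr1 le_eqVlt; apply/orP; left; apply/eqP.
by field; rewrite gt_eqF.
Qed.

Lemma mul_expRN_le1 (x : R) : x * expR (- x) <= 1.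
Proof.
rewrite expRN -ler_pdivlMr ?invr_gt0 ?expR_gt0 // invrK mul1r.
by have := expR_ge1Dx x; lra.
Qed.

Lemma sqr_expRN_le4 (x : R) : 0 <= x -> x ^+ 2 * expR (- x) <= 4.
Proof.
move=> x0; have -> : x ^+ 2 * expR (- x) = 4 * (x / 2 * expR (- (x / 2))) ^+ 2.
  have -> : - x = - (x / 2) + - (x / 2) by field.
  by rewrite expRD; field.
have := mul_expRN_le1 (x / 2).
have : 0 <= x / 2 * expR (- (x / 2)) by rewrite mulr_ge0 ?expR_ge0 // divr_ge0.
by move: (_ * expR _) => y; nra.
Qed.

Lemma one_expRN_le (x : R) : 0 <= x -> expR (- x) <= 1.
Proof. by rewrite expR_le1 oppr_le0. Qed.

(* Weighted by [1 + X] because the first asymptotics of the theorem involve [X * lazy n m]. *)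
Lemma lazy_ratio n m (X := m%:R / Num.sqrt n%:R : R) : (0 < n)%N ->
  (1 + X) * `|lazy R n m - lazy R n 0 * expR (- X ^+ 2)| <=
  88 / Num.sqrt n%:R * lazy R n 0.
Proof.
move=> n0; have nr : 0 < n%:R :> R by rewrite ltr0n.
have s0 : 0 < Num.sqrt n%:R :> R by rewrite sqrtr_gt0.
have X0 : 0 <= X by rewrite divr_ge0 // ltW.
have b0 := lazy_ge0 R n 0.
have X2 : X ^+ 2 = m%:R ^+ 2 / n%:R by rewrite /X expr_div_n sqr_sqrtr // ltW.
have X20 : 0 <= X ^+ 2 by rewrite exprn_ge0.
have e2 : 0 < expR (- (X ^+ 2 / 2)) := expR_gt0 _.
have hE : expR (- X ^+ 2) <= expR (- (X ^+ 2 / 2)) by rewrite ler_expR; lra.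
have e1 := mul_expRN_le1 (X ^+ 2 / 2).
have e4 : (X ^+ 2 / 2) ^+ 2 * expR (- (X ^+ 2 / 2)) <= 4.
  by apply: sqr_expRN_le4; rewrite divr_ge0.
have e0 : expR (- (X ^+ 2 / 2)) <= 1 by apply: one_expRN_le; rewrite divr_ge0.
(* For m <= n / 2, [lazy_le] and [lazy_ge] frame exp(- X^2) with exponents O(X^3 / sqrt n) apart.
   Beyond, 2 X >= sqrt n, and the decay of each term pays for the factor 1 / sqrt n. *)
case: (leqP m.*2 n) => mn.
  have mn' : (m <= n)%N by apply: leq_trans mn; rewrite -addnn leq_addr.
  have mr : m%:R * 2 <= n%:R :> R by rewrite -natrM ler_nat muln2.
  have m0 : 0 <= m%:R :> R by [].
  have up := lazy_le n0 (leqnn m).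
  have lo : lazy R n 0 * expR (- (m%:R ^+ 2 / (n%:R - m%:R))) <= lazy R n m.
    by apply: lazy_ge => //; move: mn n0; clear; lia.
  set U := m%:R ^+ 2 / (n%:R + m%:R) in up; set L := m%:R ^+ 2 / (n%:R - m%:R) in lo.
  have D1 : 0 < n%:R + m%:R :> R by rewrite ltr_pwDl.
  have D2 : 0 < n%:R - m%:R :> R by lra.
  have UX : U <= X ^+ 2.
    by rewrite X2 ler_wpM2l ?exprn_ge0 // lef_pV2 ?posrE // lerDl.
  have XL : X ^+ 2 <= L.
    by rewrite X2 ler_wpM2l ?exprn_ge0 // lef_pV2 ?posrE // gerBl.
  have XU : X ^+ 2 / 2 <= U.
    rewrite X2 /U -mulrA -invfM ler_wpM2l ?exprn_ge0 // lef_pV2 ?posrE ?mulr_gt0 //; lra.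
  have LU : L - U <= 8 / 3 * X ^+ 3 / Num.sqrt n%:R.
    have -> : L - U = 2 * m%:R ^+ 3 / ((n%:R - m%:R) * (n%:R + m%:R)).
      by rewrite /L /U; field; rewrite !gt_eqF.
    have -> : 8 / 3 * X ^+ 3 / Num.sqrt n%:R = 2 * m%:R ^+ 3 / (3 / 4 * n%:R ^+ 2).
      have sE : n%:R = Num.sqrt n%:R ^+ 2 :> R by rewrite sqr_sqrtr // ltW.
      by rewrite [in RHS]sE /X; field; rewrite gt_eqF.
    rewrite ler_wpM2l ?mulr_ge0 ?exprn_ge0 // lef_pV2 ?posrE ?mulr_gt0 ?exprn_gt0 //; nra.
  have diff : `|lazy R n m - lazy R n 0 * expR (- X ^+ 2)| <=
      lazy R n 0 * (expR (- (X ^+ 2 / 2)) * (8 / 3 * X ^+ 3 / Num.sqrt n%:R)).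
    apply: le_trans (_ : lazy R n 0 * (expR (- U) - expR (- L)) <= _).
      have h1 : lazy R n 0 * expR (- X ^+ 2) <= lazy R n 0 * expR (- U).
        by rewrite ler_wpM2l // ler_expR lerN2.
      have h2 : lazy R n 0 * expR (- L) <= lazy R n 0 * expR (- X ^+ 2).
        by rewrite ler_wpM2l // ler_expR lerN2.
      by rewrite ler_norml; apply/andP; split; lra.
    rewrite ler_wpM2l //.
    have -> : expR (- U) - expR (- L) = expR (- U) * (1 - expR (- (L - U))).
      by rewrite mulrBr mulr1 -expRD; congr (_ - expR _); ring.
    apply: le_trans (_ : expR (- U) * (L - U) <= _).
      by rewrite ler_wpM2l ?expR_ge0 //; have := expR_ge1Dx (- (L - U)); lra.
    by rewrite ler_pM ?expR_ge0 ?ler_expR ?lerN2 //; lra.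
  apply: le_trans (ler_wpM2l _ diff) _; first by rewrite addr_ge0.
  have -> : (1 + X) * (lazy R n 0 * (expR (- (X ^+ 2 / 2)) * (8 / 3 * X ^+ 3 / Num.sqrt n%:R))) =
    (8 / 3 * ((X ^+ 3 + X ^+ 4) * expR (- (X ^+ 2 / 2)))) / Num.sqrt n%:R * lazy R n 0.
    by ring.
  rewrite ler_wpM2r // ler_pM2r ?invr_gt0 //.
  have X3 : X ^+ 3 + X ^+ 4 <= 1 + 2 * X ^+ 4.
    have -> : X ^+ 4 = X ^+ 3 * X by rewrite exprSr.
    have -> : X ^+ 3 = X ^+ 2 * X by rewrite exprSr.
    have [x1|x1] := lerP X 1; first by nra.
    have : X ^+ 2 * X <= X ^+ 2 * X * X by rewrite ler_peMr ?mulr_ge0 // ltW.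
    lra.
  (* 33 = 1 + 8 * 4 by e0 and e4; then 8 / 3 * 33 = 88. *)
  have X4 : (1 + 2 * X ^+ 4) * expR (- (X ^+ 2 / 2)) <= 33.
    have -> : (1 + 2 * X ^+ 4) * expR (- (X ^+ 2 / 2)) = expR (- (X ^+ 2 / 2)) +
      8 * ((X ^+ 2 / 2) ^+ 2 * expR (- (X ^+ 2 / 2))) by field.
    lra.
  have := ler_wpM2r (ltW e2) X3; lra.
have d : `|lazy R n m - lazy R n 0 * expR (- X ^+ 2)| <= lazy R n 0 * expR (- (X ^+ 2 / 2)).
  have h1 : 0 <= lazy R n 0 * expR (- X ^+ 2) by rewrite mulr_ge0 ?expR_ge0.
  have h2 : lazy R n 0 * expR (- X ^+ 2) <= lazy R n 0 * expR (- (X ^+ 2 / 2)).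
    by rewrite ler_wpM2l.
  have h3 := lazy_ge0 R n m.
  have h4 : lazy R n m <= lazy R n 0 * expR (- (X ^+ 2 / 2)).
    have [mn'|nm] := leqP m n.
      apply: le_trans (lazy_le n0 mn') _; rewrite ler_wpM2l // ler_expR lerN2 X2.
      rewrite le_eqVlt; apply/orP; left; apply/eqP; field.
      by rewrite !gt_eqF // addr_gt0.
    by rewrite (lazy_small R nm) mulr_ge0 ?expR_ge0.
  by rewrite ler_norml; apply/andP; split; lra.
apply: le_trans (ler_wpM2l _ d) _; first by rewrite addr_ge0.
rewrite mulrCA mulrC ler_wpM2r // ler_pdivlMr //.
have sX : Num.sqrt n%:R <= 2 * X.
  rewrite /X mulrA ler_pdivlMr // -expr2 sqr_sqrtr ?ltW //.
  by rewrite -natrM ltr_nat mulnC muln2.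
have x1 : (1 + X) * (2 * X) <= 2 + 4 * X ^+ 2 by nra.
apply: le_trans (_ : (1 + X) * expR (- (X ^+ 2 / 2)) * (2 * X) <= _).
  by rewrite ler_wpM2l // mulr_ge0 ?addr_ge0 // ltW.
rewrite mulrAC; have := ler_wpM2r (ltW e2) x1; lra.
Qed.

(** The centred normal density of variance 1/2, the variance of a lazy step. *)
Definition gauss (x : R) : R := expR (- x ^+ 2) / Num.sqrt pi.

Lemma lazy_gauss n m (X := m%:R / Num.sqrt n%:R : R) : (0 < n)%N ->
  (1 + X) * `|Num.sqrt n%:R * lazy R n m - gauss X| <= 90 / Num.sqrt n%:R.
Proof.
move=> n0; have nr : 0 < n%:R :> R by rewrite ltr0n.
have s0 : 0 < Num.sqrt n%:R :> R by rewrite sqrtr_gt0.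
have X0 : 0 <= X by rewrite divr_ge0 // ltW.
have p0 := pi_gt0 R; have sp0 : 0 < Num.sqrt pi :> R by rewrite sqrtr_gt0.
have b0 := lazy_ge0 R n 0.
have /andP[b1 b2] := lazy_central_sqr n0.
have h := lazy_ratio m n0; rewrite -/X in h.
set s := Num.sqrt n%:R in s0 h *; set E := expR (- X ^+ 2) in h.
have sE : s ^+ 2 = n%:R by rewrite sqr_sqrtr // ltW.
have pE : Num.sqrt pi ^+ 2 = pi :> R by rewrite sqr_sqrtr // ltW.
set t := Num.sqrt pi in sp0 pE.
(* The central probability divided by 1 / sqrt(pi n); it lies between 1 - 1 / sqrt n and 1, which
   adds 2 to the constant 88. *)
pose beta := s * lazy R n 0 * t.
have be0 : 0 <= beta by rewrite !mulr_ge0 // ltW.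
have be2 : beta ^+ 2 = pi * lazy R n 0 ^+ 2 * n%:R.
  by rewrite -pE -sE /beta; ring.
have B1 : beta ^+ 2 <= 1 by rewrite be2 -ler_pdivlMr // mul1r.
have B1' : beta <= 1 by rewrite -(@ler_pXn2r _ 2) ?nnegrE // expr1n.
have s1 : 1 <= s by rewrite -(@ler_pXn2r _ 2) ?nnegrE ?(ltW s0) // sE expr1n ler1n.
have B2 : 1 - 1 / s <= beta.
  apply: le_trans (_ : beta ^+ 2 <= _); last by rewrite expr2 ler_piMl.
  rewrite be2; apply: le_trans (_ : (n%:R + 2^-1)^-1 * n%:R <= _).
    have -> : (n%:R + 2^-1)^-1 * n%:R = 1 - (2 * n%:R + 1)^-1 :> R.
      by field; rewrite !gt_eqF // ?ltr_pwDl // ?mulr_gt0 // addr_gt0.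
    rewrite lerD2l lerN2 mul1r lef_pV2 ?posrE ?ltr_wpDl ?mulr_ge0 //.
    by rewrite -sE; nra.
  by rewrite ler_pM2r.
have E0 : 0 < E := expR_gt0 _.
have XE : (1 + X) * E <= 2.
  have := mul_expRN_le1 (X ^+ 2); have := one_expRN_le (sqr_ge0 X).
  rewrite -/E => e1 e2; have [x1|x1] := lerP X 1; first by nra.
  have : X * E <= X ^+ 2 * E by rewrite ler_wpM2r ?(ltW E0) // expr2 ler_peMl // ltW.
  lra.
have D0 : 0 < 1 + X by rewrite ltr_pwDl.
have main : (1 + X) * `|s * lazy R n m * t - E| <= 90 / s.
  have -> : s * lazy R n m * t - E =
     s * t * (lazy R n m - lazy R n 0 * E) + (beta - 1) * E by rewrite /beta; ring.
  apply: le_trans (ler_wpM2l (ltW D0) (ler_normD _ _)) _.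
  rewrite mulrDr !normrM (gtr0_norm s0) (gtr0_norm sp0) (gtr0_norm E0).
  have -> : 90 / s = 88 / s + 2 / s by ring.
  apply: lerD.
    rewrite mulrCA; apply: le_trans (ler_wpM2l _ h) _; first by rewrite mulr_ge0 // ltW.
    have -> : s * t * (88 / s * lazy R n 0) = 88 / s * beta.
      by rewrite /beta; ring.
    by rewrite ler_piMr // divr_ge0 // ltW.
  have -> : (1 + X) * (`|beta - 1| * E) = (1 + X) * E * `|beta - 1| by ring.
  have b1s : `|beta - 1| <= 1 / s by rewrite ler0_norm ?subr_le0 //; lra.
  have -> : 2 / s = 2 * (1 / s) by rewrite mul1r.
  by apply: ler_pM => //; rewrite mulr_ge0 ?(ltW D0) ?(ltW E0).
have -> : s * lazy R n m - gauss X = (s * lazy R n m * t - E) / t.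
  by rewrite /gauss -/t -/E; field; rewrite gt_eqF.
rewrite normrM normfV (gtr0_norm sp0) mulrA ler_pdivrMr //.
apply: le_trans main _; rewrite ler_peMr ?divr_ge0 ?(ltW s0) //.
rewrite -(@ler_pXn2r _ 2) ?nnegrE ?(ltW sp0) // pE expr1n.
by have := pi_ge2 R; lra.
Qed.

Lemma gauss_lip (X x : R) : 0 <= X -> X <= x -> x <= X + 1 ->
  `|gauss X - gauss x| <= 3 * (x - X) /\ `|X * gauss X - x * gauss x| <= 4 * (x - X).
Proof.
move=> X0 Xx xX; have p0 := pi_gt0 R.
have sp0 : 1 <= Num.sqrt pi :> R.
  rewrite -(@ler_pXn2r _ 2) ?nnegrE // sqr_sqrtr ?(ltW p0) // expr1n.
  by have := pi_ge2 R; lra.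
have sp1 : 0 < Num.sqrt pi :> R by lra.
set A := expR (- X ^+ 2); set B := expR (- x ^+ 2).
have A0 : 0 < A := expR_gt0 _; have B0 : 0 < B := expR_gt0 _.
have B1 : B <= 1 by apply: one_expRN_le; exact: sqr_ge0.
have A1 : A <= 1 by apply: one_expRN_le; exact: sqr_ge0.
have A2 : X ^+ 2 * A <= 1 := mul_expRN_le1 _.
have A3 : X * A <= 1 by have [x1|x1] := lerP X 1; nra.
have BA : B <= A by rewrite ler_expR lerN2 lerXn2r ?nnegrE //; lra.
have AB : A - B <= A * (x - X) * (2 * X + 1).
  have -> : A - B = A * (1 - expR (- (x ^+ 2 - X ^+ 2))).
    by rewrite mulrBr mulr1 -expRD; congr (_ - expR _); ring.
  rewrite -mulrA ler_wpM2l ?(ltW A0) //.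
  have := expR_ge1Dx (- (x ^+ 2 - X ^+ 2)).
  have : x ^+ 2 - X ^+ 2 <= (x - X) * (2 * X + 1).
    by rewrite subr_sqr ler_wpM2l ?subr_ge0 //; lra.
  lra.
have d0 : 0 <= x - X by rewrite subr_ge0.
have key (u v K : R) : `|u - v| <= K -> `|u / Num.sqrt pi - v / Num.sqrt pi| <= K.
  move=> uv; rewrite -mulrBl normrM normfV (gtr0_norm sp1) ler_pdivrMr //.
  by rewrite (le_trans uv) // ler_peMr // (le_trans _ uv).
have AB3 : A * (x - X) * (2 * X + 1) <= 3 * (x - X).
  have -> : A * (x - X) * (2 * X + 1) = (2 * (X * A) + A) * (x - X) by ring.
  by rewrite ler_wpM2r //; lra.
split; rewrite /gauss -/A -/B.
  by apply: key; rewrite ger0_norm ?subr_ge0 //; lra.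
rewrite !mulrA; apply: key.
have -> : X * A - x * B = X * (A - B) - (x - X) * B by ring.
have h1 : 0 <= X * (A - B) by rewrite mulr_ge0 // subr_ge0.
have h2 : 0 <= (x - X) * B by rewrite mulr_ge0 // ltW.
have h3 : (x - X) * B <= x - X by rewrite ler_piMr.
have h4 : X * (A - B) <= 3 * (x - X).
  apply: le_trans (ler_wpM2l X0 AB) _.
  have -> : X * (A * (x - X) * (2 * X + 1)) = (2 * (X ^+ 2 * A) + X * A) * (x - X) by ring.
  by rewrite ler_wpM2r //; lra.
by rewrite ler_norml; apply/andP; split; lra.
Qed.

End Wallis.

(** * Extraction of coefficients *)

Section TimeInversion.
Variable R : realType.

Lemma disk_exists (z : R[i]) : cn z < 1 -> exists q, disk z q.
Proof.
move=> z1; have R0 : 0 < Re (1 - z).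
  rewrite reCD reCN /= subr_gt0 (le_lt_trans _ z1) //.
  by rewrite (le_trans (ler_norm _)) // Re_le_cn.
have E := sqr_sqrtc (1 - z); set s := sqrtc _ in E.
have s0 : Re s != 0.
  apply/negP => /eqP s0; move: R0; rewrite -E expr2 reCM s0 mul0r sub0r.
  by rewrite oppr_gt0 -expr2 ltNge sqr_ge0.
case: (ltgtP (Re s) 0) s0 => // h _; last by exists s.
by exists (- s); split; rewrite ?sqrrN // reCN oppr_gt0.
Qed.

(** K may depend on N. Sending the truncation to infinity shows that W is the sum of the series,
    whose tail is then controlled by U alone: the truncation M can be fixed before N. *)
Lemma partial_sum_tail (u : nat -> R) (W z : R[i]) (K U : R) :
  cn z < 1 -> (forall k, `|u k| <= U) ->
  (forall M, cn (W - \sum_(k < M) z ^+ k * (u k)%:C) <= K * cn z ^+ M) ->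
  forall M, cn (W - \sum_(k < M) z ^+ k * (u k)%:C) <= U / (1 - cn z) * cn z ^+ M.
Proof.
move=> z1 u1 hK M; have z0 := cn_ge0 z.
apply/ler_addgt0Pr => e e0.
have K0 : 0 < `|K| + 1 by rewrite ltr_wpDl.
have [m _ hm] := near_exp_le (introT andP (conj z0 z1)) (divr_gt0 e0 K0).
pose M' := (M + m)%N.
have h1 : cn (W - \sum_(k < M') z ^+ k * (u k)%:C) <= e.
  apply: le_trans (hK M') _; apply: le_trans (_ : (`|K| + 1) * cn z ^+ M' <= _).
    by rewrite ler_wpM2r ?exprn_ge0 //; have := ler_norm K; lra.
  by rewrite mulrC -ler_pdivlMr //; apply: hm; rewrite /= leq_addl.
have h2 : cn (\sum_(k < M') z ^+ k * (u k)%:C - \sum_(k < M) z ^+ k * (u k)%:C) <=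
   U / (1 - cn z) * cn z ^+ M.
  rewrite /M' big_split_ord /= [X in cn X]addrAC subrr add0r.
  apply: le_trans (cn_sum _ _ _) _.
  apply: le_trans (_ : \sum_(i < m) U * cn z ^+ M * cn z ^+ i <= _).
    apply: ler_sum => i _; rewrite cnM cnX cn_real exprD.
    by rewrite mulrC -mulrA ler_wpM2r // mulr_ge0 // exprn_ge0.
  have U0 : 0 <= U := le_trans (normr_ge0 _) (u1 0%N).
  rewrite -mulr_sumr mulrAC ler_wpM2r ?exprn_ge0 // ler_wpM2l //.
  rewrite -[leRHS]mul1r ler_pdivlMr ?subr_gt0 //.
  have := subrX1 (cn z) m; have : 0 <= cn z ^+ m by rewrite exprn_ge0.
  by move: (\sum_(i < m) _) => S; nra.
have -> : W - \sum_(k < M) z ^+ k * (u k)%:C = (W - \sum_(k < M') z ^+ k * (u k)%:C) +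
  (\sum_(k < M') z ^+ k * (u k)%:C - \sum_(k < M) z ^+ k * (u k)%:C) by ring.
by apply: le_trans (cnD _ _) _; rewrite addrC lerD.
Qed.

(** Cauchy's estimate with M sample points. It is exact on polynomials of degree below M, so the
    truncation error K takes care of aliasing. *)
Lemma time_inversion (u : nat -> R) (W : R[i] -> R[i]) (r K : R) (n M : nat) :
  0 <= r -> (n < M)%N ->
  (forall z, cn z = r -> cn (W z - \sum_(k < M) z ^+ k * (u k)%:C) <= K) ->
  `|u n| * r ^+ n <= avg M (fun j => cn (W (r%:C * cis (th R M j)))) + K.
Proof.
move=> r0 nM hW; have M0 : (0 < M)%N by exact: leq_ltn_trans nM.
pose c k : R[i] := (r ^+ k * u k)%:C.
have h : avgC M (fun j => cis (- (th R M j * n%:Z%:~R)) *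
    \sum_(k < M) c k * cis (th R M j * k%:R)) = c n.
  by rewrite (avgC_coef c (k0 := Ordinal nM)) //= subrr dvdz0.
have -> : `|u n| * r ^+ n = cn (c n).
  by rewrite /c cn_real normrM normrX (ger0_norm r0) mulrC.
rewrite -h -[X in _ + X](avg_cst K M0) -avgD; apply: le_trans (cn_avgC _ _) _.
apply: ler_avg => j jM; rewrite cnM cn_cis mul1r.
set z := r%:C * cis (th R M j).
have zr : cn z = r by rewrite cn_realM // cn_cis mulr1.
have -> : \sum_(k < M) c k * cis (th R M j * k%:R) = \sum_(k < M) z ^+ k * (u k)%:C.
  apply: eq_bigr => k _; rewrite /c /z exprMn mulr_natr cisMn rmorphM rmorphXn /=; ring.
have := hW _ zr; set S := \sum_(k < M) _ => hS.
have -> : S = W z - (W z - S) by ring.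
by apply: le_trans (cnB _ _) _; rewrite lerD2l.
Qed.

(** The fourth power is chosen because |q|^4 = |1 - z|^2, the denominator in [avg_poisson]. *)
Lemma pow4_expRN (x : R) : 0 < x -> expR (- x) <= 256 / x ^+ 4.
Proof.
move=> x0; rewrite ler_pdivlMr ?exprn_gt0 //.
have x2 : 0 <= x / 2 by rewrite divr_ge0 // ltW.
have h := sqr_expRN_le4 x2.
have h0 : 0 <= (x / 2) ^+ 2 * expR (- (x / 2)) by rewrite mulr_ge0 ?exprn_ge0 ?expR_ge0.
have -> : expR (- x) * x ^+ 4 = 16 * ((x / 2) ^+ 2 * expR (- (x / 2))) ^+ 2.
  have -> : - x = - (x / 2) + - (x / 2) by field.
  by rewrite expRD; field.
by move: (_ * expR _) h h0 => y; nra.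
Qed.

(* The radius of the circle on which the [n]-th coefficient is extracted. *)
Definition crad (n : nat) : R := 1 - (2 * n%:R)^-1.

Lemma crad_itv n : (0 < n)%N -> 2^-1 <= crad n < 1.
Proof.
move=> n0; have nr : 1 <= n%:R :> R by rewrite ler1n.
rewrite /crad; apply/andP; split.
  by rewrite invfM; have : n%:R^-1 <= 1 :> R; [rewrite invf_le1 // ltr0n|lra].
by rewrite gtrBl invr_gt0 mulr_gt0 // ltr0n.
Qed.

Lemma cradX n : (0 < n)%N -> 2^-1 <= crad n ^+ n.
Proof.
move=> n0; have nr : 1 <= n%:R :> R by rewrite ler1n.
have /andP[r2 r1] := crad_itv n0.
have B m : 1 - m%:R * (2 * n%:R)^-1 <= crad n ^+ m.
  elim: m => [|m IH]; first by rewrite mul0r subr0.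
  rewrite exprS; apply: le_trans (ler_wpM2l _ IH); last by lra.
  have t0 : 0 <= (2 * n%:R)^-1 :> R by rewrite invr_ge0 mulr_ge0.
  have m0 : 0 <= m%:R :> R by [].
  rewrite /crad -natr1; nra.
apply: le_trans (B n); rewrite invfM mulrCA divff ?mulr1; first by lra.
by rewrite gt_eqF // ltr0n.
Qed.

(** The hypotheses on D hold eventually in N for each z, which is enough as only finitely many z are
    sampled. The weight w is the scale of D: 1 for the joint law, of order sqrt n for the occupation
    measure alone. The square of eps anticipates a geometric mean. *)
Lemma coef_bound (C c kappa eps d w v U : R) (n l : nat)
  (u : nat -> nat -> R) (D : nat -> R[i] -> R[i]) :
  0 < C -> 0 < c -> 0 < kappa -> 0 < eps -> 0 < d -> 0 < w -> 0 < U -> (0 < n)%N ->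
  kappa * Num.sqrt n%:R <= l%:R ->
  (\forall N \near \oo, forall k, `|u N k| <= U) ->
  (\forall N \near \oo, forall z, cn z = crad n -> exists K, forall M,
     cn (D N z - \sum_(k < M) z ^+ k * (u N k)%:C) <= K * cn z ^+ M) ->
  (forall z q, cn z = crad n -> disk z q -> \forall N \near \oo,
     cn (D N z) <= w * (C * expR (- (c * l%:R * cn q)))) ->
  (forall z q, cn z = crad n -> disk z q -> cn q < d -> \forall N \near \oo,
     cn (D N z) <= w * (eps ^+ 2 / C)) ->
  u N n @[N --> \oo] --> v ->
  n%:R * `|v| <= w * (8 * 16 ^+ 3 / (c * kappa) ^+ 4 * eps + 512 * C / (c * kappa * d) ^+ 4 / n%:R).
Proof.
move=> C0 c0 k0 eps0 d0 w0 U0 n0 kl hu hpart hup hnear huv.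
have nr : 0 < n%:R :> R by rewrite ltr0n.
have s0 : 0 < Num.sqrt n%:R :> R by rewrite sqrtr_gt0.
have sE : Num.sqrt n%:R ^+ 2 = n%:R :> R by rewrite sqr_sqrtr // ltW.
move: (Num.sqrt n%:R) s0 sE kl => s s0 sE kl.
set r := crad n in hpart hup hnear.
have /andP[r2 r1] := crad_itv n0; rewrite -/r in r2 r1.
have r0 : 0 <= r by apply: le_trans r2; rewrite invr_ge0.
have r01 : 0 <= r < 1 by rewrite r0.
(* 16^3 = 256 * 2^4 comes from [pow4_expRN] at x / 2, where x = c kappa sqrt n |q| and x^4 = (c
   kappa)^4 n^2 |1 - z|^2; B is the same at |q| = d, without the halving. *)
pose A := 16 ^+ 3 / (c * kappa) ^+ 4 * eps / n%:R ^+ 2.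
pose B := 256 * C / (c * kappa * d) ^+ 4 / n%:R ^+ 2.
have A0 : 0 < A by rewrite !(divr_gt0, mulr_gt0, exprn_gt0).
have B0 : 0 < B.
  by rewrite !(divr_gt0, exprn_gt0) ?mulr_gt0 ?ltr0n.
have ptw z : cn z = r -> \forall N \near \oo,
    cn (D N z) <= w * (A * (cn (1 - z) ^+ 2)^-1 + B).
  move=> zr; have [q zq] : exists q, disk z q by apply: disk_exists; rewrite zr.
  have q0 := disk_gt0 zq.
  have lq : c * kappa * s * cn q <= c * l%:R * cn q.
    by rewrite ler_pM2r // -mulrA ler_pM2l.
  have x0 : 0 < c * kappa * s * cn q by rewrite !mulr_gt0.
  have e1 : expR (- (c * l%:R * cn q)) <= expR (- (c * kappa * s * cn q)).
    by rewrite ler_expR lerN2.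
  have zq2 := disk_cn1B zq.
  have [qd|qd] := ltP (cn q) d.
    near=> N.
    have h1 : cn (D N z) <= w * (C * expR (- (c * l%:R * cn q))) by near: N; exact: hup.
    have h2 : cn (D N z) <= w * (eps ^+ 2 / C) by near: N; exact: (hnear _ _ zr zq qd).
    set x := c * kappa * s * cn q in x0 e1.
    (* Geometric mean of h1 and h2: small and decaying at once, for half the rate. *)
    have h3 : cn (D N z) <= w * (eps * expR (- (x / 2))).
      rewrite -(@ler_pXn2r _ 2) ?nnegrE ?cn_ge0 ?mulr_ge0 ?expR_ge0 ?(ltW w0) ?(ltW eps0) //.
      have -> : (w * (eps * expR (- (x / 2)))) ^+ 2 =
          (w * (C * expR (- x))) * (w * (eps ^+ 2 / C)).
        have -> : - x = - (x / 2) + - (x / 2) by field.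
        by rewrite expRD; field; rewrite gt_eqF.
      rewrite expr2 ler_pM ?cn_ge0 //; apply: le_trans h1 _.
      by rewrite ler_pM2l // ler_pM2l.
    apply: le_trans h3 _; rewrite ler_pM2l //.
    apply: le_trans (_ : A * (cn (1 - z) ^+ 2)^-1 <= _); last by rewrite lerDl ltW.
    have x20 : 0 < x / 2 by rewrite divr_gt0.
    apply: le_trans (ler_wpM2l (ltW eps0) (pow4_expRN x20)) _.
    rewrite zq2 /A -sE /x le_eqVlt; apply/orP; left; apply/eqP; field.
    by rewrite !gt_eqF.
  near=> N.
  have h1 : cn (D N z) <= w * (C * expR (- (c * l%:R * cn q))) by near: N; exact: hup.
  apply: le_trans h1 _; rewrite ler_pM2l //.
  apply: le_trans (_ : B <= _); last first.
    by rewrite lerDr mulr_ge0 ?(ltW A0) // invr_ge0 exprn_ge0 // cn_ge0.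
  have y0 : 0 < c * kappa * s * d by rewrite !mulr_gt0.
  apply: le_trans (_ : C * expR (- (c * kappa * s * d)) <= _).
    rewrite ler_pM2l // (le_trans e1) // ler_expR lerN2 ler_pM2l ?mulr_gt0 //.
  apply: le_trans (ler_wpM2l (ltW C0) (pow4_expRN y0)) _.
  rewrite /B -sE le_eqVlt; apply/orP; left; apply/eqP; field.
  by rewrite !gt_eqF.
have main (e : R) : 0 < e -> `|v| * r ^+ n <= w * (A * (4 * n%:R) + B) + e.
  move=> e0.
  have e2 : 0 < e / 2 / U * (1 - r) by rewrite mulr_gt0 ?subr_gt0 // !divr_gt0.
  have [M0 _ hM0] := near_exp_le r01 e2.
  have [M1 _ hM1] := near_avg_poisson r01.
  (* M depends on r, e, U and n but not on N, so the pointwise bounds hold together at the M sample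
     points for large N. *)
  pose M := maxn (maxn M0 M1) n.+1.
  have hM : r ^+ M <= e / 2 / U * (1 - r) by apply: hM0; rewrite /= /M !leq_max leqnn.
  have hP := hM1 M; rewrite /= in hP.
  have {}hP := hP (leq_trans (leq_maxr M0 M1) (leq_maxl _ _)).
  have nM : (n < M)%N by rewrite leq_maxr.
  have M00 : (0 < M)%N by exact: leq_ltn_trans nM.
  have fin : \forall N \near \oo, forall j : 'I_M,
      cn (D N (r%:C * cis (th R M j))) <=
      w * (A * (cn (1 - r%:C * cis (th R M j)) ^+ 2)^-1 + B).
    apply: filter_forall => j; apply: ptw.
    by rewrite cn_realM // cn_cis mulr1.
  have bd : \forall N \near \oo, `|u N n| * r ^+ n <= w * (A * (4 * n%:R) + B) + e / 2.
    near=> N.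
    have hf : forall j : 'I_M, cn (D N (r%:C * cis (th R M j))) <=
      w * (A * (cn (1 - r%:C * cis (th R M j)) ^+ 2)^-1 + B) by near: N.
    have hp : forall z, cn z = r -> exists K, forall M,
     cn (D N z - \sum_(k < M) z ^+ k * (u N k)%:C) <= K * cn z ^+ M by near: N.
    have h1 : forall k, `|u N k| <= U by near: N.
    have hT : forall z, cn z = r -> cn (D N z - \sum_(k < M) z ^+ k * (u N k)%:C) <= e / 2.
      move=> z zr; have [K hK] := hp _ zr.
      have z1 : cn z < 1 by rewrite zr.
      apply: le_trans (partial_sum_tail z1 h1 hK M) _.
      rewrite zr; apply: le_trans (ler_wpM2l _ hM) _.
        by rewrite divr_ge0 ?(ltW U0) // subr_ge0 ltW.
      by rewrite le_eqVlt; apply/orP; left; apply/eqP; field; rewrite !gt_eqF ?subr_gt0.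
    apply: le_trans (time_inversion r0 nM hT) _; rewrite lerD2r.
    apply: le_trans (_ : avg M (fun j => w * (A * (cn (1 - r%:C * cis (th R M j)) ^+ 2)^-1 + B)) <= _).
      by apply: ler_avg => j jM; exact: (hf (Ordinal jM)).
    rewrite avgZ avgD avgZ avg_cst // ler_pM2l // lerD2r ler_pM2l //.
    apply: le_trans hP _; rewrite ler_pdivrMr; last by rewrite subr_gt0 expr_lt1.
    have rE : (2 * n%:R) * (1 - r) = 1 by rewrite /r /crad subKr divff // gt_eqF // mulr_gt0.
    have : 0 <= r * (2 * n%:R * (1 - r)) by rewrite rE mulr1.
    have -> : 4 * n%:R * (1 - r ^+ 2) = 2 * (2 * n%:R * (1 - r)) + 2 * (r * (2 * n%:R * (1 - r))) by ring.
    by rewrite rE; lra.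
  have cv : `|u N n| * r ^+ n @[N --> \oo] --> `|v| * r ^+ n.
    by apply: cvgM; [exact: (cvg_norm huv)|exact: cvg_cst].
  have h3 : `|v| * r ^+ n <= w * (A * (4 * n%:R) + B) + e / 2.
    rewrite -(cvg_lim (@norm_hausdorff _ _) cv); apply: limr_le.
      by apply/cvg_ex; eexists; exact: cv.
    exact: bd.
  by apply: le_trans h3 _; rewrite lerD2l; lra.
have {}main : `|v| * r ^+ n <= w * (A * (4 * n%:R) + B) by apply/ler_addgt0Pr => e e0; exact: main.
have rn := cradX n0; rewrite -/r in rn.
have : `|v| * 2^-1 <= w * (A * (4 * n%:R) + B).
  by apply: le_trans main; rewrite ler_wpM2l.
move=> h; apply: le_trans (_ : n%:R * (2 * (w * (A * (4 * n%:R) + B))) <= _).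
  by rewrite ler_pM2l //; lra.
rewrite /A /B le_eqVlt; apply/orP; left; apply/eqP; field.
by rewrite !gt_eqF.
Unshelve. all: by end_near. Qed.

End TimeInversion.

(** * Comparison of the walk with the lazy walk *)

Section LocalLimit.
Variables (R : realType) (f : R -> R[i]) (p : nat -> int -> R) (nu C1 c2 : R).
Hypothesis p_ge0 : forall N x, 0 <= p N x.
Hypothesis p_sum1 : forall N, (0 < N)%N -> forall x, \sum_(r < N) p N (x - r%:Z) = 1.
Hypothesis p_fourier : forall N, (0 < N)%N -> forall j (x : int),
  \sum_(r < N) (p N (x - r%:Z))%:C * cis (- (th R N j * r%:R)) =
  f (th R N j) * cis (- (th R N j * x%:~R)).
Hypothesis nu_gt0 : 0 < nu.
Hypothesis C1_gt0 : 0 < C1.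
Hypothesis c2_gt0 : 0 < c2.
Hypothesis f_upper : forall t, cn (1 - f t) <= C1 * (1 - cos t).
Hypothesis f_lower : forall N j, (1 < N)%N ->
  cn (f (th R N j)) <= 1 - c2 * (1 - cos (th R N j)).
Hypothesis f_taylor : forall e, 0 < e -> exists2 d, 0 < d &
  forall t, 1 - cos t < d -> cn (1 - f t - (nu * (1 - cos t))%:C) <= e * (1 - cos t).

Variable mu : nat -> int -> nat -> int -> nat -> R.
Hypothesis mu0 : forall N a x l, mu N a 0 x l = ((N %| x)%Z && (l == 0)%N)%:R.
Hypothesis muS : forall N a n x l, (0 < N)%N ->
  mu N a n.+1 x l = step N a (fun h x => \sum_(r < N) p N (x - r%:Z) * h r) (mu N a n) x l.
Hypothesis mu_ge0 : forall N a n x l, 0 <= mu N a n x l.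
Hypothesis mu_le1 : forall N a n x l, mu N a n x l <= 1.
Hypothesis mu_sum_le1 : forall N a n l, \sum_(x < N) mu N a n x%:Z l <= 1.

Lemma disk_uniq (z q q' : R[i]) : disk z q -> disk z q' -> q = q'.
Proof.
case=> _ qE q0 [_ qE' q0'].
have : (q - q') * (q + q') = 0 by rewrite -subr_sqr qE qE' subrr.
move/eqP; rewrite mulf_eq0 subr_eq0 => /orP[/eqP //|/eqP h].
have : Re (q + q') = 0 by rewrite h.
by rewrite reCD => h'; have := addr_gt0 q0 q0'; rewrite h' ltxx.
Qed.

(** Makes q a function of z, as [coef_bound] requires; the default 0 occurs only outside the open
    unit disk. *)
Definition disk_root (z : R[i]) : R[i] := xget 0 [set q | disk z q].

Lemma disk_rootE z q : disk z q -> disk_root z = q.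
Proof.
move=> zq; apply: (disk_uniq _ zq); rewrite /disk_root.
by case: xgetP => [q' _ //|/(_ q)].
Qed.

Lemma lazy_hit_itv n m : 0 <= lazy_hit R n m <= 1.
Proof.
elim: n m => [|n IH] [|m].
- by rewrite lazy_hit0 eqxx ler01 lexx.
- by rewrite /lazy_hit /= lexx ler01.
- by rewrite lazy_hit0 /= lexx ler01.
have /andP[a1 a2] := IH m; have /andP[b1 b2] := IH m.+1; have /andP[d1 d2] := IH m.+2.
by rewrite lazy_hitSS; apply/andP; split; lra.
Qed.

Lemma lazy_itv n m : 0 <= lazy R n m <= 1.
Proof.
elim: n m => [|n IH] m; first by rewrite lazy0; case: (m == 0)%N; rewrite ?lexx ler01.
case: m => [|m].
  have /andP[a1 a2] := IH 0%N; have /andP[b1 b2] := IH 1%N.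
  by rewrite lazyS0; apply/andP; split; lra.
have /andP[a1 a2] := IH m; have /andP[b1 b2] := IH m.+1; have /andP[d1 d2] := IH m.+2.
by rewrite lazySS; apply/andP; split; lra.
Qed.

Local Notation Vis N z a l := (visit N (fun j => f (th R N j)) z a l).
Local Notation G N z y := (green N (fun j => f (th R N j)) z y).
Local Notation c1 := (c1 nu).

(* The index of the lazy walk matching the rescaled quantity [s]. *)
Definition lattice_index (s : R) : nat := Num.truncn (c1 / 2 * s).

Lemma index_itv s : 0 <= s -> (lattice_index s)%:R <= c1 / 2 * s <= (lattice_index s)%:R + 1.
Proof.
move=> s0; have c10 := ltW (c1_gt0 nu_gt0).
have /truncn_itv /andP[h1 h2] : 0 <= c1 / 2 * s by rewrite mulr_ge0 // divr_ge0.
by rewrite h1 /= natr1 ltW.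
Qed.

(** The unit lost by truncation costs at most exp(|q| / 18), covered by [expR 1]. *)
Lemma rho0_decay z q (s : R) (l : nat) : disk z q -> nu * l%:R <= s ->
  cn (rho0 q ^+ lattice_index s) <= expR 1 * expR (- (nu * c1 / 36 * l%:R * cn q)).
Proof.
move=> zq ls; have q0 := disk_gt0 zq; have q2 := disk_le2 zq.
have c10 := c1_gt0 nu_gt0.
have s0 : 0 <= s by apply: le_trans ls; rewrite mulr_ge0 // ltW.
have /andP[_ h] := index_itv s0.
rewrite cnX; apply: le_trans (_ : expR (- (cn q / 18)) ^+ lattice_index s <= _).
  rewrite lerXn2r ?nnegrE ?cn_ge0 ?expR_ge0 //.
  by apply: le_trans (cn_rho0_le zq) _; exact: expR_ge1Dx.
rewrite -expRM_natl -expRD ler_expR.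
have : c1 / 2 * (nu * l%:R) <= (lattice_index s)%:R + 1.
  by apply: le_trans h; rewrite ler_pM2l // divr_gt0.
move=> /(ler_wpM2r (ltW q0)); lra.
Qed.

Lemma visit_decay : exists C c, [/\ 0 < C, 0 < c & forall z q, disk z q ->
  forall (a y : int) (l : nat) (s : R), nu * l.+1%:R <= s -> \forall N \near \oo,
    cn (Vis N z a l.+1 * G N z y - rho0 q ^+ lattice_index s) <= C * expR (- (c * l.+1%:R * cn q)) /\
    cn (q * (Vis N z a l.+1 / (1 - z)) - (nu * c1)%:C * rho0 q ^+ lattice_index s)
      <= C * expR (- (c * l.+1%:R * cn q))].
Proof.
have [C [c [C0 cc0 h]]] := visit_upper p_ge0 p_sum1 p_fourier nu_gt0 C1_gt0 c2_gt0 f_upper f_lower f_taylor.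
have n0 := nuc1_gt0 nu_gt0.
pose c' := Num.min c (nu * c1 / 36).
have c'0 : 0 < c' by rewrite lt_min cc0 divr_gt0.
have [e1 e2] : c' <= c /\ c' <= nu * c1 / 36 by rewrite !ge_min !lexx orbT.
exists (C * expR (2 * c) + (1 + nu * c1) * expR 1), c'; split=> //.
  by rewrite addr_gt0 ?mulr_gt0 ?expR_gt0 ?addr_gt0.
move=> z q zq a y l s ls; have q0 := disk_gt0 zq; have q2 := disk_le2 zq.
have r0 := rho0_decay zq ls.
have r1 : cn (rho0 q ^+ lattice_index s) <= expR 1 * expR (- (c' * l.+1%:R * cn q)).
  apply: le_trans r0 _; rewrite ler_pM2l ?expR_gt0 // ler_expR lerN2.
  by rewrite ler_pM2r // ler_pM2r // ltr0n.
near=> N.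
have hh : forall a y l, cn (Vis N z a l.+1 * G N z y) <= C * (1 - c * cn q) ^+ l /\
    cn (q * (Vis N z a l.+1 / (1 - z))) <= C * (1 - c * cn q) ^+ l by near: N; exact: h.
have [h1 h2] := hh a y l.
have P : C * (1 - c * cn q) ^+ l <= C * expR (2 * c) * expR (- (c' * l.+1%:R * cn q)).
  rewrite -mulrA ler_pM2l //.
  (* A negative base is impossible: with exponent 1 it would bound a modulus from above by a
     negative number. *)
  have [X|X] := leP 0 (1 - c * cn q); last first.
    have := cn_ge0 (Vis N z a 1 * G N z y).
    have [+ _] := hh a y 1%N; rewrite expr1 => t1 _.
    have : 0 <= C * (1 - c * cn q) := le_trans (cn_ge0 _) t1.
    by rewrite pmulr_rge0 // leNgt X.
  apply: le_trans (_ : expR (- (c * cn q)) ^+ l <= _).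
    by rewrite lerXn2r ?nnegrE ?expR_ge0 //; exact: expR_ge1Dx.
  rewrite -expRM_natl -expRD ler_expR.
  have t1 : c * cn q <= c * 2 by rewrite ler_pM2l.
  have t2 : c' * l.+1%:R * cn q <= c * l.+1%:R * cn q by rewrite ler_pM2r // ler_pM2r // ltr0n.
  by rewrite -natr1 in t2 *; lra.
have Q0 : 0 < expR (- (c' * l.+1%:R * cn q)) := expR_gt0 _.
have E0 : 0 < expR 1 * expR (- (c' * l.+1%:R * cn q)) by rewrite mulr_gt0 ?expR_gt0.
split; (apply: le_trans (cnB _ _) _).
  have := mulr_gt0 n0 E0; lra.
rewrite cn_realM ?(ltW n0) //.
have := ler_wpM2l (ltW n0) r1; lra.
Unshelve. all: by end_near. Qed.

(** The shift by nu reflects that l visits involve only l - 1 returns. *)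
Lemma index_near (s : R) : 0 <= s ->
  `|2 * (lattice_index s)%:R - c1 * (s - nu)| <= 2 + nu * c1.
Proof.
move=> s0; have /andP[h1 h2] := index_itv s0; have n0 := nuc1_gt0 nu_gt0.
by rewrite ler_norml; apply/andP; split; lra.
Qed.

Lemma large_nat (B e : R) : 0 < B -> 0 < e -> exists n0 : nat, forall n, (n0 <= n)%N ->
  [/\ (0 < n)%N, B / n%:R <= e & 100 / Num.sqrt n%:R <= e].
Proof.
move=> B0 e0; pose X := B / e + (100 / e) ^+ 2.
have X0 : 0 <= X by rewrite addr_ge0 ?exprn_ge0 ?divr_ge0 // ltW.
exists (Num.truncn X).+1 => n nn; have /truncn_itv /andP[_ X1] := X0.
have Xn : X < n%:R by apply: lt_le_trans X1 _; rewrite ler_nat.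
have nr : 0 < n%:R :> R := le_lt_trans X0 Xn.
have s0 : 0 < Num.sqrt n%:R :> R by rewrite sqrtr_gt0.
have t1 : 0 < B / e by rewrite divr_gt0.
have t2 : 0 <= (100 / e) ^+ 2 by rewrite exprn_ge0 // divr_ge0 // ltW.
split; first by rewrite -(ltr_nat R).
  rewrite ler_pdivrMr // mulrC -ler_pdivrMr //; rewrite /X in Xn; lra.
rewrite ler_pdivrMr // mulrC -ler_pdivrMr // -(@ler_pXn2r _ 2) ?nnegrE ?(ltW s0) //.
  by rewrite sqr_sqrtr ?(ltW nr) //; rewrite /X in Xn; lra.
by rewrite divr_ge0 // ltW.
Qed.

Lemma normr_int (a : int) : `|a%:~R| = `|a|%N%:R :> R.
Proof. by rewrite -intr_norm -abszE. Qed.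

Definition scale (a x : int) (l : nat) : R := `|a|%N%:R + `|x - a|%N%:R + nu * l%:R.
Definition scale' (a : int) (l : nat) : R := `|a|%N%:R + nu * l%:R.

Lemma sqrt_const : Num.sqrt (2 * pi * nu) = 2 / c1 * Num.sqrt pi.
Proof.
have c10 := c1_gt0 nu_gt0; have p0 := pi_gt0 R.
have h : 0 <= 2 / c1 * Num.sqrt pi by rewrite mulr_ge0 ?sqrtr_ge0 // divr_ge0 // ltW.
rewrite -[RHS](ger0_norm h) -sqrtr_sqr exprMn expr_div_n (sqr_c1 nu_gt0).
by rewrite sqr_sqrtr ?(ltW p0) //; congr Num.sqrt; field; rewrite gt_eqF.
Qed.

Lemma gauss_scale (t : R) : expR (- t ^+ 2 / (2 * nu)) / Num.sqrt (2 * pi * nu) =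
  c1 / 2 * gauss (c1 / 2 * t).
Proof.
have c10 := c1_gt0 nu_gt0; have p0 : 0 < Num.sqrt pi :> R by rewrite sqrtr_gt0 pi_gt0.
rewrite sqrt_const /gauss; have -> : - (c1 / 2 * t) ^+ 2 = - t ^+ 2 / (2 * nu).
  by rewrite !exprMn (sqr_c1 nu_gt0); field; rewrite gt_eqF.
by field; rewrite !gt_eqF.
Qed.

(** [phi] depends on one variable only, and X gauss(X) is the limit profile of n [lazy_hit], that
    is, of m [lazy]. *)
Lemma phiE n (a x : int) (l : nat) (X := c1 / 2 * scale a x l / Num.sqrt n%:R) :
  (0 < n)%N ->
  phi nu (a%:~R / Num.sqrt n%:R) (x%:~R / Num.sqrt n%:R) (l%:R / Num.sqrt n%:R) =
  X * gauss X.
Proof.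
move=> n0; have s0 : 0 < Num.sqrt n%:R :> R by rewrite sqrtr_gt0 ltr0n.
rewrite /phi -mulrBl -rmorphB /= !normrM !normr_int normfV (gtr0_norm s0).
have -> : `|a|%N%:R / Num.sqrt n%:R + `|x - a|%N%:R / Num.sqrt n%:R +
    nu * (l%:R / Num.sqrt n%:R) = scale a x l / Num.sqrt n%:R by rewrite /scale; ring.
rewrite -mulrA gauss_scale /X; have -> : c1 / 2 * (scale a x l / Num.sqrt n%:R) =
  c1 / 2 * scale a x l / Num.sqrt n%:R by rewrite mulrA.
by ring.
Qed.

Lemma psiE n (a : int) (l : nat) (X := c1 / 2 * scale' a l / Num.sqrt n%:R) :
  (0 < n)%N ->
  psi nu (a%:~R / Num.sqrt n%:R) (l%:R / Num.sqrt n%:R) = nu * c1 * gauss X.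
Proof.
move=> n0; have s0 : 0 < Num.sqrt n%:R :> R by rewrite sqrtr_gt0 ltr0n.
rewrite /psi !normrM !normr_int normfV (gtr0_norm s0).
have -> : `|a|%N%:R / Num.sqrt n%:R + nu * (l%:R / Num.sqrt n%:R) =
    scale' a l / Num.sqrt n%:R by rewrite /scale'; ring.
rewrite gauss_scale /X; have -> : c1 / 2 * (scale' a l / Num.sqrt n%:R) =
  c1 / 2 * scale' a l / Num.sqrt n%:R by rewrite mulrA.
by field.
Qed.

Lemma lazy_hitE n m : (0 < n)%N -> n%:R * lazy_hit R n m = m%:R * lazy R n m.
Proof.
case: n => // n _; rewrite /lazy_hit.
have : n.+1%:R != 0 :> R by rewrite pnatr_eq0.
by move: (n.+1%:R) (lazy R n.+1 m) => y t y0; field.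
Qed.

Lemma index_gauss n (s : R) : (0 < n)%N -> 0 <= s ->
  `|Num.sqrt n%:R * lazy R n (lattice_index s) - gauss (c1 / 2 * s / Num.sqrt n%:R)|
    <= 100 / Num.sqrt n%:R /\
  `|n%:R * lazy_hit R n (lattice_index s) -
     c1 / 2 * s / Num.sqrt n%:R * gauss (c1 / 2 * s / Num.sqrt n%:R)|
    <= 100 / Num.sqrt n%:R.
Proof.
move=> n0 s0; have nr : 0 < n%:R :> R by rewrite ltr0n.
have q0 : 0 < Num.sqrt n%:R :> R by rewrite sqrtr_gt0.
have qE : Num.sqrt n%:R ^+ 2 = n%:R :> R by rewrite sqr_sqrtr // ltW.
have q1 : 1 <= Num.sqrt n%:R :> R.
  by rewrite -(@ler_pXn2r _ 2) ?nnegrE ?(ltW q0) // qE expr1n ler1n.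
have /andP[i1 i2] := index_itv s0.
have h := lazy_gauss R (lattice_index s) n0.
set x := c1 / 2 * s / Num.sqrt n%:R.
set X := (lattice_index s)%:R / Num.sqrt n%:R in h.
have X0 : 0 <= X by rewrite divr_ge0 // ltW.
have Xx : X <= x by rewrite ler_pM2r ?invr_gt0.
have xX : x - X <= 1 / Num.sqrt n%:R by rewrite -mulrBl ler_pM2r ?invr_gt0 //; lra.
have xX1 : x <= X + 1.
  have : 1 / Num.sqrt n%:R <= 1 :> R by rewrite mul1r invf_le1.
  lra.
have [g1 g2] := gauss_lip X0 Xx xX1.
set y := Num.sqrt n%:R * lazy R n (lattice_index s) in h *.
have D0 := normr_ge0 (y - gauss X).
have h1 : `|y - gauss X| <= 90 / Num.sqrt n%:R.
  by apply: le_trans h; rewrite ler_peMl // lerDl.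
have h2 : X * `|y - gauss X| <= 90 / Num.sqrt n%:R.
  by apply: le_trans h; rewrite ler_wpM2r // lerDr.
split.
  have -> : y - gauss x = (y - gauss X) + (gauss X - gauss x) by ring.
  apply: le_trans (ler_normD _ _) _; lra.
have -> : n%:R * lazy_hit R n (lattice_index s) = X * y.
  by rewrite lazy_hitE // /X /y; field; rewrite gt_eqF.
have -> : X * y - x * gauss x = X * (y - gauss X) + (X * gauss X - x * gauss x) by ring.
apply: le_trans (ler_normD _ _) _; rewrite normrM (ger0_norm X0); lra.
Qed.

Lemma local_phi (kappa e : R) : 0 < kappa -> 0 < e -> exists n0 : nat,
  forall n, (n0 <= n)%N -> forall (x a : int) (l : nat) (v : R), (0 < l)%N ->
    kappa * Num.sqrt n%:R <= l%:R -> mu N a n x l @[N --> \oo] --> v ->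
    `|n%:R * v - phi nu (a%:~R / Num.sqrt n%:R) (x%:~R / Num.sqrt n%:R)
                       (l%:R / Num.sqrt n%:R)| <= e.
Proof.
move=> k0 e0; have [C [c [C0 c0 hC]]] := visit_decay.
have n0' := nuc1_gt0 nu_gt0.
have [A AE] : exists A, A = 8 * 16 ^+ 3 / (c * kappa) ^+ 4 by eexists.
have A0 : 0 < A by rewrite AE !(divr_gt0, mulr_gt0, exprn_gt0).
(* The error has three shares of at most e / 4: A eps, B / n, and the Gaussian approximation of the
   lazy walk. *)
pose eps := e / 4 / A.
have eps0 : 0 < eps by rewrite !divr_gt0.
have eC : 0 < eps ^+ 2 / C by rewrite divr_gt0 // exprn_gt0.
have [d d0 hd] := visit_near p_ge0 p_sum1 p_fourier nu_gt0 C1_gt0 c2_gt0 f_upper f_lower f_taylor (2 + nu * c1) eC.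
have [B BE] : exists B, B = 512 * C / (c * kappa * d) ^+ 4 by eexists.
have B0 : 0 < B by rewrite BE divr_gt0 ?exprn_gt0 ?mulr_gt0 ?ltr0n //.
have e4 : 0 < e / 4 by rewrite divr_gt0.
have [n0 hn0] := large_nat B0 e4.
exists n0 => n nn x a [//|l] v _ kl hv; have [n1 nB n100] := hn0 n nn.
have s0 : 0 <= scale a x l.+1 by rewrite !addr_ge0 // mulr_ge0 // ltW.
set m := lattice_index (scale a x l.+1).
pose u N k := mu N a k x l.+1 - lazy_hit R k m.
pose D N z := Vis N z a l.+1 * G N z (x - a) - rho0 (disk_root z) ^+ m.
have ls : nu * l.+1%:R <= scale a x l.+1 by rewrite lerDr addr_ge0.
have main : n%:R * `|v - lazy_hit R n m| <= 1 * (A * eps + B / n%:R).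
  rewrite AE BE; apply: (@coef_bound R C c kappa eps d 1 _ 1 n l.+1 u D) => //.
  - near=> N => k; have /andP[h1 h2] := lazy_hit_itv k m.
    have := mu_ge0 N a k x l.+1; have := mu_le1 N a k x l.+1.
    by rewrite ler_norml /u => *; apply/andP; split; lra.
  - near=> N; have N0 : (0 < N)%N by near: N; exists 1%N.
    move=> z zr; have z1 : cn z < 1 by rewrite zr; case/andP: (crad_itv R n1).
    have [q zq] := disk_exists z1.
    exists (occ_bound z + 1) => M.
    have h1 := visit_partial N0 (p_ge0 N) (p_sum1 N0) (p_fourier N0) z1 (mu0 N a) (fun n x l => muS a n x l N0) x l M.
    have h2 := lazy_hit_partial zq M m.
    rewrite /D /u (disk_rootE zq).
    have -> : \sum_(k < M) z ^+ k * (mu N a k x l.+1 - lazy_hit R k m)%:C =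
      \sum_(k < M) z ^+ k * (mu N a k x l.+1)%:C - \sum_(k < M) z ^+ k * (lazy_hit R k m)%:C.
      by rewrite -sumrB; apply: eq_bigr => k _; rewrite rmorphB mulrBr.
    rewrite opprB addrACA [- _ + _]addrC [X in cn (_ + X)]addrC.
    rewrite mulrDl mul1r; apply: le_trans (_ : _ <= _); last exact: lerD h1 h2.
    rewrite (cn_sym (rho0 q ^+ m)); apply: le_trans (cnD _ _).
    by rewrite le_eqVlt; apply/orP; left; apply/eqP; congr cn; ring.
  - move=> z q _ zq; near=> N; rewrite mul1r /D (disk_rootE zq).
    have : cn (Vis N z a l.+1 * G N z (x - a) - rho0 q ^+ m) <= C * expR (- (c * l.+1%:R * cn q)) /\
    cn (q * (Vis N z a l.+1 / (1 - z)) - (nu * c1)%:C * rho0 q ^+ m)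
      <= C * expR (- (c * l.+1%:R * cn q)) by near: N; exact: (hC _ _ zq).
    by case.
  - move=> z q _ zq qd; have [+ _] := hd z q zq qd a l m.
    move=> /(_ (x - a)); have := index_near s0; rewrite -/m.
    have -> : scale a x l.+1 - nu = `|a|%N%:R + `|x - a|%N%:R + nu * l%:R.
      by rewrite /scale -natr1; ring.
    move=> i /(_ i); apply: filterS => N; rewrite mul1r /D (disk_rootE zq) //.
  - by rewrite /u; apply: cvgB; [exact: hv|exact: cvg_cst].
rewrite phiE //; have [_ g] := index_gauss n1 s0; rewrite -/m in g.
have -> : n%:R * v = n%:R * (v - lazy_hit R n m) + n%:R * lazy_hit R n m by ring.
rewrite -addrA; apply: le_trans (ler_normD _ _) _.
rewrite normrM ger0_norm //.
have : A * eps = e / 4 by rewrite /eps mulrC divfK // gt_eqF.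
lra.
Unshelve. all: by end_near. Qed.

(** The transform now carries a factor 1 / q, so the comparison is made after multiplication by q,
    and undoing this costs a factor of order sqrt n. *)
Lemma local_psi (kappa e : R) : 0 < kappa -> 0 < e -> exists n0 : nat,
  forall n, (n0 <= n)%N -> forall (a : int) (l : nat) (v : R), (0 < l)%N ->
    kappa * Num.sqrt n%:R <= l%:R -> \sum_(x < N) mu N a n x%:Z l @[N --> \oo] --> v ->
    `|Num.sqrt n%:R * v - psi nu (a%:~R / Num.sqrt n%:R) (l%:R / Num.sqrt n%:R)| <= e.
Proof.
move=> k0 e0; have [C [c [C0 c0 hC]]] := visit_decay.
have n0' := nuc1_gt0 nu_gt0.
have [A AE] : exists A, A = 8 * 16 ^+ 3 / (c * kappa) ^+ 4 by eexists.
have A0 : 0 < A by rewrite AE !(divr_gt0, mulr_gt0, exprn_gt0).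
pose eps := e / 8 / A.
have eps0 : 0 < eps by rewrite !divr_gt0.
have eC : 0 < eps ^+ 2 / C by rewrite divr_gt0 // exprn_gt0.
have [d d0 hd] := visit_near p_ge0 p_sum1 p_fourier nu_gt0 C1_gt0 c2_gt0 f_upper f_lower f_taylor (2 + nu * c1) eC.
have [B BE] : exists B, B = 512 * C / (c * kappa * d) ^+ 4 by eexists.
have B0 : 0 < B by rewrite BE divr_gt0 ?exprn_gt0 ?mulr_gt0 ?ltr0n //.
have p1 : 0 < nu * c1 + 1 by rewrite addr_gt0.
have e8 : 0 < e / 8 / (nu * c1 + 1) by rewrite !divr_gt0.
have [n0 hn0] := large_nat B0 e8.
exists n0 => n nn a [//|l] v _ kl hv; have [n1 nB n100] := hn0 n nn.
have nr : 0 < n%:R :> R by rewrite ltr0n.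
have q0 : 0 < Num.sqrt n%:R :> R by rewrite sqrtr_gt0.
have qE : Num.sqrt n%:R ^+ 2 = n%:R :> R by rewrite sqr_sqrtr // ltW.
have s0 : 0 <= scale' a l.+1 by rewrite !addr_ge0 // mulr_ge0 // ltW.
set m := lattice_index (scale' a l.+1).
pose u N k := \sum_(x < N) mu N a k x%:Z l.+1 - nu * c1 * lazy R k m.
pose D N z := Vis N z a l.+1 / (1 - z) - (nu * c1)%:C * (rho0 (disk_root z) ^+ m / disk_root z).
have ls : nu * l.+1%:R <= scale' a l.+1 by rewrite lerDr.
(* On the circle |q|^2 = |1 - z| >= 1 / (2 n), hence w |q| >= 1. *)
pose w := 2 * Num.sqrt n%:R : R.
have w0 : 0 < w by rewrite mulr_gt0.
have Dw z q N : cn z = crad R n -> disk z q ->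
    cn (D N z) <= w * cn (q * (Vis N z a l.+1 / (1 - z)) - (nu * c1)%:C * rho0 q ^+ m).
  move=> zr zq; have qq := disk_gt0 zq; have q1 : q != 0 by rewrite -cn_gt0.
  have -> : q * (Vis N z a l.+1 / (1 - z)) - (nu * c1)%:C * rho0 q ^+ m = q * D N z.
    rewrite /D (disk_rootE zq); move: (Vis N z a l.+1 / (1 - z)) => t; field.
    exact: q1.
  rewrite cnM mulrA ler_peMl ?cn_ge0 //.
  rewrite -(@ler_pXn2r _ 2) ?nnegrE ?mulr_ge0 ?cn_ge0 ?(ltW w0) // expr1n.
  rewrite exprMn -(disk_cn1B zq) /w exprMn qE.
  have h1 : (2 * n%:R)^-1 <= cn (1 - z).
    apply: le_trans (cn_revB _ _); rewrite cn1 zr /crad; lra.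
  apply: le_trans (_ : 2 ^+ 2 * n%:R * (2 * n%:R)^-1 <= _).
    have -> : 2 ^+ 2 * n%:R * (2 * n%:R)^-1 = 2 :> R by field; rewrite gt_eqF.
    lra.
  by rewrite ler_wpM2l // mulr_ge0 // exprn_ge0.
have main : n%:R * `|v - nu * c1 * lazy R n m| <= w * (A * eps + B / n%:R).
  rewrite AE BE; apply: (@coef_bound R C c kappa eps d w _ (1 + nu * c1) n l.+1 u D) => //.
  - by rewrite addr_gt0.
  - near=> N => k; have /andP[h1 h2] := lazy_itv k m.
    have := mu_sum_le1 N a k l.+1.
    have : 0 <= \sum_(x < N) mu N a k x l.+1 by rewrite sumr_ge0.
    rewrite /u ler_norml; move: (\sum_(x < N) _) => S *.
    by apply/andP; split; nra.
  - near=> N; have N0 : (0 < N)%N by near: N; exists 1%N.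
    move=> z zr; have z1 : cn z < 1 by rewrite zr; case/andP: (crad_itv R n1).
    have [q zq] := disk_exists z1.
    exists (N%:R * occ_bound z + nu * c1 * (cn q)^-1) => M.
    have h1 := visit_sum_partial N0 (p_ge0 N) (p_sum1 N0) (p_fourier N0) z1 (mu0 N a) (fun n x l => muS a n x l N0) l M.
    have h2 := lazy_partial zq M m.
    rewrite /D /u (disk_rootE zq).
    have -> : \sum_(k < M) z ^+ k * (\sum_(x < N) mu N a k x%:Z l.+1 - nu * c1 * lazy R k m)%:C =
      \sum_(k < M) z ^+ k * (\sum_(x < N) mu N a k x%:Z l.+1)%:C -
      (nu * c1)%:C * \sum_(k < M) z ^+ k * (lazy R k m)%:C.
      rewrite mulr_sumr -sumrB; apply: eq_bigr => k _.
      by rewrite rmorphB (rmorphM _ (nu * c1)) /=; ring.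
    have h3 := ler_wpM2l (ltW n0') h2.
    rewrite mulrDl; apply: le_trans (_ : _ <= _); last first.
      by apply: lerD; [rewrite -mulrA; exact: h1|rewrite -mulrA; exact: h3].
    rewrite -(cn_realM _ (ltW n0')) -[cn ((nu * c1)%:C * _)]cnN; apply: le_trans (cnD _ _).
    rewrite le_eqVlt; apply/orP; left; apply/eqP; congr cn.
    move: (Vis N z a l.+1 / (1 - z)) (rho0 q ^+ m / q) (\sum_(k < M) _) (\sum_(k < M) _) => *.
    ring.
  - move=> z q zr zq; near=> N; apply: le_trans (Dw _ _ _ zr zq) _; rewrite ler_pM2l //.
    have : cn (Vis N z a l.+1 * G N z 0 - rho0 q ^+ m) <= C * expR (- (c * l.+1%:R * cn q)) /\
    cn (q * (Vis N z a l.+1 / (1 - z)) - (nu * c1)%:C * rho0 q ^+ m)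
      <= C * expR (- (c * l.+1%:R * cn q)) by near: N; exact: (hC _ _ zq).
    by case.
  - move=> z q zr zq qd; have [_] := hd z q zq qd a l m.
    have := index_near s0; rewrite -/m.
    have -> : scale' a l.+1 - nu = `|a|%N%:R + nu * l%:R.
      by rewrite /scale' -natr1; ring.
    move=> i /(_ i); apply: filterS => N h.
    by apply: le_trans (Dw _ _ _ zr zq) _; rewrite ler_pM2l.
  - by rewrite /u; apply: cvgB; [exact: hv|exact: cvg_cst].
rewrite psiE //; have [g _] := index_gauss n1 s0; rewrite -/m in g.
set X := c1 / 2 * _ / _ in g *.
have -> : Num.sqrt n%:R * v - nu * c1 * gauss X = Num.sqrt n%:R * (v - nu * c1 * lazy R n m) +
  nu * c1 * (Num.sqrt n%:R * lazy R n m - gauss X) by ring.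
apply: le_trans (ler_normD _ _) _.
rewrite !(normrM _ (_ - _)) (gtr0_norm q0) (gtr0_norm n0').
have AE' : A * eps = e / 8 by rewrite /eps mulrC divfK // gt_eqF.
have m1 : Num.sqrt n%:R * `|v - nu * c1 * lazy R n m| <= 2 * (A * eps + B / n%:R).
  rewrite -(ler_pM2l q0) mulrA -expr2 qE; apply: le_trans main _.
  by rewrite /w le_eqVlt; apply/orP; left; apply/eqP; ring.
have g1 : nu * c1 * `|Num.sqrt n%:R * lazy R n m - gauss X| <= nu * c1 * (e / 8 / (nu * c1 + 1)).
  by rewrite ler_pM2l // (le_trans g).
have f1 : nu * c1 * (e / 8 / (nu * c1 + 1)) = e / 8 * (1 - (nu * c1 + 1)^-1).
  by field; rewrite gt_eqF.
have f2 : e / 8 / (nu * c1 + 1) <= e / 8.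
  by rewrite ler_pdivrMr // ler_peMr ?lerDr ?(ltW n0') // divr_ge0 // ltW.
have f3 : 0 <= (nu * c1 + 1)^-1 by rewrite invr_ge0 ltW.
have := mulr_ge0 (ltW e0) f3; lra.
Unshelve. all: by end_near. Qed.

End LocalLimit.

(** * From the random walk to the walk modulo N *)

Section Pr.
Context d (T : measurableType d) (R : realType) (P : probability T R).

Definition pr (A : set T) : R := fine (P A).

Lemma prE A : measurable A -> P A = (pr A)%:E.
Proof. by move=> mA; rewrite fineK // fin_num_measure. Qed.

Lemma pr_ge0 A : 0 <= pr A. Proof. exact: fine_ge0. Qed.

Lemma le_pr A B : measurable A -> measurable B -> A `<=` B -> pr A <= pr B.
Proof.
by move=> mA mB AB; rewrite -lee_fin -!prE //; apply: le_measure => //; exact: mem_set.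
Qed.

Lemma pr_setT : pr setT = 1. Proof. by rewrite /pr probability_setT. Qed.

Lemma pr_set0 : pr set0 = 0. Proof. by rewrite /pr measure0. Qed.

Lemma pr_le1 A : measurable A -> pr A <= 1.
Proof. by move=> mA; rewrite -pr_setT le_pr. Qed.

Lemma pr_sum N (A : 'I_N -> set T) : (forall i, measurable (A i)) -> trivIset setT A ->
  pr (\bigcup_i A i) = \sum_(i < N) pr (A i).
Proof.
move=> mA tA; rewrite /pr sum_fine => [|i _]; last by rewrite fin_num_measure.
rewrite -(measure_bigsetU_ord P (fun=> true)) //; congr (fine (P _)).
by rewrite -bigcup_seq; apply/seteqP; split => w [i _ Ai]; exists i => //=; rewrite mem_index_enum.
Qed.

Lemma residue_ex (N : nat) (k : int) : (0 < N)%N -> exists i : 'I_N, (N %| k - i%:Z)%Z.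
Proof.
move=> N0; have k0 : 0 <= (k %% N)%Z by rewrite modz_ge0 // -lt0n.
have kN : (`|(k %% N)%Z| < N)%N by rewrite -ltz_nat gez0_abs // ltz_pmod.
exists (Ordinal kN) => /=.
by rewrite gez0_abs // -eqz_mod_dvd modz_mod.
Qed.

Lemma residue_uniq (N : nat) (k : int) (i j : 'I_N) :
  (N %| k - i%:Z)%Z -> (N %| k - j%:Z)%Z -> i = j.
Proof.
rewrite -!eqz_mod_dvd => /eqP -> /eqP; rewrite !modz_nat !modn_small //.
by move=> [] /val_inj.
Qed.

Lemma pr_residue N (E : set T) (g : T -> int) : (0 < N)%N ->
  (forall i : 'I_N, measurable (E `&` [set w | (N %| g w - i%:Z)%Z])) ->
  \sum_(i < N) pr (E `&` [set w | (N %| g w - i%:Z)%Z]) = pr E.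
Proof.
move=> N0 mE; rewrite -pr_sum //; last first.
  by move=> i j _ _ [w [[_ /= wi] [_ /= wj]]]; exact: residue_uniq wi wj.
congr pr; apply/seteqP; split => w; first by case=> i _ [].
by move=> Ew; have [i ih] := residue_ex (g w) N0; exists i.
Qed.

Lemma pr_ae A B : measurable A -> measurable B -> {ae P, forall w, A w <-> B w} ->
  pr A = pr B.
Proof.
move=> mA mB [N [mN N0 hN]].
have H C D : measurable C -> measurable D -> C `<=` D `|` N -> pr C <= pr D.
  move=> mC mD CD; have mDN : measurable (D `|` N) by exact: measurableU.
  rewrite (le_trans (le_pr mC mDN CD)) // -lee_fin -!prE //.
  by apply: le_trans (measureU2 P mD mN) _; rewrite [X in (_ + X)%E]N0 adde0.
apply/le_anti/andP; split; apply: H => // w hw.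
  have [Bw|nB] := pselect (B w); [by left|right].
  by apply: hN => /= -[/(_ hw)].
have [Aw|nA] := pselect (A w); [by left|right].
by apply: hN => /= -[_ /(_ hw)].
Qed.

(** The E n need not be monotone, but the sets B n of points where some later E differs from A
    decrease to the empty set. *)
Lemma pr_cvg (E : nat -> set T) A : (forall n, measurable (E n)) -> measurable A ->
  (forall w, \forall n \near \oo, E n w <-> A w) -> pr (E n) @[n --> \oo] --> pr A.
Proof.
move=> mE mA hE.
pose S n := (E n `\` A) `|` (A `\` E n).
pose B n := \bigcup_m S (n + m)%N.
have mS n : measurable (S n) by apply: measurableU; exact: measurableD.
have mB n : measurable (B n) by exact: bigcupT_measurable.
have B0 : \bigcap_n B n = set0.
  rewrite -subset0 => w hw; have [M _ hM] := hE w.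
  have [m _ [[h1 h2]|[h1 h2]]] := hw M I; have /= := hM (M + m)%N (leq_addr _ _); tauto.
have niB : nonincreasing_seq B.
  move=> n m nm; apply/subsetPset => w [k _ Sk]; exists (m - n + k)%N => //.
  by rewrite addnA subnKC.
have cB : P (B n) @[n --> \oo] --> P (\bigcap_n B n).
  apply: nonincreasing_cvg_mu => //; last exact: bigcapT_measurable.
  by rewrite ltey_eq fin_num_measure.
have cB' : pr (B n) @[n --> \oo] --> (0 : R).
  have := cB; rewrite B0 measure0 => /fine_cvgP[_]; exact: cvg_trans.
have H C D N : measurable C -> measurable D -> C `<=` D `|` B N -> pr C <= pr D + pr (B N).
  move=> mC mD CD; have mDN : measurable (D `|` B N) by exact: measurableU.
  rewrite (le_trans (le_pr mC mDN CD)) // -lee_fin EFinD -!prE //.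
  exact: measureU2.
have EB n : `|pr A - pr (E n)| <= pr (B n).
  have SB : S n `<=` B n by move=> w Sw; exists 0%N; rewrite ?addn0.
  have h1 : pr A <= pr (E n) + pr (B n).
    apply: H => // w Aw; have [Ew|nE] := pselect (E n w); [by left|right].
    by apply: SB; right.
  have h2 : pr (E n) <= pr A + pr (B n).
    apply: H => // w Ew; have [Aw|nA] := pselect (A w); [by left|right].
    by apply: SB; left.
  by rewrite ler_norml; apply/andP; split; lra.
apply/cvgrPdist_le => e e0; move/cvgrPdist_le : cB' => /(_ e e0).
apply: filterS => n; rewrite sub0r normrN ger0_norm ?pr_ge0 //.
exact: le_trans.
Qed.

End Pr.

Section FloorMeasurable.
Variable R : realType.

Lemma measurable_floor_preimage (B : set int) : measurable [set x : R | B (Num.floor x)].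
Proof.
have -> : [set x : R | B (Num.floor x)] =
    \bigcup_k (if k \in B then `[k%:~R, (k + 1)%:~R[%classic else set0 : set R).
  apply/seteqP; split => [x Bx|x [k _]].
    exists (Num.floor x) => //; rewrite mem_set //=.
    by rewrite in_itv /= floor_le floorD1_gt.
  case: ifPn => // /set_mem Bk; rewrite /= in_itv /= => /andP[k1 k2].
  have fk : Num.floor x = k.
    by apply/eqP; rewrite eq_le floor_ge_int k1 andbT -ltzD1 floor_lt_int.
  by rewrite fk.
apply: countable_bigcupT_measurable => [|k]; first exact: countableP.
by case: ifPn => _; [exact: measurable_itv|exact: measurable0].
Qed.

End FloorMeasurable.

(** * Past and next step of an integer walk; its law modulo N *)

Section Paths.
Context d (T : measurableType d) (R : realType) (P : probability T R).
Variables (Y : nat -> T -> int) (law : set int -> R).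
Hypothesis mY : forall k (B : set int), measurable [set w | B (Y k w)].
Hypothesis indep : forall n (B : nat -> set int),
  pr P [set w | forall k, (k < n)%N -> B k (Y k w)] = \prod_(k < n) law (B k).

Definition hist n w := mkseq (Y^~ w) n.

Lemma cylinderE n s : [set w | hist n w = s] =
  if size s == n then [set w | forall k, (k < n)%N -> Y k w = nth 0 s k] else set0.
Proof.
case: ifPn => [/eqP sn|sn]; apply/seteqP; split => w //=.
- by move=> <- k kn; rewrite nth_mkseq.
- move=> h; apply: (@eq_from_nth _ 0); rewrite size_mkseq // => k kn.
  by rewrite nth_mkseq // h.
- by move=> h; move: sn; rewrite -h size_mkseq eqxx.
Qed.

Lemma measurable_all n (B : nat -> set int) :
  measurable [set w | forall k, (k < n)%N -> B k (Y k w)].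
Proof.
have -> : [set w | forall k, (k < n)%N -> B k (Y k w)] =
    \bigcap_k [set w | (k < n)%N -> B k (Y k w)].
  by apply/seteqP; split => w h k; [move=> _|move=> kn]; exact: h.
apply: bigcapT_measurable => k; have [kn|kn] := boolP (k < n)%N.
  have -> : [set w | true -> B k (Y k w)] = [set w | B k (Y k w)] => //.
  by apply/seteqP; split => w //= h; exact: h.
by rewrite (_ : [set _ | _] = setT) //; apply/seteqP; split => w.
Qed.

Lemma measurable_cylinder n s : measurable [set w | hist n w = s].
Proof.
by rewrite cylinderE; case: ifP => _ //; exact: (measurable_all n (fun k => [set nth 0 s k])).
Qed.

(** Histories are countable, and [choice.pickle] numbers them: any event of the past is a disjoint
    union of cylinders and empty sets, so its independence follows from countable additivity. *)
Definition piece n (Q : set (seq int)) m :=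
  [set w | Q (hist n w) /\ choice.pickle (hist n w) = m].

Lemma hist_decomp n (Q : set (seq int)) : [set w | Q (hist n w)] = \bigcup_m piece n Q m.
Proof.
apply/seteqP; split => w; last by case=> m _ [].
by move=> Qw; exists (choice.pickle (hist n w)).
Qed.

Lemma pieceE n (Q : set (seq int)) m :
  piece n Q m = set0 \/ exists s, piece n Q m = [set w | hist n w = s].
Proof.
have [h|] := pselect (~ exists w, piece n Q m w).
  by left; apply/seteqP; split => // w Dw; case: h; exists w.
move=> /contrapT[w0 [Qw <-]]; right; exists (hist n w0); apply/seteqP; split => w /=.
  by case=> _ /(pcan_inj choice.pickleK).
by rewrite /piece /= => ->.
Qed.

Lemma measurable_piece n (Q : set (seq int)) m : measurable (piece n Q m).
Proof. by case: (pieceE n Q m) => [->|[s ->]] //; exact: measurable_cylinder. Qed.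

Lemma measurable_hist n (Q : set (seq int)) : measurable [set w | Q (hist n w)].
Proof. by rewrite hist_decomp; apply: bigcupT_measurable => m; exact: measurable_piece. Qed.

Lemma indep_cylinder n s (B : set int) :
  pr P ([set w | hist n w = s] `&` [set w | B (Y n w)]) =
  pr P [set w | hist n w = s] * law B.
Proof.
rewrite cylinderE; case: ifP => _; last by rewrite set0I pr_set0 mul0r.
rewrite (indep n (fun k => [set nth 0 s k])).
pose B' k := if (k < n)%N then [set nth 0 s k] else B.
rewrite (_ : _ `&` _ = [set w | forall k, (k < n.+1)%N -> B' k (Y k w)]); last first.
  apply/seteqP; split => w.
    move=> [h1 h2] k; rewrite ltnS leq_eqVlt /B' => /orP[/eqP->|kn].
      by rewrite ltnn.
    by rewrite kn; exact: h1.
  move=> h; split=> /= [k kn|]; last by have := h n (ltnSn n); rewrite /B' ltnn.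
  by have := h k (ltnW kn); rewrite /B' kn.
rewrite indep big_ord_recr /= /B' ltnn; congr (_ * _).
by apply: eq_bigr => i _; rewrite ltn_ord.
Qed.

Lemma indep_hist n (Q : set (seq int)) (B : set int) :
  pr P ([set w | Q (hist n w)] `&` [set w | B (Y n w)]) = pr P [set w | Q (hist n w)] * law B.
Proof.
have mB : measurable [set w | B (Y n w)] by exact: mY.
have mD m : measurable (piece n Q m) by exact: measurable_piece.
have mDB m : measurable (piece n Q m `&` [set w | B (Y n w)]) by exact: measurableI.
have tD : trivIset setT (piece n Q) by move=> i j _ _ [w [[_ <-] [_ <-]]].
have tDB : trivIset setT (fun m => piece n Q m `&` [set w | B (Y n w)]).
  by move=> i j _ _ [w [[[_ <-] _] [[_ <-] _]]].
rewrite hist_decomp setI_bigcupl /pr.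
rewrite (measure_semi_bigcup P mDB tDB); last exact: bigcupT_measurable.
have -> : (\sum_(0 <= i <oo) P (piece n Q i `&` [set w | B (Y n w)]) =
    (law B)%:E * \sum_(0 <= i <oo) P (piece n Q i))%E.
  rewrite -nneseriesZl //; apply: eq_eseriesr => m _.
  rewrite !(prE P) // -EFinM mulrC; congr (_%:E).
  case: (pieceE n Q m) => [->|[s ->]]; last exact: indep_cylinder.
  by rewrite set0I pr_set0 mul0r.
rewrite -(measure_semi_bigcup P mD tD); last exact: bigcupT_measurable.
have mU : measurable (\bigcup_m piece n Q m) by exact: bigcupT_measurable.
by rewrite mulrC fineM ?fin_num_measure.
Qed.

Lemma lawE B : law B = pr P [set w | B (Y 0%N w)].
Proof.
have := indep 1 (fun=> B); rewrite big_ord_recl big_ord0 mulr1 => <-.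
by congr pr; apply/seteqP; split => w /=; [apply|move=> h [|k]].
Qed.

(** Plays the part of a filtration: with integer steps, depending on the first n of them already
    implies measurability. *)
Definition adapted n (E : set T) :=
  forall w w', (forall k, (k < n)%N -> Y k w = Y k w') -> E w -> E w'.

Lemma adaptedE n E : adapted n E ->
  E = [set w | [set s | exists2 w', hist n w' = s & E w'] (hist n w)].
Proof.
move=> aE; apply/seteqP; split => w /=; first by exists w.
case=> w' h; apply: aE => k kn.
by rewrite -(nth_mkseq 0 (Y^~ w') kn) -(nth_mkseq 0 (Y^~ w) kn) -/(hist n w') h.
Qed.

Lemma measurable_adapted n E : adapted n E -> measurable E.
Proof. by move=> /adaptedE->; exact: measurable_hist. Qed.

Lemma indep_adapted n E (B : set int) : adapted n E ->
  pr P (E `&` [set w | B (Y n w)]) = pr P E * law B.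
Proof. by move=> /adaptedE->; exact: indep_hist. Qed.

Definition Z n w : int := \sum_(k < n) Y k w.

Definition visits (D : int -> bool) n w : nat := (\sum_(1 <= k < n.+1) D (Z k w))%N.

Lemma Z_adapted n w w' : (forall k, (k < n)%N -> Y k w = Y k w') ->
  forall k, (k <= n)%N -> Z k w = Z k w'.
Proof.
by move=> h k kn; apply: eq_bigr => i _; apply: h; exact: leq_trans (ltn_ord i) kn.
Qed.

Lemma visits_adapted D n w w' : (forall k, (k < n)%N -> Y k w = Y k w') ->
  visits D n w = visits D n w'.
Proof.
move=> h; apply: eq_big_nat => k /andP[_ kn].
by rewrite (Z_adapted h).
Qed.

Lemma measurable_Z (B : set int) n : measurable [set w | B (Z n w)].
Proof. by apply: (@measurable_adapted n) => w w' h; rewrite /= (Z_adapted h). Qed.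

Lemma visitsS D n w : visits D n.+1 w = (visits D n w + D (Z n.+1 w))%N.
Proof. by rewrite /visits big_nat_recr. Qed.

Lemma ZS n w : Z n.+1 w = Z n w + Y n w.
Proof. by rewrite /Z big_ord_recr. Qed.

(** Arbitrary predicates let one event serve for congruence modulo N, for equality in Z and, through
    [xpred0], for the position alone. *)
Definition site (D : int -> bool) (D' : int -> bool) n l :=
  [set w | D (Z n w) /\ visits D' n w = l].

Lemma site_adapted D D' n l : adapted n (site D D' n l).
Proof.
move=> w w' h; rewrite /site /= (visits_adapted D' h) //.
by rewrite (Z_adapted h).
Qed.

Lemma measurable_site D D' n l : measurable (site D D' n l).
Proof. by apply: (@measurable_adapted n); exact: site_adapted. Qed.

Definition mu (N : nat) (a : int) n (x : int) l : R :=
  pr P (site (fun z => (N %| z - x)%Z) (fun z => (N %| z - a)%Z) n l).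

Definition residue_law (N : nat) (x : int) : R := law [set k | (N %| k - x)%Z].

Lemma mu_0 N a x l : mu N a 0 x l = ((N %| x)%Z && (l == 0)%N)%:R.
Proof.
rewrite /mu; have ZE w : Z 0 w = 0 by rewrite /Z big_ord0.
have -> : (N %| x)%Z = (N %| 0 - x)%Z by rewrite sub0r rpredN.
set b := (_ && _); rewrite (_ : site _ _ _ _ = if b then setT else set0).
  by case: b; rewrite ?pr_setT ?pr_set0.
apply/seteqP; split => w; rewrite /b /site /= ZE /visits big_geq //.
  by case=> -> <-.
by case: ifP => // /andP[? /eqP->].
Qed.

(** Visits stop at time n while the position is taken at time n + 1. The last visit is added in
    [mu_S], where the residue x decides it. *)
Lemma site_conv N D' n x l : (0 < N)%N ->
  pr P [set w | (N %| Z n.+1 w - x)%Z /\ visits D' n w = l] =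
  \sum_(r < N) residue_law N (x - r%:Z) * pr P (site (fun z => (N %| z - r%:Z)%Z) D' n l).
Proof.
move=> N0; set E := [set w | _].
pose D (r : 'I_N) := site (fun z => (N %| z - r%:Z)%Z) D' n l.
have H (r : 'I_N) : E `&` [set w | (N %| Z n w - r%:Z)%Z] =
    D r `&` [set w | [set k | (N %| k - (x - r%:Z))%Z] (Y n w)].
  have e w : (N %| Z n w - r%:Z)%Z -> (N %| Z n.+1 w - x)%Z = (N %| Y n w - (x - r%:Z))%Z.
    move=> h; rewrite ZS.
    rewrite (_ : Z n w + Y n w - x = (Y n w - (x - r%:Z)) + (Z n w - r%:Z)); last ring.
    by rewrite rpredDr.
  apply/seteqP; split => w [/=].
    by case=> h1 h2 h3; split => //=; rewrite -e.
  by case=> h1 h2 h3; split => //=; split => //; rewrite e.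
rewrite -(@pr_residue _ _ _ P N E (Z n)) //; last first.
  move=> r; rewrite H; apply: measurableI; [exact: measurable_site|exact: mY].
apply: eq_bigr => r _; rewrite H indep_adapted; last exact: site_adapted.
by rewrite mulrC.
Qed.

Lemma mu_S N a n x l : (0 < N)%N ->
  mu N a n.+1 x l = step N a (fun h x => \sum_(r < N) residue_law N (x - r%:Z) * h r) (mu N a n) x l.
Proof.
move=> N0; rewrite /mu /site /step.
have e w : (N %| Z n.+1 w - x)%Z -> (N %| Z n.+1 w - a)%Z = (N %| x - a)%Z.
  move=> h; rewrite (_ : Z n.+1 w - a = (x - a) + (Z n.+1 w - x)); last ring.
  by rewrite rpredDr.
have -> : [set w | (N %| Z n.+1 w - x)%Z /\ visits (fun z => (N %| z - a)%Z) n.+1 w = l] =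
    [set w | (N %| Z n.+1 w - x)%Z /\
             addn (visits (fun z => (N %| z - a)%Z) n w) (N %| x - a)%Z = l].
  by apply/seteqP; split => w /= [h1 h2]; split => //; move: h2; rewrite visitsS (e _ h1).
case: ifP => xa; last by rewrite -site_conv //; congr pr; apply/seteqP; split => w; rewrite /= addn0.
case: l => [|l].
  by rewrite -[RHS](pr_set0 P); congr pr; apply/seteqP; split => w // [_]; rewrite addn1.
by rewrite -site_conv //; congr pr; apply/seteqP; split => w [h1] /=; rewrite ?addn1; [case|move=> ->].
Qed.

Lemma mu_ge0 N a n x l : 0 <= mu N a n x l.
Proof. exact: pr_ge0. Qed.

Lemma mu_le1 N a n x l : mu N a n x l <= 1.
Proof. by apply: pr_le1; exact: measurable_site. Qed.

Lemma measurable_visits D n l : measurable [set w | visits D n w = l].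
Proof.
rewrite (_ : [set _ | _] = site (fun=> true) D n l); first exact: measurable_site.
by apply/seteqP; split => w //= [].
Qed.

Lemma mu_sum N a n l : (0 < N)%N ->
  \sum_(x < N) mu N a n x%:Z l = pr P [set w | visits (fun z => (N %| z - a)%Z) n w = l].
Proof.
move=> N0; have e (x : 'I_N) : site (fun z => (N %| z - x%:Z)%Z) (fun z => (N %| z - a)%Z) n l =
    [set w | visits (fun z => (N %| z - a)%Z) n w = l] `&` [set w | (N %| Z n w - x%:Z)%Z].
  by apply/seteqP; split => w [].
rewrite -(@pr_residue _ _ _ P N _ (Z n)) // => [|x].
  by apply: eq_bigr => x _; rewrite /mu e.
by rewrite -e; exact: measurable_site.
Qed.

Lemma mu_sum_le1 N a n l : \sum_(x < N) mu N a n x%:Z l <= 1.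
Proof.
case: N => [|N]; first by rewrite big_ord0.
by rewrite mu_sum //; apply: pr_le1; exact: measurable_visits.
Qed.

Lemma residue_law_sum1 N : (0 < N)%N -> forall x, \sum_(r < N) residue_law N (x - r%:Z) = 1.
Proof.
move=> N0 x; rewrite -(pr_setT P) -(@pr_residue _ _ _ P N _ (fun w => x - Y 0 w)) //.
  apply: eq_bigr => r _; rewrite /residue_law lawE setTI; congr pr.
  have e w : (N %| Y 0 w - (x - r%:Z))%Z = (N %| x - Y 0 w - r%:Z)%Z.
    by rewrite -rpredN; congr (_ %| _)%Z; ring.
  by apply/seteqP; split => w /=; rewrite e.
move=> r; rewrite setTI; exact: (mY 0 (fun k => (N %| x - k - r%:Z)%Z)).
Qed.

(** Applied to the finitely many positions of a path, this gives pointwise convergence of the events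
    modulo N, as [pr_cvg] requires. *)
Lemma near_dvdz (y : int) : \forall N \near \oo, (N%:Z %| y)%Z = (y == 0).
Proof.
exists `|y|.+1 => // N /= yN; apply/idP/eqP => [|->]; last exact: rpred0.
rewrite dvdzE absz_nat => h; apply/eqP; rewrite -absz_eq0 -leqn0 leqNgt; apply/negP => y0.
by have := leq_trans yN (dvdn_leq y0 h); rewrite ltnn.
Qed.

Lemma near_visits a n w : \forall N \near \oo,
  visits (fun z => (N%:Z %| z - a)%Z) n w = visits (fun z => z == a) n w.
Proof.
have : \forall N \near \oo, forall k : 'I_n.+1, (N%:Z %| Z k w - a)%Z = (Z k w == a).
  apply: filter_forall => k; apply: filterS (near_dvdz (Z k w - a)) => N ->.
  by rewrite subr_eq0.
apply: filterS => N h; apply: eq_big_nat => k /andP[_ kn].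
by rewrite (h (Ordinal kn)).
Qed.

Lemma mu_cvg a n x l : mu N a n x l @[N --> \oo] -->
  pr P (site (fun z => z == x) (fun z => z == a) n l).
Proof.
apply: pr_cvg => [N||w]; [exact: measurable_site|exact: measurable_site|].
near=> N; rewrite /site /=.
have -> : (N%:Z %| Z n w - x)%Z = (Z n w == x).
  by rewrite -[RHS]subr_eq0; near: N; exact: near_dvdz.
have -> // : visits (fun z => (N%:Z %| z - a)%Z) n w = visits (fun z => z == a) n w.
by near: N; exact: near_visits.
Unshelve. all: by end_near. Qed.

Lemma mu_sum_cvg a n l : \sum_(x < N) mu N a n x%:Z l @[N --> \oo] -->
  pr P [set w | visits (fun z => z == a) n w = l].
Proof.
apply: (@cvg_trans _ (pr P [set w | visits (fun z => (N%:Z %| z - a)%Z) n w = l] @[N --> \oo])).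
  apply: near_eq_cvg; exists 1%N => // N /= N0; rewrite mu_sum //.
apply: pr_cvg => [N||w]; [exact: measurable_visits|exact: measurable_visits|].
by apply: filterS (near_visits a n w) => N /= ->.
Qed.

End Paths.

(** * The characteristic function of a step *)

Section Trig.
Variable R : realType.
Implicit Types (t e : R) (n : nat) (k : int).

Lemma le_sin_muln n t : `|sin (n%:R * t)| <= n%:R * `|sin t|.
Proof.
elim: n => [|n IH]; first by rewrite !mul0r sin0 normr0.
rewrite -natr1 mulrDl mul1r sinD (le_trans (ler_normD _ _)) // mulrDl mul1r !normrM lerD //.
  by rewrite (le_trans _ IH) // ler_piMr // cos_max.
by rewrite ler_piMl // cos_max.
Qed.

Lemma cosB1_half t : 1 - cos t = 2 * sin (t / 2) ^+ 2.
Proof.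
have -> : cos t = cos (t / 2 + t / 2) by congr cos; field.
by rewrite cosD; have := cos2Dsin2 (t / 2); rewrite !expr2; lra.
Qed.

Lemma cosB1_muln n t : 1 - cos (n%:R * t) <= n%:R ^+ 2 * (1 - cos t).
Proof.
rewrite !cosB1_half -mulrA (_ : n%:R ^+ 2 * _ = 2 * (n%:R * `|sin (t / 2)|) ^+ 2); last first.
  by rewrite exprMn real_normK ?num_real //; ring.
rewrite ler_pM2l // -[X in X <= _](real_normK (num_real _)).
by rewrite ler_pXn2r ?nnegrE // ?mulr_ge0 // le_sin_muln.
Qed.

Lemma cosB1_ge0 t : 0 <= 1 - cos t.
Proof. by have := cos_le1 t; lra. Qed.

(** Expansions are made in 1 - cos t rather than in t: they hold for every angle, without choosing a
    representative. *)
Lemma cosB1_muln_taylor n t :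
  0 <= n%:R ^+ 2 * (1 - cos t) - (1 - cos (n%:R * t)) <= 2 * n%:R ^+ 4 * (1 - cos t) ^+ 2.
Proof.
set b := 1 - cos t; pose v m := m%:R ^+ 2 * b - (1 - cos (m%:R * t)).
rewrite -/(v n); have b0 : 0 <= b := cosB1_ge0 t.
(* The Chebyshev recursion for cos(m t), summed twice below. *)
have rec m : v m.+2 - v m.+1 = v m.+1 - v m + 2 * b * (1 - cos (m.+1%:R * t)).
  have := cosD (m.+1%:R * t) t; have := cosB (m.+1%:R * t) t; rewrite /v /b.
  rewrite (_ : m.+1%:R * t - t = m%:R * t); last by rewrite -natr1; ring.
  rewrite (_ : m.+1%:R * t + t = m.+2%:R * t); last by rewrite -!natr1; ring.
  by move=> -> ->; rewrite -!natr1; ring.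
have v0 : v 0%N = 0 by rewrite /v !mul0r cos0; ring.
have v1 : v 1%N = 0 by rewrite /v mul1r /b; ring.
have D m : 0 <= v m.+1 - v m <= 2 * m%:R ^+ 3 * b ^+ 2.
  elim: m => [|m /andP[h1 h2]]; first by rewrite v0 v1 subrr lexx !expr0n /= !mulr0 mul0r.
  have := cosB1_ge0 (m.+1%:R * t); have := cosB1_muln m.+1 t; rewrite -/b => u1 u2.
  rewrite rec; have w2 : 0 <= b * (1 - cos (m.+1%:R * t)) by rewrite mulr_ge0.
  have w1 : b * (1 - cos (m.+1%:R * t)) <= b * (m.+1%:R ^+ 2 * b) by rewrite ler_wpM2l.
  apply/andP; split; first by lra.
  have m0 : 0 <= m%:R :> R by [].
  have : 0 <= (m%:R ^+ 2 * 2 + m%:R) * b ^+ 2 by rewrite mulr_ge0 ?sqr_ge0 // addr_ge0 // mulr_ge0.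
  have e : 2 * m.+1%:R ^+ 3 * b ^+ 2 = 2 * m%:R ^+ 3 * b ^+ 2 + 2 * (b * (m.+1%:R ^+ 2 * b))
     + 2 * (m%:R ^+ 2 * 2 + m%:R) * b ^+ 2 by rewrite -natr1; ring.
  by move=> h3; rewrite e; lra.
elim: n => [|n /andP[h1 h2]]; first by rewrite v0 lexx !expr0n /= mulr0 mul0r.
have /andP[D1 D2] := D n; apply/andP; split; first by lra.
have n0 : 0 <= n%:R :> R by [].
have : 0 <= (3 * n%:R ^+ 3 + 6 * n%:R ^+ 2 + 4 * n%:R + 1) * b ^+ 2.
  by rewrite mulr_ge0 ?sqr_ge0 // !addr_ge0 // mulr_ge0 // exprn_ge0.
have e : 2 * n.+1%:R ^+ 4 * b ^+ 2 = 2 * n%:R ^+ 4 * b ^+ 2 + 2 * n%:R ^+ 3 * b ^+ 2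
   + 2 * (3 * n%:R ^+ 3 + 6 * n%:R ^+ 2 + 4 * n%:R + 1) * b ^+ 2 by rewrite -natr1; ring.
by move=> h3; rewrite e; lra.
Qed.

Lemma sin_le_sqrt t : `|sin t| <= Num.sqrt (2 * (1 - cos t)).
Proof.
rewrite -sqrtr_sqr ler_wsqrtr // sin2cos2.
by have := sqr_ge0 (1 - cos t); rewrite !expr2; lra.
Qed.

Lemma sin_muln_taylor n t :
  `|sin (n%:R * t) - n%:R * sin t| <= n%:R ^+ 3 * `|sin t| * (1 - cos t).
Proof.
set b := 1 - cos t; have b0 : 0 <= b := cosB1_ge0 t.
elim: n => [|n IH]; first by rewrite !mul0r sin0 subrr normr0 expr0n !mul0r.
have -> : sin (n.+1%:R * t) - n.+1%:R * sin t =
    (sin (n%:R * t) - n%:R * sin t) - sin t * (1 - cos (n%:R * t)) - b * sin (n%:R * t).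
  by rewrite -natr1 !mulrDl mul1r sinD /b; ring.
have h1 : `|sin t * (1 - cos (n%:R * t))| <= `|sin t| * (n%:R ^+ 2 * b).
  by rewrite normrM ler_wpM2l // ger0_norm ?cosB1_ge0 // cosB1_muln.
have h2 : `|b * sin (n%:R * t)| <= b * (n%:R * `|sin t|).
  by rewrite normrM (ger0_norm b0) ler_wpM2l // le_sin_muln.
have := ler_normB (sin (n%:R * t) - n%:R * sin t - sin t * (1 - cos (n%:R * t))) (b * sin (n%:R * t)).
have := ler_normB (sin (n%:R * t) - n%:R * sin t) (sin t * (1 - cos (n%:R * t))).
have : 0 <= (2 * n%:R ^+ 2 + 2 * n%:R + 1) * (`|sin t| * b).
  by rewrite mulr_ge0 // ?mulr_ge0 // !addr_ge0 // mulr_ge0 // exprn_ge0.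
have -> : n.+1%:R ^+ 3 * `|sin t| * b = n%:R ^+ 3 * `|sin t| * b + `|sin t| * (n%:R ^+ 2 * b)
   + b * (n%:R * `|sin t|) + (2 * n%:R ^+ 2 + 2 * n%:R + 1) * (`|sin t| * b).
  by rewrite -natr1; ring.
lra.
Qed.

(** Quadratic in n because only a second moment is available: the cubic bound serves when n s <= 1,
    with s = sqrt(2 (1 - cos t)), and the trivial bound 2 n s otherwise. *)
Lemma sin_muln_bound n t : `|sin (n%:R * t) - n%:R * sin t| <= 4 * n%:R ^+ 2 * (1 - cos t).
Proof.
have := sin_muln_taylor n t; have := sin_le_sqrt t; have := le_sin_muln n t.
have := cosB1_ge0 t; set b := 1 - cos t => b0 h1 h2 h3.
set s := Num.sqrt (2 * b) in h2; have s0 : 0 <= s by exact: sqrtr_ge0.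
have s2 : s ^+ 2 = 2 * b by rewrite sqr_sqrtr // mulr_ge0.
have [ns|ns] := leP (n%:R * s) 1.
  apply: le_trans h3 _.
  have : n%:R ^+ 2 * b * (n%:R * `|sin t|) <= n%:R ^+ 2 * b * 1.
    rewrite ler_wpM2l ?mulr_ge0 ?exprn_ge0 //; by apply: le_trans ns; rewrite ler_wpM2l.
  have : 0 <= n%:R ^+ 2 * b by rewrite mulr_ge0 ?exprn_ge0.
  have -> : n%:R ^+ 3 * `|sin t| * b = n%:R ^+ 2 * b * (n%:R * `|sin t|) by ring.
  lra.
have := ler_normB (sin (n%:R * t)) (n%:R * sin t); rewrite normrM ger0_norm // => h4.
have h5 : n%:R * `|sin t| <= n%:R * s by exact: ler_wpM2l.
have h6 : n%:R * s * 1 <= n%:R * s * (n%:R * s) by rewrite ler_wpM2l ?mulr_ge0 // ltW.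
have -> : 4 * n%:R ^+ 2 * b = 2 * (n%:R * s * (n%:R * s)) by rewrite mulrACA -expr2 -expr2 s2; ring.
lra.
Qed.

Lemma abs_int_trig k t : (k%:~R ^+ 2 = `|k|%N%:R ^+ 2 :> R) *
  (cos (k%:~R * t) = cos (`|k|%N%:R * t)) *
  (`|sin (k%:~R * t) - k%:~R * sin t| = `|sin (`|k|%N%:R * t) - `|k|%N%:R * sin t|).
Proof.
case: k => n; first by rewrite absz_nat.
have -> : `|Negz n|%N = n.+1 by [].
by rewrite NegzE rmorphN /= sqrrN !mulNr cosN sinN -opprD normrN.
Qed.

Lemma cosB1_int k t : 0 <= k%:~R ^+ 2 * (1 - cos t) - (1 - cos (k%:~R * t)) <=
  k%:~R ^+ 2 * (1 - cos t).
Proof.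
rewrite !(abs_int_trig k t); have /andP[-> _] := cosB1_muln_taylor `|k| t.
by have := cosB1_ge0 (`|k|%N%:R * t); lra.
Qed.

Lemma sin_int_bound k t : `|sin (k%:~R * t) - k%:~R * sin t| <= 4 * k%:~R ^+ 2 * (1 - cos t).
Proof. by rewrite !(abs_int_trig k t); exact: sin_muln_bound. Qed.

Lemma trig_taylor (M : nat) e : 0 < e -> exists2 d, 0 < d & forall t k, 1 - cos t < d ->
  (`|k| <= M)%N -> `|k%:~R ^+ 2 * (1 - cos t) - (1 - cos (k%:~R * t))| +
    `|sin (k%:~R * t) - k%:~R * sin t| <= e * (1 - cos t).
Proof.
move=> e0; pose A : R := 2 * M%:R ^+ 4 + 1; pose B : R := M%:R ^+ 3 + 1.
have A0 : 0 < A by rewrite ltr_wpDl // mulr_ge0 // exprn_ge0.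
have B0 : 0 < B by rewrite ltr_wpDl // exprn_ge0.
exists (Num.min (e / (2 * A)) ((e / (2 * B)) ^+ 2 / 2)).
  by rewrite lt_min !divr_gt0 ?exprn_gt0 ?divr_gt0 ?mulr_gt0.
move=> t k; rewrite lt_min => /andP[d1 d2] kM.
rewrite !(abs_int_trig k t).
have /andP[a1 a2] := cosB1_muln_taylor `|k| t; rewrite (ger0_norm a1).
have b0 := cosB1_ge0 t; have s1 := sin_le_sqrt t.
apply: (le_trans (lerD a2 (sin_muln_taylor _ _))).
have kM' : `|k|%N%:R <= M%:R :> R by rewrite ler_nat.
set m := `|k|%N%:R in kM' *; have m0 : 0 <= m :> R by rewrite /m.
set b := 1 - cos t in b0 d1 d2 s1 *.
have h1 : 2 * m ^+ 4 * b ^+ 2 <= e / 2 * b.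
  rewrite expr2 mulrA ler_wpM2r //.
  apply: (@le_trans _ _ (A * b)).
    rewrite ler_wpM2r // /A ler_wpDr // ler_wpM2l // lerXn2r ?nnegrE //.
  have -> : e / 2 = A * (e / (2 * A)) by field; rewrite gt_eqF.
  by rewrite ler_pM2l // ltW.
have h2 : m ^+ 3 * `|sin t| * b <= e / 2 * b.
  rewrite ler_wpM2r //.
  have sb : Num.sqrt (2 * b) <= e / (2 * B).
    rewrite -[leRHS]ger0_norm ?(ltW (divr_gt0 _ _)) ?mulr_gt0 // -sqrtr_sqr ler_wsqrtr //; lra.
  have -> : e / 2 = B * (e / (2 * B)) by field; rewrite gt_eqF.
  rewrite ler_pM ?exprn_ge0 //; last exact: le_trans sb.
  by rewrite /B ler_wpDr // lerXn2r ?nnegrE.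
lra.
Qed.

End Trig.

(** * Expectations of functions of an integer variable; its characteristic function *)

Section IntegerExpectation.
Context d (T : measurableType d) (R : realType) (P : probability T R).
Variable K : T -> int.
Hypothesis mK : forall B : set int, measurable [set w | B (K w)].

Definition Ex (g : int -> R) : R := \int[P]_w g (K w).

Definition inL1 (g : int -> R) := P.-integrable setT (EFin \o (g \o K)).

Lemma measurable_fun_int (g : int -> R) : measurable_fun setT (g \o K).
Proof. by move=> _ B mB; rewrite setTI; exact: (mK (g @^-1` B)). Qed.

Lemma inL1_le g h : (forall k, `|g k| <= h k) -> inL1 h -> inL1 g.
Proof.
move=> gh; apply: le_integrable => //.
  by apply/measurable_EFinP; exact: measurable_fun_int.
move=> w _ /=; rewrite lee_fin; apply: le_trans (gh _) (ler_norm _).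
Qed.

Lemma inL1_cst c : inL1 (fun=> c).
Proof. exact: finite_measure_integrable_cst. Qed.

Lemma inL1_bounded g C : (forall k, `|g k| <= C) -> inL1 g.
Proof. by move=> h; apply: inL1_le h (inL1_cst C). Qed.

Lemma inL1D g h : inL1 g -> inL1 h -> inL1 (fun k => g k + h k).
Proof. by move=> sg sh; have := integrableD measurableT sg sh. Qed.

Lemma inL1Z c g : inL1 g -> inL1 (fun k => c * g k).
Proof. by move=> sg; have := @integrableZl _ _ _ P _ measurableT c _ sg. Qed.

Lemma ExD g h : inL1 g -> inL1 h -> Ex (fun k => g k + h k) = Ex g + Ex h.
Proof. by move=> sg sh; rewrite /Ex RintegralD. Qed.

Lemma ExZ c g : inL1 g -> Ex (fun k => c * g k) = c * Ex g.
Proof. by move=> sg; rewrite /Ex (@RintegralZl _ _ _ _ _ (g \o K)). Qed.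

Lemma Ex_cst c : Ex (fun=> c) = c.
Proof. by rewrite /Ex Rintegral_cst // [fine _](pr_setT P) mulr1. Qed.

Lemma le_Ex g h : inL1 g -> inL1 h -> (forall k, g k <= h k) -> Ex g <= Ex h.
Proof. by move=> sg sh gh; rewrite /Ex le_Rintegral. Qed.

Lemma normr_Ex g h : inL1 h -> (forall k, `|g k| <= h k) -> `|Ex g| <= Ex h.
Proof.
move=> sh gh; have sg := inL1_le gh sh; rewrite ler_norml; apply/andP; split.
  have := ExZ (-1) sh; rewrite mulN1r => <-; apply: le_Ex => // [|k]; first exact: inL1Z.
  by have := gh k; rewrite ler_norml mulN1r => /andP[].
by apply: le_Ex => // k; have := gh k; rewrite ler_norml => /andP[].
Qed.

Lemma inL1_sum (I : Type) (s : seq I) (g : I -> int -> R) : (forall i, inL1 (g i)) ->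
  inL1 (fun k => \sum_(i <- s) g i k).
Proof.
move=> sg; elim: s => [|i s IH].
  by under [X in inL1 X]eq_fun do rewrite big_nil; exact: inL1_cst.
by under [X in inL1 X]eq_fun do rewrite big_cons; exact: inL1D.
Qed.

Lemma Ex_sum (I : Type) (s : seq I) (g : I -> int -> R) : (forall i, inL1 (g i)) ->
  Ex (fun k => \sum_(i <- s) g i k) = \sum_(i <- s) Ex (g i).
Proof.
move=> sg; elim: s => [|i s IH].
  by rewrite big_nil; under [X in Ex X]eq_fun do rewrite big_nil; exact: Ex_cst.
rewrite big_cons -IH -ExD //; last exact: inL1_sum.
by under [X in Ex X]eq_fun do rewrite big_cons.
Qed.

Lemma Ex_ind (B : set int) : Ex (\1_B) = pr P [set w | B (K w)].
Proof.
rewrite /Ex /Rintegral /pr; congr fine.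
by have := integral_indic P measurableT (mK B); rewrite setIT => <-.
Qed.

Variable nu : R.
Hypothesis sqr_inL1 : inL1 (fun k => k%:~R ^+ 2).
Hypothesis mean0 : Ex (fun k => k%:~R) = 0.
Hypothesis var_nu : Ex (fun k => k%:~R ^+ 2) = nu.

Lemma id_inL1 : inL1 (fun k => k%:~R).
Proof.
apply: inL1_le (inL1D (inL1_cst 1) sqr_inL1) => k.
rewrite -[k%:~R ^+ 2]real_normK ?num_real //.
by have := sqr_ge0 (`|k%:~R| - 1 : R); rewrite sqrrB1; have := normr_ge0 (k%:~R : R); lra.
Qed.

Lemma cos_inL1 t : inL1 (fun k => cos (k%:~R * t)).
Proof. by apply: (@inL1_bounded _ 1) => k; exact: cos_max. Qed.

Lemma sin_inL1 t : inL1 (fun k => sin (k%:~R * t)).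
Proof. by apply: (@inL1_bounded _ 1) => k; exact: sin_max. Qed.

Lemma sqr_tail e : 0 < e -> exists M : nat,
  Ex (fun k => if (`|k| <= M)%N then 0 else k%:~R ^+ 2) <= e.
Proof.
move=> e0; pose h M w : \bar R := (if (`|K w| <= M)%N then 0 else (K w)%:~R ^+ 2)%:E.
have sh M : inL1 (fun k => if (`|k| <= M)%N then 0 else k%:~R ^+ 2).
  apply: inL1_le sqr_inL1 => k; case: ifP => _; rewrite ?normr0 ?sqr_ge0 //.
  by rewrite ger0_norm ?sqr_ge0.
have mh M : measurable_fun setT (h M) by case/integrableP: (sh M).
have h0 : {ae P, forall w, setT w -> h ^~ w @ \oo --> (0%E : \bar R)}.
  apply: aeW => w _; apply: cvg_near_cst; exists `|K w|%N => // M /= KM.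
  by rewrite /h KM.
have hd : {ae P, forall w M, setT w -> (`|h M w| <= ((K w)%:~R ^+ 2)%:E)%E}.
  apply: aeW => w M _; rewrite /h lee_fin; case: ifP => _; rewrite ?normr0 ?sqr_ge0 //.
  by rewrite ger0_norm ?sqr_ge0.
have [_ _] := dominated_convergence measurableT mh (measurable_cst _) h0 sqr_inL1 hd.
rewrite integral_cst // mul0e => /fine_cvgP[_] /cvgrPdist_le /(_ e e0)[M _ /(_ M (leqnn M)) /=].
rewrite sub0r normrN => hM; exists M; apply: le_trans hM; exact: ler_norm.
Qed.

Definition phi_re t := Ex (fun k => cos (k%:~R * t)).
Definition phi_im t := Ex (fun k => sin (k%:~R * t)).

Definition chf t : R[i] := phi_re t +i* phi_im t.

(** Subtracting the variance term in F and the centred linear term in G leaves remainders whose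
    expectations are the real and imaginary errors of the expansion. *)
Let F t k : R := k%:~R ^+ 2 * (1 - cos t) - (1 - cos (k%:~R * t)).
Let G t k : R := sin (k%:~R * t) - k%:~R * sin t.

Let sqrZ_inL1 c : inL1 (fun k => c * k%:~R ^+ 2).
Proof. exact: inL1Z. Qed.

Let F_le t k : `|F t k| <= (1 - cos t) * k%:~R ^+ 2.
Proof. by have /andP[h0 h1] := cosB1_int k t; rewrite ger0_norm // mulrC. Qed.

Let G_le t k : `|G t k| <= 4 * (1 - cos t) * k%:~R ^+ 2.
Proof. by rewrite -mulrA [_ * _ ^+ 2]mulrC mulrA sin_int_bound. Qed.

Let ExF t : Ex (F t) = nu * (1 - cos t) - (1 - phi_re t).
Proof.
have -> : F t = (fun k => (1 - cos t) * k%:~R ^+ 2 + (-1 + cos (k%:~R * t))).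
  by apply/funext => k; rewrite /F; ring.
have s1 : inL1 (fun k => -1 + cos (k%:~R * t)).
  by apply: inL1D; [exact: inL1_cst|exact: cos_inL1].
rewrite ExD // ExZ // var_nu ExD; [|exact: inL1_cst|exact: cos_inL1].
by rewrite Ex_cst -/(phi_re t); ring.
Qed.

Let ExG t : Ex (G t) = phi_im t.
Proof.
have -> : G t = (fun k => sin (k%:~R * t) + - sin t * k%:~R).
  by apply/funext => k; rewrite /G; ring.
rewrite ExD; [|exact: sin_inL1|exact: inL1Z id_inL1].
by rewrite ExZ ?mean0 ?mulr0 ?addr0 //; exact: id_inL1.
Qed.

Lemma chf_taylorE t : cn (1 - chf t - (nu * (1 - cos t))%:C) <= `|Ex (F t)| + `|Ex (G t)|.
Proof.
apply: le_trans (cn_le_ReIm _) _; rewrite !reCD !imCD !reCN !imCN /= ExF ExG.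
by rewrite -normrN opprB opprD opprK addrA sub0r subr0 normrN.
Qed.

Let nu_ge0 : 0 <= nu.
Proof.
by rewrite -var_nu -(Ex_cst 0); apply: le_Ex => // [|k]; [exact: inL1_cst|exact: sqr_ge0].
Qed.

(** 6 = 1 + 4 + 1, from F, from G and from the main term. *)
Lemma chf_upper t : cn (1 - chf t) <= (6 * nu + 1) * (1 - cos t).
Proof.
have b0 := cosB1_ge0 t; set b := 1 - cos t in b0 *.
have hF : `|Ex (F t)| <= b * nu.
  by rewrite -var_nu -ExZ //; apply: normr_Ex => //; exact: F_le.
have hG : `|Ex (G t)| <= 4 * b * nu.
  by rewrite -var_nu -ExZ //; apply: normr_Ex => //; exact: G_le.
have h := chf_taylorE t; rewrite -/b in h.
have := cnD (1 - chf t - (nu * b)%:C) (nu * b)%:C.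
by rewrite subrK cn_real ger0_norm ?mulr_ge0 //; lra.
Qed.

(** Values up to M are expanded uniformly; the rest costs 5 (1 - cos t) times a tail of the second
    moment, taken below e / 10. *)
Lemma chf_taylor e : 0 < e -> exists2 d, 0 < d & forall t, 1 - cos t < d ->
  cn (1 - chf t - (nu * (1 - cos t))%:C) <= e * (1 - cos t).
Proof.
move=> e0; have e10 : 0 < e / 10 by rewrite divr_gt0.
have [M hM] := sqr_tail e10; have e2 : 0 < e / 2 by rewrite divr_gt0.
have [d0 d0_gt0 hd] := trig_taylor M e2; exists d0 => // t /hd {}hd.
apply: le_trans (chf_taylorE t) _.
have b0 := cosB1_ge0 t; set b := 1 - cos t in b0 hd *.
pose tl (k : int) : R := if (`|k| <= M)%N then 0 else k%:~R ^+ 2.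
have stl : inL1 tl.
  apply: inL1_le sqr_inL1 => k; rewrite /tl; case: ifP => _; rewrite ?normr0 ?sqr_ge0 //.
  by rewrite ger0_norm ?sqr_ge0.
have sF : inL1 (fun k => `|F t k|).
  by apply: inL1_le (sqrZ_inL1 b) => k; rewrite normr_id; exact: F_le.
have sG : inL1 (fun k => `|G t k|).
  by apply: inL1_le (sqrZ_inL1 (4 * b)) => k; rewrite normr_id; exact: G_le.
apply: (@le_trans _ _ (Ex (fun k => `|F t k| + `|G t k|))).
  by rewrite (ExD sF sG) lerD //; apply: normr_Ex.
apply: (@le_trans _ _ (Ex (fun k => e / 2 * b + 5 * b * tl k))).
  apply: le_Ex => [||k].
  - exact: inL1D.
  - by apply: inL1D; [exact: inL1_cst|exact: inL1Z].
  have [kM|kM] := boolP (`|k| <= M)%N.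
    by rewrite /tl kM mulr0 addr0 hd.
  rewrite /tl (negbTE kM); have := F_le t k; have := G_le t k; rewrite -/b.
  by have := mulr_ge0 (ltW e2) b0; lra.
rewrite ExD; [|exact: inL1_cst|exact: inL1Z].
rewrite Ex_cst ExZ //; have : b * Ex tl <= b * (e / 10) by rewrite ler_wpM2l.
lra.
Qed.

Lemma Ex_residue N (g : int -> R) (u : int -> int) : (0 < N)%N ->
  (forall x y, (N %| x - y)%Z -> g x = g y) ->
  \sum_(r < N) pr P [set w | (N %| u (K w) - r%:Z)%Z] * g r%:Z = Ex (g \o u).
Proof.
move=> N0 gN; pose I (r : 'I_N) (k : int) : R := ((N %| u k - r%:Z)%Z)%:R.
have IE r : Ex (I r) = pr P [set w | (N %| u (K w) - r%:Z)%Z].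
  by rewrite -(Ex_ind (fun k => (N %| u k - r%:Z)%Z)); congr Ex; apply/funext => k;
    rewrite /I indicE; congr ((nat_of_bool _)%:R); apply/idP/idP => [h|/set_mem //]; exact: mem_set.
have sI r : inL1 (I r).
  by apply: (@inL1_bounded _ 1) => k; rewrite /I; case: (_ %| _)%Z; rewrite ?normr1 ?normr0.
have -> : g \o u = (fun k => \sum_(r < N) g r%:Z * I r k).
  apply/funext => k /=; have [i ki] := residue_ex (u k) N0.
  rewrite (bigD1 i) //= /I ki mulr1 big1 ?addr0; first exact: gN.
  move=> j ji; case: (boolP (N %| u k - j%:Z)%Z) => kj; last by rewrite mulr0.
  by case/eqP: ji; exact: residue_uniq kj ki.
rewrite Ex_sum => [|r]; last exact: inL1Z.
by apply: eq_bigr => r _; rewrite ExZ // IE mulrC.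
Qed.

(** The sign s covers both uses: x - k for the transition read backwards, k + r for the law after n
    steps. *)
Lemma chf_fourier N j (u : int -> int) (s y : int) : (0 < N)%N -> s ^+ 2 = 1 ->
  (forall k, u k = s * k + y) ->
  \sum_(r < N) (pr P [set w | (N %| u (K w) - r%:Z)%Z])%:C * cis (s%:~R * (th R N j * r%:R)) =
  chf (th R N j) * cis (s%:~R * (th R N j * y%:~R)).
Proof.
move=> N0 s1 uE; set th0 := th R N j.
have per x z : (N %| x - z)%Z -> cis (s%:~R * (th0 * x%:~R)) = cis (s%:~R * (th0 * z%:~R)).
  move=> xz; rewrite !(mulrCA _ th0) -!intrM; apply: cis_th_mod => //.
  by rewrite -mulrBr dvdz_mull.
have [perc pers] : (forall x z, (N %| x - z)%Z ->
    cos (s%:~R * (th0 * x%:~R)) = cos (s%:~R * (th0 * z%:~R))) /\ (forall x z, (N %| x - z)%Z ->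
    sin (s%:~R * (th0 * x%:~R)) = sin (s%:~R * (th0 * z%:~R))).
  by split=> x z /per /eqP; rewrite eq_complex /= => /andP[/eqP ? /eqP ?].
have H1 := Ex_residue u N0 perc; have H2 := Ex_residue u N0 pers.
have uth k : s%:~R * (th0 * (u k)%:~R) = k%:~R * th0 + s%:~R * (th0 * y%:~R).
  have s2 : s%:~R ^+ 2 = 1 :> R by rewrite -rmorphXn s1.
  transitivity (s%:~R ^+ 2 * (k%:~R * th0) + s%:~R * (th0 * y%:~R)).
    by rewrite uE rmorphD rmorphM /=; ring.
  by rewrite s2 mul1r.
have -> : \sum_(r < N) (pr P [set w | (N %| u (K w) - r%:Z)%Z])%:C * cis (s%:~R * (th0 * r%:R)) =
    Ex (fun k => cos (s%:~R * (th0 * (u k)%:~R))) +i* Ex (fun k => sin (s%:~R * (th0 * (u k)%:~R))).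
  move: H1 H2; rewrite /comp => <- <-.
  apply: (big_rec3 (fun (z : R[i]) x y => z = x +i* y)) => // i x1 x2 z _ ->.
  by rewrite /cis; apply/eqP; rewrite eq_complex /= !mul0r subr0 addr0 -!pmulrn !eqxx.
under [X in Ex X +i* _]eq_fun do rewrite uth cosD.
under [X in _ +i* Ex X]eq_fun do rewrite uth sinD.
set c0 := s%:~R * _.
have sc := cos_inL1 th0; have ss := sin_inL1 th0.
have e1 : Ex (fun k => cos (k%:~R * th0) * cos c0 - sin (k%:~R * th0) * sin c0) =
    phi_re th0 * cos c0 - phi_im th0 * sin c0.
  rewrite (_ : (fun k => _) = (fun k => cos c0 * cos (k%:~R * th0) + - sin c0 * sin (k%:~R * th0))).
    by rewrite (ExD (inL1Z _ sc) (inL1Z _ ss)) !ExZ // /phi_re /phi_im; ring.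
  by apply/funext => k; ring.
have e2 : Ex (fun k => sin (k%:~R * th0) * cos c0 + cos (k%:~R * th0) * sin c0) =
    phi_im th0 * cos c0 + phi_re th0 * sin c0.
  rewrite (_ : (fun k => _) = (fun k => cos c0 * sin (k%:~R * th0) + sin c0 * cos (k%:~R * th0))).
    by rewrite (ExD (inL1Z _ ss) (inL1Z _ sc)) !ExZ // /phi_re /phi_im; ring.
  by apply/funext => k; ring.
rewrite e1 e2 /chf /cis; apply/eqP; rewrite eq_complex /= eqxx /=; apply/eqP; ring.
Qed.

End IntegerExpectation.

(** * Fourier transform of the step law modulo N, and its lower bound *)

Section StepFourier.
Context d (T : measurableType d) (R : realType) (P : probability T R).
Context d0 (T0 : measurableType d0) (P0 : probability T0 R).
Variables (Y : nat -> T -> int) (K : T0 -> int).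
Hypothesis mY : forall k (B : set int), measurable [set w | B (Y k w)].
Hypothesis mK : forall B : set int, measurable [set w | B (K w)].
Let law (B : set int) := pr P0 [set w | B (K w)].
Hypothesis indep : forall n (B : nat -> set int),
  pr P [set w | forall k, (k < n)%N -> B k (Y k w)] = \prod_(k < n) law (B k).

Lemma residue_lawE (N : nat) (u : int -> int) (y z : int) :
  (forall k, (N %| k - y)%Z = (N %| u k - z)%Z) ->
  residue_law law N y = pr P0 [set w | (N %| u (K w) - z)%Z].
Proof. by move=> h; congr pr; apply/seteqP; split => w /=; rewrite h. Qed.

Lemma residue_law_fourier N : (0 < N)%N -> forall j (x : int),
  \sum_(r < N) (residue_law law N (x - r%:Z))%:C * cis (- (th R N j * r%:R)) =
  chf P0 K (th R N j) * cis (- (th R N j * x%:~R)).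
Proof.
move=> N0 j x; have h k : x - k = -1 * k + x by ring.
have := chf_fourier P0 mK j N0 (sqrrN 1) h; rewrite !mulN1r => <-.
apply: eq_bigr => r _; rewrite !mulN1r; congr (_%:C * _).
apply: (residue_lawE (u := fun k => x - k) (z := r%:Z)) => k.
by rewrite -rpredN; congr (_ %| _)%Z; ring.
Qed.

Definition torus_law N n (x : int) : R := pr P (site Y (fun z => (N %| z - x)%Z) xpred0 n 0).

Lemma visits0 n w : visits Y xpred0 n w = 0%N.
Proof. by rewrite /visits big1. Qed.

Lemma torus_law_fourier N n j : (0 < N)%N ->
  \sum_(x < N) (torus_law N n x%:Z)%:C * cis (th R N j * x%:R) = chf P0 K (th R N j) ^+ n.
Proof.
move=> N0; elim: n => [|n IH].
  have torus_lawE (x : 'I_N) : torus_law N 0 x%:Z = (x == Ordinal N0)%:R.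
    have -> : (x == Ordinal N0) = (N %| 0 - x%:Z)%Z.
      rewrite sub0r rpredN; apply/eqP/idP => [->|]; first exact: dvdz0.
      rewrite dvdzE !absz_nat => h; apply/val_inj/eqP => /=; rewrite -leqn0 leqNgt.
      by apply/negP => /dvdn_leq/(_ h); rewrite leqNgt ltn_ord.
    rewrite /torus_law; set b := (_ %| _)%Z; rewrite (_ : site _ _ _ _ _ = if b then setT else set0).
      by case: b; rewrite ?pr_setT ?pr_set0.
    apply/seteqP; split => w; rewrite /b /site /= visits0 /Z big_ord0; first by case=> ->.
    by case: ifP.
  rewrite (bigD1 (Ordinal N0)) // torus_lawE eqxx /= mulr0 cis0 mulr1 big1 ?addr0 ?expr0 // => x xN.
  by rewrite torus_lawE (negbTE xN) mul0r.
have torus_lawS (x : 'I_N) : torus_law N n.+1 x%:Z =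
    \sum_(r < N) residue_law law N (x%:Z - r%:Z) * torus_law N n r%:Z.
  rewrite -(site_conv mY indep) // /torus_law; congr pr.
  apply/seteqP; split => w; rewrite /site /= !visits0 //.
under eq_bigr => x _ do rewrite torus_lawS rmorph_sum mulr_suml.
rewrite exchange_big exprS -IH mulr_sumr; apply: eq_bigr => r _ /=.
have h k : k + r%:Z = 1 * k + r%:Z by rewrite mul1r.
have := chf_fourier P0 mK j N0 (expr1n _ 2) h; rewrite !mul1r -pmulrn => H.
rewrite mulrCA -H mulr_sumr; apply: eq_bigr => x _; rewrite mul1r rmorphM /=.
rewrite (residue_lawE (u := fun k => k + r%:Z) (z := x%:Z)); first ring.
by move=> k; congr (_ %| _)%Z; ring.
Qed.

Lemma bernoulli_ineq (s : R) m : 0 <= s <= 1 -> 1 - m%:R * s <= (1 - s) ^+ m.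
Proof.
move=> /andP[s0 s1]; elim: m => [|m IH]; first by rewrite mul0r subr0 expr0.
rewrite exprS; apply: (@le_trans _ _ ((1 - s) * (1 - m%:R * s))).
  rewrite -natr1; have : 0 <= m%:R * s * s by rewrite !mulr_ge0.
  have -> : 1 - (m%:R + 1) * s = (1 - s) * (1 - m%:R * s) - m%:R * s * s by ring.
  lra.
by rewrite ler_wpM2l // subr_ge0.
Qed.

Lemma cn_1Dcis (t : R) : cn (1 + cis t) <= 2 - (1 - cos t) / 2.
Proof.
have b0 : 0 <= 1 - cos t by exact: cosB1_ge0.
have b2 : -1 <= cos t by exact: cos_geN1.
rewrite -(ler_pXn2r (n := 2)) ?nnegrE ?cn_ge0 //; last lra.
rewrite sqr_cn1D cn_cis /= -subr_ge0.
have -> : (2 - (1 - cos t) / 2) ^+ 2 - (1 + 2 * cos t + 1 ^+ 2) = ((1 - cos t) / 2) ^+ 2.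
  by field.
exact: sqr_ge0.
Qed.

(** The law of Z_m has mass at least g at 0 and at 1, distinct residues as N > 1, so |f|^m <= 1 - 2
    g + g |1 + cis t| <= 1 - g (1 - cos t) / 2. Bernoulli's inequality extracts the m-th root,
    whence c = g / (2 m). *)
Lemma chf_lower m (g : R) : (0 < m)%N -> 0 < g ->
  g <= pr P [set w | Z Y m w = 0] -> g <= pr P [set w | Z Y m w = 1] ->
  exists2 c, 0 < c & forall N j, (1 < N)%N ->
    cn (chf P0 K (th R N j)) <= 1 - c * (1 - cos (th R N j)).
Proof.
move=> m0 g0 h0 h1; exists (g / (2 * m%:R)).
  by rewrite divr_gt0 ?mulr_gt0 ?ltr0n.
move=> [|[|N]] // j _; set t := th R N.+2 j.
have N0 : (0 < N.+2)%N by [].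
have le_torus_law x : pr P [set w | Z Y m w = x] <= torus_law N.+2 m x.
  apply: le_pr; first exact: (measurable_Z mY [set x]).
    exact: measurable_site.
  by move=> w /= e; rewrite /site /= e subrr visits0; split => //; exact: dvdz0.
have sum1 : \sum_(x < N.+2) torus_law N.+2 m x%:Z = 1.
  rewrite -(pr_setT P) -(@pr_residue _ _ _ P N.+2 setT (Z Y m)) //.
    apply: eq_bigr => x _; rewrite setTI /torus_law; congr pr.
    by apply/seteqP; split => w; rewrite /site /= visits0 // => -[].
  by move=> x; rewrite setTI; exact: (measurable_Z mY (fun z => (N.+2 %| z - x%:Z)%Z)).
have := torus_law_fourier m j N0; rewrite -/t => H.
have b0 := cosB1_ge0 t; have b2 : cos t >= -1 by exact: cos_geN1.
have ub : cn (chf P0 K t) ^+ m <= 1 - g * ((1 - cos t) / 2).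
  rewrite -cnX -H !big_ord_recl /= mulr0 cis0 !mulr1.
  move: sum1; rewrite !big_ord_recl /=; set S := \sum_(i < N) _; set S' := \sum_(i < N) _.
  have hS : cn S' <= S.
    apply: le_trans (cn_sum _ _ _) _; apply: ler_sum => i _.
    by rewrite cn_realM ?pr_ge0 // cn_cis mulr1.
  have := le_torus_law 0; have := le_torus_law 1.
  set p0 := torus_law N.+2 m 0; set p1 := torus_law N.+2 m 1.
  move=> l1 l0 s1.
  have -> : p0%:C + (p1%:C * cis t + S') =
      g%:C * (1 + cis t) + (p0 - g)%:C + (p1 - g)%:C * cis t + S' by rewrite !rmorphB /=; ring.
  apply: le_trans (cnD _ _) _; apply: le_trans (lerD (cnD _ _) hS) _.
  apply: le_trans (lerD (lerD (cnD _ _) (lexx _)) (lexx _)) _.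
  have p0g : 0 <= p0 - g by lra.
  have p1g : 0 <= p1 - g by lra.
  rewrite (cn_realM _ (ltW g0)) (cn_realM _ p1g) cn_cis cn_real (ger0_norm p0g).
  have : g * cn (1 + cis t) <= g * (2 - (1 - cos t) / 2) by rewrite ler_wpM2l ?(ltW g0) ?cn_1Dcis.
  lra.
have mr : 0 < m%:R :> R by rewrite ltr0n.
have g1 : g <= 1.
  by apply: le_trans h0 _; apply: pr_le1; exact: (measurable_Z mY [set 0]).
set s := g / (2 * m%:R) * (1 - cos t).
have s0 : 0 <= s by rewrite mulr_ge0 // divr_ge0 ?mulr_ge0 // ltW.
have ms : m%:R * s = g * ((1 - cos t) / 2) by rewrite /s; field; rewrite gt_eqF.
have s1 : s <= 1.
  have : 1 * s <= m%:R * s by rewrite ler_wpM2r // ler1n.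
  have : g * ((1 - cos t) / 2) <= 1 * 1 by rewrite ler_pM ?(ltW g0) //; lra.
  by rewrite ms; lra.
rewrite leNgt; apply/negP => lt.
have := bernoulli_ineq m (s := s); rewrite s0 s1 ms => /(_ isT) /(le_trans ub).
rewrite leNgt => /negP; apply; rewrite ltr_pXn2r ?nnegrE ?cn_ge0 //; lra.
Qed.

End StepFourier.

(** * From almost surely integer variables to integer ones *)

Section IntegerValued.
Variable R : realType.

Lemma measurable_range_int : measurable (range (fun z : int => z%:~R : R)).
Proof.
rewrite (_ : range _ = \bigcup_(z in setT) [set (z%:~R : R)]).
  exact: countable_bigcupT_measurable.
apply/seteqP; split => x; first by case=> z _ <-; exists z.
by case=> z _ ->; exists z.
Qed.

Context d (T : measurableType d) (P : probability T R).
Implicit Type X : {RV P >-> R}.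

Lemma measurable_RV X (A : set R) : measurable A -> measurable [set w | A (X w)].
Proof.
by move=> mA; have := @measurable_funPT _ _ _ _ X; rewrite -[X in measurable X]setTI; exact.
Qed.

Lemma measurable_RV_floor X (B : set int) : measurable [set w | B (Num.floor (X w))].
Proof.
have mB : measurable [set x : R | B (Num.floor x)] by exact: measurable_floor_preimage.
exact: measurable_RV mB.
Qed.

(** X is an integer only almost surely; its floor is one everywhere, which the combinatorics of
    paths requires. *)
Lemma supported_floor X : supported_on X (range (fun z : int => z%:~R)) ->
  {ae P, forall w, X w = (Num.floor (X w))%:~R}.
Proof.
move=> h; exists (~` (X @^-1` range (fun z : int => z%:~R))); split.
- by apply: measurableC; exact: (measurable_RV X measurable_range_int).
- rewrite probability_setC ?h ?subee //; exact: (measurable_RV X measurable_range_int).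
- by move=> w /= hw [z _ zE]; apply: hw; rewrite -zE intrKfloor.
Qed.

Lemma moments X (nu : R) (K := fun w => Num.floor (X w)) :
  {ae P, forall w, X w = (K w)%:~R} ->
  ('E_P[X] = 0)%E -> ('E_P[fun w => (X w ^+ 2)%R] = nu%:E)%E ->
  [/\ inL1 P K (fun k => k%:~R ^+ 2), Ex P K (fun k => k%:~R) = 0 &
      Ex P K (fun k => k%:~R ^+ 2) = nu].
Proof.
move=> XK; rewrite unlock => m0 mv.
have mX : measurable_fun setT X by exact: measurable_funPT.
have mK (g : int -> R) : measurable_fun setT (g \o K).
  by apply: measurable_fun_int => B; exact: measurable_RV_floor.
have e1 : (\int[P]_w ((K w)%:~R)%:E = 0)%E.
  rewrite -m0; apply: ae_eq_integral => //.
  - by apply/measurable_EFinP; exact: (mK (fun k => k%:~R)).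
  - by apply/measurable_EFinP.
  - by apply: filterS XK => w /= e _; rewrite e.
have e2 : (\int[P]_w ((K w)%:~R ^+ 2)%:E = nu%:E)%E.
  rewrite -mv; apply: ae_eq_integral => //.
  - by apply/measurable_EFinP; exact: (mK (fun k => k%:~R ^+ 2)).
  - by apply/measurable_EFinP; exact: measurable_funX.
  - by apply: filterS XK => w /= e _; rewrite e.
split; last 2 first.
- by rewrite /Ex /Rintegral e1.
- by rewrite /Ex /Rintegral e2.
apply/integrableP; split; first by apply/measurable_EFinP; exact: (mK (fun k => k%:~R ^+ 2)).
rewrite (_ : (\int[P]_x `|_|)%E = nu%:E) ?ltry // -e2; apply: eq_integral => w _ /=.
by rewrite ger0_norm // sqr_ge0.
Qed.

End IntegerValued.

Section IidSteps.
Context d0 (T0 : measurableType d0) (R : realType) (P0 : probability T0 R) (X : {RV P0 >-> R}).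
Context d (T : measurableType d) (P : probability T R) (Xs : nat -> {RV P >-> R}).
Hypothesis Xs_iid : iid_copies X Xs.

Lemma same_lawE k (A : set R) : measurable A ->
  pr P [set w | A (Xs k w)] = pr P0 [set w | A (X w)].
Proof. by move=> mA; have := Xs_iid.2 k A mA; rewrite /distribution /pushforward /pr => ->. Qed.

Lemma iid_prod n (B : nat -> set int) :
  pr P [set w | forall k, (k < n)%N -> B k (Num.floor (Xs k w))] =
  \prod_(k < n) pr P0 [set w | B k (Num.floor (X w))].
Proof.
have mB k : measurable [set x : R | B k (Num.floor x)] by exact: measurable_floor_preimage.
have := Xs_iid.1 [fset k in iota 0 n]%fset _ mB.
rewrite (perm_big (iota 0 n)) /=; last first.
  by apply: uniq_perm; rewrite ?iota_uniq ?fset_uniq // => k; rewrite !inE.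
have -> : (\prod_(j <- iota 0 n) P (Xs j @^-1` [set x | B j (Num.floor x)]))%E =
    (\prod_(k < n) pr P0 [set w | B k (Num.floor (X w))])%:E.
  rewrite -{1}[n]subn0 -/(index_iota 0 n) big_mkord.
  apply: (big_rec2 (fun x y => x = y%:E)) => // k x y _ ->.
  rewrite EFinM; congr (_ * _)%E.
  by rewrite -(same_lawE k (mB k)) -prE //; exact: measurable_RV.
rewrite /pr => H; have -> : [set w | forall k, (k < n)%N -> B k (Num.floor (Xs k w))] =
  \bigcap_(j in [set` [fset k in iota 0 n]%fset]) Xs j @^-1` [set x | B j (Num.floor x)].
  apply/seteqP; split => w h k /=.
    by rewrite !inE mem_iota add0n => /h.
  by move=> kn; apply: (h k); rewrite /= !inE mem_iota.
by rewrite H.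
Qed.

Lemma Xs_floor : supported_on X (range (fun z : int => z%:~R)) ->
  {ae P, forall w k, Xs k w = (Num.floor (Xs k w))%:~R}.
Proof.
move=> h; apply: ae_foralln => k; apply: supported_floor.
have := Xs_iid.2 k _ (@measurable_range_int R).
by rewrite /supported_on /distribution /pushforward => ->.
Qed.

End IidSteps.

(** * Uniform errors, and the walk rewritten with integer steps *)

Section Walk.
Variables (R : realType).

(** The index sets must be nonempty, since the extended supremum of the empty set is -oo and would
    not tend to 0. *)
Lemma uniform_o1P (I : Type) (D : nat -> set I) (err : nat -> I -> R) :
  (forall n, D n !=set0) ->
  (forall e, 0 < e -> exists n0 : nat, forall n, (n0 <= n)%N -> forall i, D n i ->
    `|err n i| <= e) -> uniform_o1 D err.
Proof.
move=> D0 h; pose s n := ereal_sup [set `|err n i|%:E | i in D n].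
have s0 n : (0 <= s n)%E.
  have [i Di] := D0 n; apply: (@le_trans _ _ (`|err n i|%:E)); first by rewrite lee_fin.
  by apply: ereal_sup_ubound; exists i.
have se e : 0 < e -> \forall n \near \oo, (s n <= e%:E)%E.
  move=> /h[n0 hn]; exists n0 => // n /= nn; apply: ge_ereal_sup => _ [i Di <-].
  by rewrite lee_fin hn.
apply/fine_cvgP; split.
  apply: filterS (se 1 ltr01) => n sn; rewrite fin_numE gt_eqF ?lt_eqF //.
    exact: le_lt_trans sn (ltry _).
  exact: lt_le_trans (ltNyr 0) (s0 n).
apply/cvgrPdist_le => e e0; apply: filterS (se e e0) => n sn /=.
rewrite sub0r normrN ger0_norm ?fine_ge0 ?s0 // -lee_fin fineK //.
rewrite fin_numE gt_eqF ?lt_eqF //.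
  exact: le_lt_trans sn (ltry _).
exact: lt_le_trans (ltNyr 0) (s0 n).
Qed.

Lemma admissible_ex (kappa : R) n : 0 < kappa -> admissible kappa n !=set0.
Proof.
move=> k0; have k1 : 0 <= kappa * Num.sqrt n%:R by rewrite mulr_ge0 // ltW.
have lt := archi_boundP k1; exists (0, 0, Num.bound (kappa * Num.sqrt n%:R)).
split; [|exact: ltW|by left|by left].
by rewrite -(ltr_nat R); exact: le_lt_trans lt.
Qed.

Context d (T : measurableType d) (P : probability T R) (Xs : nat -> {RV P >-> R}).

Lemma measurable_walk n (A : set R) : measurable A -> measurable [set w | A (walk Xs n w)].
Proof.
move=> mA; have mW : measurable_fun setT (walk Xs n).
  by apply: measurable_sum => k; exact: measurable_funPT.
by have := mW measurableT A mA; rewrite setTI.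
Qed.

Lemma measurable_occupation n a l : measurable [set w | occupation (walk Xs) n a w = l].
Proof.
elim: n l => [|n IH] l.
  rewrite (_ : [set w | _] = if l == 0%N then setT else set0); first by case: ifP.
  by apply/seteqP; split => w; rewrite /= /occupation big_geq //; [move=> <-|case: eqP].
pose E := [set w | walk Xs n.+1 w = a].
have mE : measurable E by exact: (measurable_walk n.+1 (measurable_set1 a)).
rewrite (_ : [set w | _] = ([set w | occupation (walk Xs) n a w = l] `\` E) `|`
   ([set w | (occupation (walk Xs) n a w).+1 = l] `&` E)).
  apply: measurableU; first by apply: measurableD.
  apply: measurableI => //; case: l => [|l]; last first.
    by rewrite (_ : [set w | _] = [set w | occupation (walk Xs) n a w = l]) //;
      apply/seteqP; split => w /= => [[]|->].
  by rewrite (_ : [set w | _] = set0) //; apply/seteqP; split.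
have occS w : occupation (walk Xs) n.+1 a w =
    (occupation (walk Xs) n a w + (walk Xs n.+1 w == a))%N by rewrite /occupation big_nat_recr.
apply/seteqP; split => w /=; rewrite occS /E /=.
  by case: eqP => e h; [right|left]; split => //; rewrite -h ?addn1 ?addn0.
by case: eqP => e [] [h1 h2] //; rewrite ?addn1 ?addn0.
Qed.

Let Y k w := Num.floor (Xs k w).
Hypothesis XY : {ae P, forall w k, Xs k w = (Y k w)%:~R}.

Lemma walk_floor : {ae P, forall w, (forall n, walk Xs n w = (Z Y n w)%:~R) /\
  forall n (a : int), occupation (walk Xs) n a%:~R w = visits Y (fun z => z == a) n w}.
Proof.
apply: filterS XY => w h; have hW n : walk Xs n w = (Z Y n w)%:~R.
  by rewrite /walk big_mkord /Z rmorph_sum; apply: eq_bigr => k _; exact: h.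
split=> // n a; apply: eq_big_nat => k _; by rewrite hW eqr_int.
Qed.

Lemma measurable_floor_steps k (B : set int) : measurable [set w | B (Y k w)].
Proof. exact: measurable_RV_floor. Qed.

Lemma pr_walk_floor n (x : int) :
  pr P [set w | walk Xs n w = x%:~R] = pr P [set w | Z Y n w = x].
Proof.
apply: pr_ae.
- exact: (measurable_walk n (measurable_set1 x%:~R)).
- exact: (measurable_Z measurable_floor_steps [set x]).
- apply: filterS walk_floor => w [h _] /=; rewrite h; split => [/eqP|->] //.
  by rewrite eqr_int => /eqP.
Qed.

Lemma pr_occupation_floor n (a : int) l :
  pr P [set w | occupation (walk Xs) n a%:~R w = l] =
  pr P [set w | visits Y (fun z => z == a) n w = l].
Proof.
apply: pr_ae.
- exact: measurable_occupation.
- exact: (measurable_visits measurable_floor_steps).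
- by apply: filterS walk_floor => w [_ h] /=; rewrite h.
Qed.

Lemma pr_site_floor n (x a : int) l :
  pr P [set w | walk Xs n w = x%:~R /\ occupation (walk Xs) n a%:~R w = l] =
  pr P (site Y (fun z => z == x) (fun z => z == a) n l).
Proof.
apply: pr_ae.
- apply: (measurableI [set w | walk Xs n w = x%:~R]); last exact: measurable_occupation.
  exact: (measurable_walk n (measurable_set1 x%:~R)).
- exact: (measurable_site measurable_floor_steps).
- apply: filterS walk_floor => w [h h']; rewrite /site /= h h'.
  split=> -[hx ->]; split => //; last by rewrite (eqP hx).
  by rewrite -(eqr_int R); apply/eqP.
Qed.

End Walk.

Theorem theorem2p3 (R : realType)
  (d0 : measure_display) (T0 : measurableType d0) (P0 : probability T0 R)
  (X : {RV P0 >-> R})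
  (d : measure_display) (T : measurableType d) (P : probability T R)
  (Xs : nat -> {RV P >-> R}) (nu : R)
  (X_int : supported_on X (range (fun z : int => z%:~R)))
  (X_mean : ('E_P0[X] = 0)%E)
  (nu_gt0 : 0 < nu)
  (X_var : ('E_P0[fun w => (X w ^+ 2)%R] = nu%:E)%E)
  (X_maximal : ~ exists c h : R, 1 < h /\ supported_on X (lattice c h))
  (Xs_iid : iid_copies X Xs)
  (S_recurrent : recurrent P (walk Xs))
  (S_aperiodic : aperiodic P (walk Xs)) :
  forall kappa : R, 0 < kappa ->
    uniform_o1 (admissible kappa)
      (fun n p => let: (x, a, l) := p in
        n%:R * fine (P [set w | walk Xs n w = x%:~R /\
                                occupation (walk Xs) n a%:~R w = l])
        - phi nu (a%:~R / Num.sqrt n%:R) (x%:~R / Num.sqrt n%:R)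
                 (l%:R / Num.sqrt n%:R)) /\
    uniform_o1 (admissible kappa)
      (fun n p => let: (x, a, l) := p in
        Num.sqrt n%:R * fine (P [set w | occupation (walk Xs) n a%:~R w = l])
        - psi nu (a%:~R / Num.sqrt n%:R) (l%:R / Num.sqrt n%:R)).
Proof.
pose K w := Num.floor (X w); pose Y k w := Num.floor (Xs k w).
have XK := supported_floor X_int; have XY := Xs_floor Xs_iid X_int.
have [sq mean var] := moments XK X_mean X_var.
have mK : forall B : set int, measurable [set w | B (K w)] by exact: measurable_RV_floor.
have mY : forall k (B : set int), measurable [set w | B (Y k w)].
  by move=> k; exact: measurable_RV_floor.
pose lw (B : set int) := pr P0 [set w | B (K w)].
have indep : forall n (B : nat -> set int),
    pr P [set w | forall k, (k < n)%N -> B k (Y k w)] = \prod_(k < n) lw (B k).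
  exact: iid_prod Xs_iid.
have [m [m0 P0m P1m]] : exists m, [/\ (0 < m)%N, 0 < pr P [set w | Z Y m w = 0] &
    0 < pr P [set w | Z Y m w = 1]].
  have [n0 h0] := S_aperiodic 0; have [n1 h1] := S_aperiodic 1.
  (* A common time for the sites 0 and 1; the successor makes it positive, as [chf_lower] divides by
     m. *)
  pose m := (maxn n0 n1).+1.
  have pos (x : int) : (0 < P [set w | walk Xs m w = x%:~R])%E -> 0 < pr P [set w | Z Y m w = x].
    have mW : measurable [set w | walk Xs m w = x%:~R].
      exact: (measurable_walk Xs m (measurable_set1 (x%:~R : R))).
    by rewrite -(pr_walk_floor XY) (prE P mW) lte_fin.
  exists m; split=> //; apply: pos; [apply: h0|apply: h1]; rewrite /m ltnW // ltnS.
    exact: leq_maxl.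
  exact: leq_maxr.
pose g := Num.min (pr P [set w | Z Y m w = 0]) (pr P [set w | Z Y m w = 1]).
have g0 : 0 < g by rewrite lt_min P0m P1m.
have [c2 c20 flow] : exists2 c, 0 < c & forall N j, (1 < N)%N ->
    cn (chf P0 K (th R N j)) <= 1 - c * (1 - cos (th R N j)).
  by apply: (chf_lower mY mK indep m0 g0); rewrite /g ge_min lexx ?orbT.
have C10 : 0 < 6 * nu + 1 by rewrite addr_gt0 // mulr_gt0.
pose pp := residue_law lw.
have pg N x : 0 <= pp N x by exact: pr_ge0.
have ps : forall N, (0 < N)%N -> forall x, \sum_(r < N) pp N (x - r%:Z) = 1.
  exact: (residue_law_sum1 mY indep).
have pf := residue_law_fourier P0 mK.
have fu := chf_upper mK sq mean var.
have ft := chf_taylor mK sq mean var.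
have u0 := mu_0 P Y.
have uS := mu_S mY indep.
have ug := mu_ge0 P Y.
have ul := @mu_le1 _ _ _ P Y mY.
have us := @mu_sum_le1 _ _ _ P Y mY.
move=> kappa kappa0; split; apply: uniform_o1P => [n|e e0].
- exact: admissible_ex.
- have [n0 hn] := local_phi pg ps pf nu_gt0 C10 c20 fu flow ft u0 uS ug ul kappa0 e0.
  exists n0 => n nn [[x a] l] [l0 lk _ _].
  (* Here N goes to infinity, with n, x, a and l fixed; n0 was chosen before them. *)
  have := hn n nn x a l _ l0 lk (@mu_cvg _ _ _ P Y mY a n x l).
  by rewrite -(pr_site_floor XY).
- exact: admissible_ex.
- have [n0 hn] := local_psi pg ps pf nu_gt0 C10 c20 fu flow ft u0 uS ug us kappa0 e0.
  exists n0 => n nn [[x a] l] [l0 lk _ _].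
  have := hn n nn a l _ l0 lk (@mu_sum_cvg _ _ _ P Y mY a n l).
  by rewrite -(pr_occupation_floor XY).
Qed.
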